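(* There is an algorithm with the following guarantee. Let $\mathcal X\subseteq\mathbb R^d$ be a convex and compact set in isotropic position to which we have oracle access, $F:\mathcal X\to\mathbb R^d$ a mapping satisfying assumptions (i)–(ii) listed in the context with parameter $B$, and $\epsilon\in\mathbb Q_{>0}$. If $\mathrm{VI}(\mathcal X,F)$ is $(\lambda,\lambda-1)$-smooth with respect to a function $Q:\mathcal X\to\mathbb R$ (and some global maximizer of $Q$), where $\lambda\in\mathbb Q\cap(0,1]$, then the algorithm runs in time $\mathrm{poly}(d,\log(B/\epsilon),\log(1/\lambda))$ and returns a point $a\in\mathcal X$ such that $Q(a)\ge\max_{x\in\mathcal X}Q(x)-\epsilon$.
   Context: $\|\cdot\|$ is the Euclidean norm. Smoothness for VIs: let $\lambda>0$, $\nu>-1$, $Q:\mathcal X\to\mathbb R$, and let $x\in\mathcal X$ be a global maximum of $Q$. $\mathrm{VI}(\mathcal X,F)$ is $(\lambda,\nu)$-smooth with respect to $Q$ and $x$ if $$\langle F(x'),x'-x\rangle\ge\lambda Q(x)-(\nu+1)Q(x')\quad\text{for all }x'\in\mathcal X.$$ For $\nu=\lambda-1$ the right-hand side is $\lambda(Q(x)-Q(x'))$. The maximizer $x$ and the value $Q(x)$ are not known to the algorithm. Isotropic position: a uniformly random $x\in\mathcal X$ has $\mathbb E[x]=0$ and $\mathbb E[xx^\top]=I_d$; accordingly, $\mathcal B_1(0)\subseteq\mathcal X\subseteq\mathcal B_R(0)$ for some $R\le\mathrm{poly}(d)$, where $\mathcal B_r(0)$ is the closed Euclidean ball of radius $r$.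 Oracle access: the algorithm has a separation oracle for $\mathcal X$ which, given $x\in\mathbb Q^d$, either asserts $x\in\mathcal X$ or returns $c\in\mathbb Q^d$ with $\|c\|_\infty=1$ such that $\langle c,x'\rangle<\langle c,x\rangle$ for every $x'\in\mathcal X$; it also has oracle access to the values of $Q$ and $F$. Assumptions on $F$ (no continuity is assumed): (i) for every $x\in\mathcal X\cap\mathbb Q^d$, $F(x)$ is rational and can be evaluated exactly in $\mathrm{poly}(d)$ time, with bit length polynomial in that of $x$; (ii) $\|F(x)\|\le B$ for all $x\in\mathcal X$, $B\in\mathbb Q_{>0}$. The parameters $\lambda,\epsilon,B$ are given to the algorithm. *)

(* Defs.v *)
(* MathComp + MathComp-Analysis *)
From mathcomp Require Import all_boot all_order all_algebra.
From mathcomp Require Import all_classical all_reals all_analysis.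
Import Order.TTheory GRing.Theory Num.Theory.
Import numFieldNormedType.Exports.

Set Implicit Arguments.
Unset Strict Implicit.
Unset Printing Implicit Defensive.

Local Open Scope classical_set_scope.
Local Open Scope ring_scope.

(** * Euclidean geometry *)

Definition dot (R : realType) (d : nat) (u v : 'rV[R]_d) : R :=
  \sum_(i < d) u 0 i * v 0 i.

(* The norm that the library puts on ['rV_d] is the sup norm. *)
Definition enorm (R : realType) (d : nat) (v : 'rV[R]_d) : R :=
  Num.sqrt (dot v v).

Definition eball (R : realType) (d : nat) (r : R) : set 'rV[R]_d :=
  [set v | enorm v <= r].
Arguments eball {R} d r.

Definition ratv (R : realType) (d : nat) (v : 'rV[rat]_d) : 'rV[R]_d :=
  map_mx (@ratr R) v.
Arguments ratv R {d} v.

(* Lebesgue integral over R^d as an iterated integral (Fubini-Tonelli); the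
   integral over R^0 is evaluation at the unique point. *)
Fixpoint integral_rV (R : realType) (d : nat) : ('rV[R]_d -> \bar R) -> \bar R :=
  match d return ('rV[R]_d -> \bar R) -> \bar R with
  | 0%N => fun f => f 0
  | d'.+1 => fun f =>
      (\int[lebesgue_measure]_(t in [set: R])
         integral_rV (fun v : 'rV[R]_d' => f (row_mx (const_mx t : 'rV[R]_1) v)))%E
  end.

(* Expectation of [g x] for [x] uniform in [X]; meaningful for [X] of finite
   positive volume, which holds for the compact sets containing a ball that
   are considered below. *)
Definition uniform_expectation (R : realType) (d : nat) (X : set 'rV[R]_d)
    (g : 'rV[R]_d -> R) : R :=
  fine (integral_rV (fun v => (g v * \1_X v)%:E))
  / fine (integral_rV (fun v => (\1_X v : R)%:E)).

(* [pR] is the polynomial meant by "R <= poly(d)". *)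
Record isotropic (pR : {poly nat}) (R : realType) (d : nat)
    (X : set 'rV[R]_d) : Prop := Isotropic {
  isotropic_mean : forall i : 'I_d,
    uniform_expectation X (fun v => v 0 i) = 0 ;
  isotropic_cov : forall i j : 'I_d,
    uniform_expectation X (fun v => v 0 i * v 0 j) = (i == j)%:R ;
  isotropic_inner : eball d 1 `<=` X ;
  isotropic_outer : exists2 r : R, r <= pR.[d]%:R & X `<=` eball d r
}.

Definition global_max (R : realType) (d : nat) (X : set 'rV[R]_d)
    (Q : 'rV[R]_d -> R) (x : 'rV[R]_d) : Prop :=
  X x /\ forall y, X y -> Q y <= Q x.

(* [F] and [Q] are total functions of which only the restrictions to [X] are
   meaningful, here and below. *)
Definition smooth_VI (R : realType) (d : nat) (X : set 'rV[R]_d)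
    (F : 'rV[R]_d -> 'rV[R]_d) (lam nu : R) (Q : 'rV[R]_d -> R)
    (x : 'rV[R]_d) : Prop :=
  [/\ 0 < lam, -1 < nu, global_max X Q x &
      forall x', X x' -> dot (F x') (x' - x) >= lam * Q x - (nu + 1) * Q x'].

(** * Bit lengths *)

Definition bitlen (q : rat) : nat :=
  ((trunc_log 2 (absz (numq q))).+1 + (trunc_log 2 (absz (denq q))).+1)%N.

Definition bitlenv (d : nat) (v : 'rV[rat]_d) : nat :=
  (\sum_(i < d) bitlen (v 0%R i))%N.

(* max(0, ceil(log2 q)), for q > 0 *)
Definition clog2 (q : rat) : nat := up_log 2 (absz (Num.ceil q)).

(** * Oracles *)

(* The answers of [o_sep]: [None] asserts membership, [Some c] is a separating
   direction. [o_timeF x] is the time taken to evaluate F at [x]. *)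
Record oracles (R : realType) (d : nat) := Oracles {
  o_sep : 'rV[rat]_d -> option 'rV[rat]_d ;
  o_evalF : 'rV[rat]_d -> 'rV[rat]_d ;
  o_timeF : 'rV[rat]_d -> nat ;
  o_valQ : 'rV[rat]_d -> R
}.

Definition separation_oracle (R : realType) (d : nat) (X : set 'rV[R]_d)
    (sep : 'rV[rat]_d -> option 'rV[rat]_d) : Prop :=
  forall x : 'rV[rat]_d,
    match sep x with
    | None => X (ratv R x)
    | Some c => \big[Num.max/0]_(i < d) `|c 0 i| = 1 /\
        forall x', X x' -> dot (ratv R c) x' < dot (ratv R c) (ratv R x)
    end.

(* Nothing is said about evaluation outside [X]. *)
Definition F_evaluator (pL pT : {poly nat}) (R : realType) (d : nat)
    (X : set 'rV[R]_d) (F : 'rV[R]_d -> 'rV[R]_d)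
    (evalF : 'rV[rat]_d -> 'rV[rat]_d) (timeF : 'rV[rat]_d -> nat) : Prop :=
  forall x : 'rV[rat]_d, X (ratv R x) ->
    [/\ F (ratv R x) = ratv R (evalF x),
        (bitlenv (evalF x) <= pL.[bitlenv x])%N &
        (timeF x <= pT.[d])%N].

Definition Q_oracle (R : realType) (d : nat) (X : set 'rV[R]_d)
    (Q : 'rV[R]_d -> R) (valQ : 'rV[rat]_d -> R) : Prop :=
  forall x : 'rV[rat]_d, X (ratv R x) -> valQ x = Q (ratv R x).

(** * Algorithms *)

(* Random access machines over the rationals with logarithmic (bit) cost,
   presented as structured programs.  The memory is a sequence of cells holding
   rationals.  In addition there are registers for the real numbers
   returned by the value oracle of Q; all a program can do with these is to
   compare them. *)

(* [Dir n] is cell n; [Ind n] is the cell whose address is stored in cell n. *)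
Inductive loc := Dir of nat | Ind of nat.

Inductive binop := Add | Sub | Mul | Div | FloorDiv.

Inductive cond :=
  | Le of loc & loc      (* comparison of two cells *)
  | QLe of nat & nat.    (* comparison of two real registers *)

(* In the three oracle instructions the first argument is a cell containing
   the address of the block of d cells that holds the query point.
   The second argument of [Sep] and [EvalF] is a cell containing the address
   of the block that receives the answer; for [Sep], the answer is 1 (asserted
   to be in X), or 0 followed by the d entries of c.  The second argument of
   [EvalQ] is the real register that receives the answer. *)
Inductive com :=
  | Skip
  | Const of loc & rat
  | Op of binop & loc & loc & loc     (* destination first *)
  | Sep of nat & nat
  | EvalF of nat & nat
  | EvalQ of nat & nat
  | Seq of com & com
  | If of cond & com & com
  | While of cond & com.

Record state (R : realType) := State { mem : nat -> rat ; qreg : nat -> R }.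

Definition upd (T : Type) (m : nat -> T) (a : nat) (v : T) : nat -> T :=
  fun n => if n == a then v else m n.

Definition read_block (d : nat) (m : nat -> rat) (a : nat) : 'rV[rat]_d :=
  \row_(i < d) m (a + i)%N.

Definition write_block (d : nat) (m : nat -> rat) (a : nat) (v : 'rV[rat]_d) :
    nat -> rat :=
  fun n => if (a <= n)%N then
             if insub (n - a)%N is Some i then v 0 i else m n
           else m n.

Definition eval_loc (m : nat -> rat) (l : loc) : nat :=
  match l with Dir n => n | Ind n => Num.truncn (m n) end.

Definition eval_op (o : binop) (x y : rat) : rat :=
  match o with
  | Add => x + y
  | Sub => x - y
  | Mul => x * y
  | Div => x / y
  | FloorDiv => (Num.floor (x / y))%:~R
  end.

Definition eval_cond (R : realType) (s : state R) (c : cond) : bool :=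
  match c with
  | Le a b => mem s (eval_loc (mem s) a) <= mem s (eval_loc (mem s) b)
  | QLe i j => qreg s i <= qreg s j
  end.

(* [exec O c s t s']: started in [s], [c] terminates in [s'] after time [t].

   An arithmetic instruction is charged the bit length of the number it
   writes, an oracle query the bit length of the query point, and an
   evaluation of F, in addition, its running time and the bit length of the
   result.  The operands of an instruction are either earlier results, which
   have been charged already, or input numbers and answers of the separation
   oracle; hence a run of time t is simulated by a Turing machine in time
   polynomial in t and the lengths of the input and of these answers.
   Not charging for the length of the input is what makes it possible to
   bound the time in terms of log(B/eps) and log(1/lam) alone. *)
Inductive exec (R : realType) (d : nat) (O : oracles R d) :
    com -> state R -> nat -> state R -> Prop :=
  | ExecSkip s : exec O Skip s 1 s
  | ExecConst s l q :
      exec O (Const l q) s (1 + bitlen q)%N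
        (State (upd (mem s) (eval_loc (mem s) l) q) (qreg s))
  | ExecOp s o l l1 l2 :
      let v := eval_op o (mem s (eval_loc (mem s) l1))
                         (mem s (eval_loc (mem s) l2)) in
      exec O (Op o l l1 l2) s (1 + bitlen v)%N
        (State (upd (mem s) (eval_loc (mem s) l) v) (qreg s))
  | ExecSep s a b :
      let x := read_block d (mem s) (eval_loc (mem s) (Ind a)) in
      let r := eval_loc (mem s) (Ind b) in
      let m := match o_sep O x with
               | None => upd (mem s) r 1
               | Some c => write_block (upd (mem s) r 0) r.+1 c
               end in
      exec O (Sep a b) s (1 + bitlenv x)%N (State m (qreg s))
  | ExecEvalF s a b :
      let x := read_block d (mem s) (eval_loc (mem s) (Ind a)) in
      let y := o_evalF O x in
      exec O (EvalF a b) s (1 + bitlenv x + o_timeF O x + bitlenv y)%N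
        (State (write_block (mem s) (eval_loc (mem s) (Ind b)) y) (qreg s))
  | ExecEvalQ s a k :
      let x := read_block d (mem s) (eval_loc (mem s) (Ind a)) in
      exec O (EvalQ a k) s (1 + bitlenv x)%N
        (State (mem s) (upd (qreg s) k (o_valQ O x)))
  | ExecSeq c1 c2 s s1 s2 t1 t2 :
      exec O c1 s t1 s1 -> exec O c2 s1 t2 s2 ->
      exec O (Seq c1 c2) s (t1 + t2)%N s2
  | ExecIf b c1 c2 s t s' :
      exec O (if eval_cond s b then c1 else c2) s t s' ->
      exec O (If b c1 c2) s (1 + t)%N s'
  | ExecWhileDone b c s :
      ~~ eval_cond s b -> exec O (While b c) s 1 s
  | ExecWhileStep b c s s1 s2 t1 t2 :
      eval_cond s b -> exec O c s t1 s1 -> exec O (While b c) s1 t2 s2 ->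
      exec O (While b c) s (1 + t1 + t2)%N s2.

Definition init_state (R : realType) (d : nat) (lam eps B : rat) : state R :=
  State (fun n => match n with
                  | 0%N => d%:R
                  | 1%N => lam
                  | 2%N => eps
                  | 3%N => B
                  | _ => 0
                  end)
        (fun=> 0).

(* The output is the block whose address is in cell 0. *)
Definition output (R : realType) (d : nat) (s : state R) : 'rV[rat]_d :=
  read_block d (mem s) (eval_loc (mem s) (Ind 0)).

(* Main.v *)
(** A cutting-plane method with simplices, in exact rational arithmetic.  A
    simplex is kept that contains a small simplex S, of known volume, in the
    copy of X shrunk towards the maximizer.  At its centroid x the separation
    oracle is asked; either a direction c separating x from X, or else c = F x,
    cuts off the points y with <c, y> >= <c, x>.  Such a cut keeps S: in the
    second case, smoothness and |F x| <= B give <F x, x - y> > 0 for y close to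
    the maximizer, unless Q x is already within eps of the maximum.

    Let a i be the values of <c, .> at the vertices, s their average, a k the
    least of them and g = 8 d^2 (s - a k).  The part that is kept lies in the
    simplex obtained by sliding each vertex i along the ray from vertex k by a
    factor t i >= g / (a i - s + g).  If t i is this number rounded up to a
    multiple of 1/D, D = 32 d^3, then the volume decreases by the factor
    (1 - 1/D)^d at least, and after n steps the coordinates are multiples of
    D^-n of size at most 3^n times the initial one, hence of polynomial length.
    The answers of the separation oracle, whose length is not bounded, are
    rounded to multiples of a tolerance that decreases geometrically.

    An initial simplex is provided by the box of radius 2^(d+1): if p maximizes
    |x_i| on X, then the copy of X scaled by 1/4 towards p has volume 4^-d vol X
    and lies where |x_i| >= |p_i| / 2, so that E[x_i^2] = 1 bounds |p_i|. *)

From HB Require Import structures.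
Require Import Defs.
From mathcomp Require Import all_boot all_order all_algebra fingroup perm.
From mathcomp Require Import all_classical all_reals all_analysis measurable_realfun.
From mathcomp Require Import ring lra zify.
Import Order.TTheory GRing.Theory Num.Theory.
Import numFieldNormedType.Exports.

Set Implicit Arguments.
Unset Strict Implicit.
Unset Printing Implicit Defensive.

Local Open Scope classical_set_scope.
Local Open Scope ring_scope.

(** * Integrals of functions that need not be measurable *)

(* The definition of [integral_rV] integrates inner integrals that are not known
   to be measurable; for nonnegative functions the integral is still the
   supremum of the integrals of simple functions below, which gives these
   inequalities (only). *)
Section nonmeasurable_integral.
Context {R : realType}.
Local Open Scope ereal_scope.
Local Notation mu := (@lebesgue_measure R).

Import HBNNSimple.

Lemma ge0_le_integral_nomeas (f g : R -> \bar R) :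
  (forall t, 0 <= f t) -> (forall t, f t <= g t) ->
  \int[mu]_(t in setT) f t <= \int[mu]_(t in setT) g t.
Proof.
move=> f0 fg; have g0 t : 0 <= g t by exact: le_trans (fg t).
rewrite !ge0_integralTE//; apply: ereal_sup_le => _ [h hf <-].
by exists h => // t; exact: le_trans (hf t) (fg t).
Qed.

Lemma integral_nomeas_le (f : R -> \bar R) (y : \bar R) :
  (forall t, 0 <= f t) ->
  (forall h : {nnsfun measurableTypeR R >-> R}, (forall t, (h t)%:E <= f t) ->
     \int[mu]_(t in setT) (h t)%:E <= y) ->
  \int[mu]_(t in setT) f t <= y.
Proof.
move=> f0 H; rewrite ge0_integralTE//; apply: ge_ereal_sup => _ [h hf <-].
by have := H _ hf; rewrite (integralT_nnsfun mu h).
Qed.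

Lemma ge0_integralZl_nomeas (f : R -> \bar R) (k : R) :
  (forall t, 0 <= f t) -> (0 < k)%R ->
  k%:E * \int[mu]_(t in setT) f t <= \int[mu]_(t in setT) (k%:E * f t).
Proof.
move=> f0 k0; rewrite -lee_pdivlMl//; apply: integral_nomeas_le => // h hf.
rewrite lee_pdivlMl//.
have mh : measurable_fun setT (EFin \o h) by exact/measurable_EFinP.
have h0 (t : measurableTypeR R) : [set: measurableTypeR R] t -> 0 <= (EFin \o h) t.
  by move=> _; rewrite lee_fin.
have k0' : 0 <= k%:E by rewrite lee_fin ltW.
rewrite -(ge0_integralZl mu measurableT mh h0 k0').
apply: ge0_le_integral_nomeas => t.
  by rewrite mule_ge0// lee_fin// ltW.
by rewrite lee_pmul2l//; exact: hf.
Qed.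

Let aff (a s : R) : measurableTypeR R -> measurableTypeR R :=
  fun t => ((t - a) / s)%R.

Let measurable_aff a s : measurable_fun setT (aff a s).
Proof. by apply: measurable_funM => //; apply: measurable_funB. Qed.

Let image_lebesgue a s : {measure set (measurableTypeR R) -> \bar R} :=
  measure_function_pushforward__canonical__measure_function_Measure
    mu (measurable_aff a s).

Let scaled_image a (s : R) (s0 : (0 <= s^-1)%R) :
    {measure set (measurableTypeR R) -> \bar R} :=
  mscale (NngNum s0) (image_lebesgue a s).

Let lebesgue_measure_aff (a s : R) (s0 : (0 < s)%R) (s1 : (0 <= s^-1)%R) A :
  measurable A -> mu A = scaled_image a s1 A.
Proof.
move=> mA; apply: lebesgue_measure_unique => // _ [[x y]/= _ <-].
rewrite /mscale/= /pushforward/=.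
rewrite (_ : _ @^-1` _ = `](a + s * x)%R, (a + s * y)%R]%classic); last first.
  apply/seteqP; split => t /=; rewrite !in_itv/= /aff ltr_pdivlMr// ler_pdivrMr//;
  by rewrite ltrBrDl lerBlDl ![(s * _)%R]mulrC.
rewrite !lebesgue_measure_itv/= !lte_fin ltrD2l ltr_pM2l//.
case: ifPn => _; last by rewrite mule0.
rewrite -!EFinD -EFinM; congr EFin.
by rewrite opprD addrACA subrr add0r -mulrBr mulKf// gt_eqF.
Qed.

Lemma ge0_integral_affine_nomeas (f : R -> \bar R) (a s : R) :
  (forall t, 0 <= f t) -> (0 < s)%R ->
  s%:E * \int[mu]_(t in setT) f t <= \int[mu]_(t in setT) f ((t - a) / s)%R.
Proof.
move=> f0 s0; rewrite -lee_pdivlMl//; apply: integral_nomeas_le => // h hf.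
have s1 : (0 <= s^-1)%R by rewrite invr_ge0 ltW.
have mh : measurable_fun setT (EFin \o h) by exact/measurable_EFinP.
have h0 (t : measurableTypeR R) : [set: measurableTypeR R] t -> 0 <= (EFin \o h) t.
  by move=> _; rewrite lee_fin.
rewrite (@eq_measure_integral _ _ _ _ (scaled_image a s1) mu); last first.
  by move=> A mA _; exact: lebesgue_measure_aff.
rewrite (ge0_integral_mscale _ measurableT _ mh h0)/=.
rewrite lee_pmul2l//=; last by rewrite lte_fin invr_gt0.
rewrite (ge0_integral_pushforward (measurable_aff a s) mu measurableT mh)//=; last first.
  by move=> t _; rewrite lee_fin.
apply: ge0_le_integral_nomeas => t /=; first by rewrite lee_fin.
exact: hf.
Qed.

End nonmeasurable_integral.

Lemma convex_setP (R : realType) (V : lmodType R) (X : set V) (x y : V) (l : R) :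
  convex_set X -> X x -> X y -> 0 <= l -> l <= 1 -> X (l *: x + (1 - l) *: y).
Proof.
move=> cX Xx Xy l0 l1.
have l01 : Itv.spec (@Itv.num_sem R) (Itv.Real `[0%Z, 1%Z]) l.
  by apply/and3P; split; rewrite /= ?bnd_simp ?l0 ?l1 ?num_real.
have := cX x y (Itv.mk l01); rewrite !inE => /(_ Xx Xy).
by [].
Qed.

Section iterated_integral.
Context {R : realType}.
Local Open Scope ereal_scope.

Lemma integral_rV_ge0 d (f : 'rV[R]_d -> \bar R) :
  (forall v, 0 <= f v) -> 0 <= integral_rV f.
Proof.
elim: d f => [|d IH] f f0 /=; first exact: f0.
by apply: integral_ge0 => t _; apply: IH.
Qed.

Lemma ge0_le_integral_rV d (f g : 'rV[R]_d -> \bar R) :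
  (forall v, 0 <= f v) -> (forall v, f v <= g v) ->
  integral_rV f <= integral_rV g.
Proof.
elim: d f g => [|d IH] f g f0 fg /=; first exact: fg.
apply: ge0_le_integral_nomeas => t; first exact: integral_rV_ge0.
exact: IH.
Qed.

Lemma ge0_integral_rVZl d (f : 'rV[R]_d -> \bar R) (k : R) :
  (forall v, 0 <= f v) -> (0 < k)%R ->
  k%:E * integral_rV f <= integral_rV (fun v => k%:E * f v).
Proof.
move=> f0 k0; elim: d f f0 => [|d IH] f f0 //=.
apply: le_trans (ge0_integralZl_nomeas _ k0) _.
  by move=> t; exact: integral_rV_ge0.
apply: ge0_le_integral_nomeas => t; last exact: IH.
by rewrite mule_ge0 ?lee_fin ?(ltW k0)//; exact: integral_rV_ge0.
Qed.

Lemma ge0_integral_rV_affine d (f : 'rV[R]_d -> \bar R) (a : 'rV[R]_d) (s : R) :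
  (forall v, 0 <= f v) -> (0 < s)%R ->
  (s ^+ d)%:E * integral_rV f <= integral_rV (fun v => f (s^-1 *: (v - a))%R).
Proof.
move=> f0 s0; elim: d f f0 a => [|d IH] f f0 a /=.
  by rewrite expr0 mul1e [(_ *: _)%R]thinmx0.
have J0 t : 0 <= integral_rV (fun v : 'rV[R]_d =>
    f (row_mx (const_mx t : 'rV[R]_1) v)) by exact: integral_rV_ge0.
rewrite exprSr EFinM -muleA.
have sd0 : 0 <= (s ^+ d)%:E by rewrite lee_fin exprn_ge0// ltW.
apply: le_trans (lee_wpmul2l sd0 (ge0_integral_affine_nomeas (a 0%R 0%R) J0 s0)) _.
apply: le_trans (ge0_integralZl_nomeas _ _) _; [by move=> t; exact: J0|exact: exprn_gt0|].
apply: ge0_le_integral_nomeas => t.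
  by rewrite mule_ge0 ?lee_fin ?exprn_ge0 ?(ltW s0).
apply: le_trans (IH _ _ (rsubmx (a : 'rV_(1 + d)))) _; first by move=> v.
rewrite le_eqVlt; apply/orP; left; apply/eqP; congr integral_rV.
apply/funext => v; congr f.
apply/rowP => j; rewrite !mxE; case: splitP => k jk; rewrite !mxE.
  rewrite mulrC (_ : j = 0%R)//; apply/val_inj.
  by rewrite /= jk (ord1 k).
by rewrite (_ : j = rshift 1 k)//; exact/val_inj.
Qed.

End iterated_integral.

Lemma isotropic_box (pR : {poly nat}) (R : realType) d (X : set 'rV[R]_d) :
  convex_set X -> compact X -> isotropic pR X ->
  forall v, X v -> forall i, `|v 0 i| <= 2 ^+ d.+1.
Proof.
move=> cvX cpX iso v Xv i.
have [||p Xp pmax] := @EVT_max_rV R d (fun v => `|v 0 i|) X _ cpX.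
- by exists v.
- apply: continuous_subspaceT => x.
  apply: (@continuous_comp _ _ _ (fun v : 'rV[R]_d => v 0 i) (fun t : R => `|t|)).
    exact: coord_continuous.
  exact: norm_continuous.
move: Xp; rewrite inE => Xp.
apply: le_trans (pmax v _) _; first by rewrite inE.
have {}pmax u : X u -> `|u 0 i| <= `|p 0 i| by move=> Xu; apply: pmax; rewrite inE.
set h := `|p 0 i| in pmax *.
have h0 : 0 <= h by exact: normr_ge0.
have hp : p 0 i = h \/ p 0 i = - h.
  by rewrite /h; case: ler0P => _; [right; rewrite opprK|left].
clearbody h.
case: (ltrP 0 h) => [hgt|]; last by move/le_trans; apply; apply: exprn_ge0.
pose s : R := 4^-1.
have s0 : 0 < s by rewrite invr_gt0.
pose one_X (u : 'rV[R]_d) : \bar R := (\1_X u)%:E.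
have one_X0 u : (0 <= one_X u)%E by rewrite lee_fin indicE.
pose f (u : 'rV[R]_d) : \bar R := (u 0 i * u 0 i * \1_X u)%:E.
have f0 u : (0 <= f u)%E by rewrite lee_fin mulr_ge0// -expr2 sqr_ge0.
have le1 : ((h ^+ 2 / 4)%:E * ((s ^+ d)%:E * integral_rV one_X) <= integral_rV f)%E.
  have k0 : 0 < h ^+ 2 / 4 by rewrite divr_gt0// exprn_gt0.
  have k0' : (0 <= (h ^+ 2 / 4)%:E)%E by rewrite lee_fin ltW.
  apply: le_trans (lee_wpmul2l k0' (ge0_integral_rV_affine ((1 - s) *: p) one_X0 s0)) _.
  apply: le_trans (ge0_integral_rVZl _ k0) _ => //.
  apply: ge0_le_integral_rV => u.
    by rewrite mule_ge0// lee_fin ltW.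
  rewrite -EFinM lee_fin !indicE.
  case: (boolP (_ \in X)) => [|_]; last first.
    by rewrite mulr0 mulr_ge0// -expr2 sqr_ge0.
  rewrite inE; set y := s^-1 *: _ => Xy.
  have -> : u = s *: y + (1 - s) *: p.
    by rewrite /y scalerA mulfV ?gt_eqF// scale1r subrK.
  clearbody y.
  have -> : (s *: y + (1 - s) *: p) \in X.
    by rewrite inE; apply: convex_setP => //; rewrite /s; lra.
  rewrite !mulr1 !mxE -expr2.
  have /ler_normlP [y1 y2] := pmax _ Xy.
  have sq (w : R) : h / 2 <= w -> h ^+ 2 / 4 <= w ^+ 2.
    move=> hw; rewrite (_ : h ^+ 2 / 4 = (h / 2) ^+ 2); last by field.
    by rewrite ler_sqr ?nnegrE//; lra.
  case: hp => ->; first by apply: sq; rewrite /s; lra.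
  by rewrite -[leRHS]sqrrN; apply: sq; rewrite /s; lra.
have := isotropic_cov iso i i; rewrite eqxx /uniform_expectation.
rewrite -/f -/one_X /= => cov.
have V0 : fine (integral_rV one_X) != 0.
  by apply: contra_eq_neq cov => ->; rewrite invr0 mulr0 eq_sym oner_eq0.
have fV : fine (integral_rV f) = fine (integral_rV one_X).
  by move: cov; rewrite mulr1n => /(canRL (divfK V0)); rewrite mul1r.
move: (integral_rV_ge0 one_X0) (integral_rV_ge0 f0) V0 fV le1.
case: (integral_rV one_X) => [V||]//=; last by rewrite eqxx.
case: (integral_rV f) => [W||]//= V0 _ Vn0 WV; last by rewrite -WV eqxx in Vn0.
rewrite WV -!EFinM lee_fin => le1.
have Vgt : 0 < V by rewrite lt_neqAle eq_sym Vn0 -lee_fin.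
have : h ^+ 2 / 4 * s ^+ d <= 1.
  by move: le1; rewrite mulrA -[leRHS]mul1r ler_pM2r.
rewrite /s exprVn ler_pdivrMr ?exprn_gt0// mul1r ler_pdivrMr// -exprSr.
have -> : (4 : R) ^+ d.+1 = (2 ^+ d.+1) ^+ 2 by rewrite -exprM mulnC exprM; congr (_ ^+ _); ring.
by rewrite ler_pXn2r// nnegrE ?exprn_ge0.
Qed.

(** * Volumes of simplices *)

Section simplex.
Context {R : realFieldType} {d : nat}.

Definition homog (V : 'M[R]_(1 + d, d)) : 'M[R]_(1 + d) := row_mx (const_mx 1) V.

Definition in_simplex (V : 'M[R]_(1 + d, d)) (p : 'rV[R]_d) : Prop :=
  exists2 l : 'I_(1 + d) -> R,
    (forall i, 0 <= l i) /\ \sum_i l i = 1 &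
    forall j, p 0 j = \sum_i l i * V i j.

Definition corner (q : 'rV[R]_d) (s : R) : 'M[R]_(1 + d, d) :=
  \matrix_(i, j) (q 0 j + s *+ (i == lift ord0 j)).

Lemma det_corner q s : \det (homog (corner q s)) = s ^+ d.
Proof.
have -> : homog (corner q s) =
    block_mx (1%:M : 'M[R]_1) 0 (const_mx 1 : 'M[R]_(d, 1)) (1%:M : 'M[R]_d)
    *m block_mx (1%:M : 'M[R]_1) q 0 s%:M.
  rewrite mulmx_block !mul1mx !mulmx1 !mul0mx !addr0.
  apply/matrixP => i j; rewrite !mxE; case: splitP => j' Hj; rewrite !mxE.
    case: splitP => i' Hi; rewrite !mxE; case: splitP => j'' Hj'; rewrite ?mxE //.
    - by rewrite !ord1.
    - by have := ltn_ord j'; rewrite -Hj Hj'.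
    - by have := ltn_ord j'; rewrite -Hj Hj'.
  case: splitP => i' Hi; rewrite !mxE; case: splitP => j'' Hj'; rewrite ?mxE //.
  - by have := ltn_ord j''; rewrite -Hj' Hj.
  - rewrite (_ : _ == _ = false) ?addr0; last first.
      by apply/eqP => /(congr1 val) /=; rewrite Hi (ord1 i') /bump.
    by rewrite (ord1 i'); congr (q 0 _); apply/val_inj; move: Hj'; rewrite Hj => -[].
  - by have := ltn_ord j''; rewrite -Hj' Hj.
  - have -> : j'' = j' by apply/val_inj; move: Hj'; rewrite Hj => -[].
    rewrite big_ord1 !mxE mul1r; congr (_ + s *+ _).
    rewrite -val_eqE /= Hi /bump /= add1n add1n eqSS eq_sym -val_eqE eq_sym //.
by rewrite det_mulmx det_lblock det_ublock !det1 !mul1r det_scalar.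
Qed.

Lemma det_move_vertices (V V' : 'M[R]_(1 + d, d)) (k : 'I_(1 + d))
    (t : 'I_(1 + d) -> R) :
  (forall i j, V' i j = V k j + t i * (V i j - V k j)) ->
  \det (homog V') = (\prod_(i < d) t (lift k i)) * \det (homog V).
Proof.
move=> HV'.
pose T : 'M[R]_(1 + d) := \matrix_(i, j) (t i *+ (i == j) + (1 - t i) *+ (j == k)).
have TE (f : 'I_(1 + d) -> R) i : \sum_l T i l * f l = f k + t i * (f i - f k).
  under eq_bigr => l _ do rewrite mxE mulrDl !mulrnAl.
  rewrite big_split/= (bigD1 i)//= eqxx mulr1n big1 => [|l /negbTE]; last first.
    by rewrite eq_sym => ->; rewrite mulr0n.
  rewrite (bigD1 k)//= eqxx mulr1n big1 => [|l /negbTE ->//].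
  by rewrite mulrBr mulrBl mul1r; ring.
have -> : homog V' = T *m homog V.
  apply/matrixP => i j; rewrite [RHS]mxE TE !mxE.
  by case: splitP => j' _; rewrite ?mxE ?subrr ?mulr0 ?addr0.
rewrite det_mulmx; congr (_ * _).
rewrite (expand_det_row _ k) (bigD1 k)//= big1 ?addr0; last first.
  by move=> j jk; rewrite mxE eq_sym (negbTE jk) addr0 mul0r.
rewrite mxE eqxx !mulr1n subrKC mul1r /cofactor addnn -signr_odd odd_double mul1r.
rewrite (_ : row' k (col' k T) = diag_mx (\row_i t (lift k i))).
  by rewrite det_diag; apply: eq_bigr => i _; rewrite mxE.
apply/matrixP => i j; rewrite !mxE (inj_eq lift_inj).
by rewrite [lift k j == k]eq_sym (negbTE (neq_lift _ _)) addr0.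
Qed.

Lemma in_simplex_move (V V' : 'M[R]_(1 + d, d)) (k : 'I_(1 + d))
    (t r : 'I_(1 + d) -> R) (p : 'rV[R]_d) (l : 'I_(1 + d) -> R) :
  (forall i j, V' i j = V k j + t i * (V i j - V k j)) ->
  (forall i, 0 < t i) -> (forall i, (t i)^-1 <= 1 + r i) -> -1 <= r k ->
  (forall i, 0 <= l i) -> \sum_i l i = 1 ->
  (forall j, p 0 j = \sum_i l i * V i j) ->
  \sum_i l i * r i <= 0 ->
  in_simplex V' p.
Proof.
move=> HV' t0 tr rk l0 l1 pl lr.
pose m i := if i == k then 1 - \sum_(i | i != k) l i / t i else l i / t i.
have mE (f : 'I_(1 + d) -> R) :
    \sum_i m i * f i = (1 - \sum_(i | i != k) l i / t i) * f k +
                       \sum_(i | i != k) l i / t i * f i.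
  rewrite (bigD1 k)//= /m eqxx; congr (_ + _).
  by apply: eq_bigr => i /negbTE ->.
exists m.
- split=> [i|].
    rewrite /m; case: ifPn => _; last by rewrite divr_ge0// ltW.
    rewrite subr_ge0.
    have : \sum_(i0 | i0 != k) l i0 / t i0 <= \sum_(i0 | i0 != k) l i0 * (1 + r i0).
      by apply: ler_sum => i0 _; rewrite ler_wpM2l.
    move/le_trans; apply.
    under eq_bigr => i0 _ do rewrite mulrDr mulr1.
    rewrite big_split/=.
    move: l1 lr; rewrite (bigD1 k)//= [X in X <= 0](bigD1 k)//=.
    have := l0 k; set a := \sum_(_ | _) l _; set b := \sum_(_ | _) _.
    by move: (l k) => x; nra.
  have := mE (fun=> 1); under eq_bigr do rewrite mulr1; move=> ->.
  by under [X in _ + X]eq_bigr do rewrite mulr1; rewrite mulr1 subrK.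
move=> j; rewrite mE pl.
rewrite (eq_bigr (fun i => l i * V k j + l i * (V i j - V k j))); last first.
  by move=> i _; rewrite -mulrDr subrKC.
rewrite big_split/= -mulr_suml l1 mul1r HV' subrr mulr0 addr0 mulrBl mul1r.
rewrite -addrA; congr (_ + _).
rewrite mulr_suml addrC -sumrB (bigD1 k)//= subrr mulr0 add0r.
apply: eq_bigr => i _; rewrite HV' -mulrBr addrAC subrr add0r mulrA divfK//.
by rewrite gt_eqF.
Qed.

(* The Leibniz formula bounds the determinant of a row-stochastic matrix by
   the number of permutations. *)
Lemma simplex_volume (V : 'M[R]_(1 + d, d)) (q : 'rV[R]_d) (s : R) :
  0 <= s ->
  (forall i, in_simplex V (row i (corner q s))) ->
  s ^+ d <= (d.+1)`!%:R * `|\det (homog V)|.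
Proof.
move=> s0 H.
have /choice [L HL] : forall i, exists l : 'I_(1 + d) -> R,
    [/\ forall i, 0 <= l i, \sum_i l i = 1 &
     forall j, corner q s i j = \sum_i l i * V i j].
  move=> i; have [l [l0 l1] lE] := H i; exists l; split => // j.
  by rewrite -lE [RHS]mxE.
pose M : 'M[R]_(1 + d) := \matrix_(i, j) L i j.
have MV : homog (corner q s) = M *m homog V.
  apply/matrixP => i j; rewrite [RHS]mxE mxE.
  have [L0 L1 LE] := HL i; case: splitP => j' Hj.
    rewrite mxE -[LHS]L1; apply: eq_bigr => i' _; rewrite !mxE.
    case: splitP => j'' Hj'; first by rewrite mxE mulr1.
    by have := ltn_ord j'; rewrite -Hj Hj'.
  rewrite LE; apply: eq_bigr => i' _; rewrite !mxE.
  case: splitP => j'' Hj'; first by have := ltn_ord j''; rewrite -Hj' Hj.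
  by congr (_ * V i' _); apply/val_inj; move: Hj'; rewrite Hj => -[].
have L01 i j : 0 <= L i j <= 1.
  have [L0 L1 _] := HL i; rewrite L0/= -L1 (bigD1 j)//= lerDl.
  by apply: sumr_ge0.
rewrite -(det_corner q) -[leLHS]ger0_norm ?det_corner ?exprn_ge0//.
rewrite -(det_corner q) MV det_mulmx normrM ler_wpM2r//.
apply: le_trans (ler_norm_sum _ _ _) _.
rewrite -(card_Sn d.+1) -sumr_const ler_sum// => g _.
rewrite normrM normrX normrN1 expr1n mul1r normr_prod.
apply: prodr_ile1 => i _; rewrite !mxE normr_ge0/=.
by have /andP[L0 L1] := L01 i (g i); rewrite ger0_norm.
Qed.

End simplex.

Lemma prod_shrink (R : realFieldType) (d : nat) (y t : 'I_d -> R) :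
  (0 < d)%N -> (forall i, -1 <= y i) -> \sum_i y i = 1 ->
  (forall i, 0 <= t i) ->
  (forall i, t i <= (1 + y i / (8 * d%:R ^+ 2))^-1 + (32 * d%:R ^+ 3)^-1) ->
  \prod_i t i <= (1 - (32 * d%:R ^+ 3)^-1) ^+ d.
Proof.
move=> d0 y1 ys t0 tle.
have dR : 1 <= d%:R :> R by rewrite ler1n.
have dR0 : d%:R != 0 :> R by rewrite pnatr_eq0 -lt0n.
set mu : R := (8 * d%:R ^+ 2)^-1.
have mu0 : 0 < mu by rewrite invr_gt0 mulr_gt0// exprn_gt0// ltr0n.
have mu8 : mu <= 1 / 8.
  rewrite /mu div1r lef_pV2 ?posrE ?mulr_gt0 ?exprn_gt0 ?ltr0n//.
  by rewrite -[leLHS]mulr1 ler_wpM2l// exprn_ege1.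
have mud : mu * (8 * d%:R ^+ 2) = 1 by rewrite mulVf// mulf_neq0// expf_neq0.
have Dmu : (32 * d%:R ^+ 3)^-1 = mu / (4 * d%:R).
  by rewrite /mu; field; rewrite dR0.
have ysq : \sum_i (y i) ^+ 2 <= 2 * d%:R ^+ 2.
  have S i : 0 <= y i + 1 by have := y1 i; lra.
  have Ssum : \sum_i (y i + 1) = d%:R + 1.
    by rewrite big_split/= ys sumr_const card_ord addrC.
  have : \sum_i (y i + 1) ^+ 2 <= \sum_i (y i + 1) * (d%:R + 1).
    apply: ler_sum => i _; rewrite expr2 ler_wpM2l// -Ssum (bigD1 i)//= lerDl.
    exact: sumr_ge0.
  rewrite -mulr_suml Ssum.
  rewrite (eq_bigr (fun i => y i ^+ 2 + (2 * y i + 1))); last by move=> i _; ring.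
  rewrite !big_split/= -mulr_sumr ys sumr_const card_ord mulr1.
  set z := \sum_(_ | _) _; clearbody z; move: dR; set x : R := d%:R; clearbody x.
  nra.
have t1 i : t i <= 1 - mu * y i + 2 * mu ^+ 2 * y i ^+ 2 + mu / (4 * d%:R).
  apply: le_trans (tle i) _; rewrite Dmu lerD2r.
  have z1 : -1/8 <= mu * y i by have := y1 i; nra.
  rewrite [y i / _]mulrC -/mu.
  rewrite -[leLHS]mul1r ler_pdivrMr; last by lra.
  rewrite -subr_ge0.
  rewrite (_ : _ - _ = (mu * y i) ^+ 2 * (1 + 2 * (mu * y i))); last by ring.
  by rewrite mulr_ge0 ?sqr_ge0//; lra.
have ts : \sum_i t i <= d%:R * (1 - (32 * d%:R ^+ 3)^-1).
  apply: le_trans (ler_sum _ (fun i _ => t1 i)) _.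
  rewrite !big_split/= sumr_const card_ord sumrN -!mulr_sumr ys sumr_const card_ord.
  rewrite Dmu -[_^-1 *+ d]mulr_natr.
  have -> : mu * ((4 * d%:R)^-1 * d%:R) = mu / 4 by field.
  have -> : d%:R * (1 - mu / (4 * d%:R)) = d%:R - mu / 4 by field.
  have : mu ^+ 2 * (\sum_i y i ^+ 2) <= mu ^+ 2 * (2 * d%:R ^+ 2).
    by rewrite ler_wpM2l// sqr_ge0.
  rewrite (_ : mu ^+ 2 * (2 * d%:R ^+ 2) = mu / 4 * (mu * (8 * d%:R ^+ 2))); last by field.
  by rewrite mud; lra.
have := (@leif_AGM R _ predT t (fun i _ => t0 i)).1; rewrite card_ord => /le_trans; apply.
rewrite lerXn2r ?nnegrE//.
- by rewrite divr_ge0// sumr_ge0.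
- rewrite subr_ge0 invf_le1 ?mulr_gt0 ?exprn_gt0 ?ltr0n//.
  by rewrite -[leLHS]mul1r ler_pM// ?exprn_ege1// ler1n.
by rewrite ler_pdivrMr ?ltr0n// mulrC.
Qed.

Lemma half_exp (R : realFieldType) (D k : nat) : (0 < D)%N ->
  (1 - D%:R^-1 : R) ^+ (D * k) <= 2^-1 ^+ k.
Proof.
move=> D0; rewrite exprM.
have D1 : D%:R^-1 <= 1 :> R by rewrite invf_le1 ?ltr0n// ler1n.
set x : R := D%:R^-1 in D1 *.
have x0 : 0 <= x by rewrite invr_ge0.
have bern n : 1 + n%:R * x <= (1 + x) ^+ n.
  elim: n => [|n IH]; first by rewrite mul0r addr0 expr0.
  rewrite exprS -natr1; apply: le_trans (ler_wpM2l _ IH); last by lra.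
  have : 0 <= (n%:R : R) by [].
  by set m : R := n%:R; nra.
apply: lerXn2r; rewrite ?nnegrE ?exprn_ge0//; first by lra.
have two : 2 <= (1 + x) ^+ D.
  by apply: le_trans (bern D); rewrite /x mulfV ?pnatr_eq0 -?lt0n//; lra.
have : (1 - x) ^+ D * (1 + x) ^+ D <= 1.
  rewrite -exprMn; apply: exprn_ile1; nra.
have : 0 <= (1 - x) ^+ D by rewrite exprn_ge0//; lra.
move: ((1 - x) ^+ D) ((1 + x) ^+ D) two => a b; nra.
Qed.

(** * Time-bounded execution of programs *)

Declare Scope com_scope.
Delimit Scope com_scope with com.
Notation "c1 ;; c2" := (Seq c1 c2) (at level 90, right associativity) : com_scope.

(* Cells: 0 d, 1 lam, 2 eps, 3 B, 4 zero, 5 one, 6 d - 1, 7-12 block addresses,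
   13 and 14 the parameters D and G = 8 d^2, 15 the rounding tolerance, 16 the
   counter of the main loop and 17 its bound, 18-26 scratch (18 and 19 are the
   counters of the inner loops), 27 d + 1, 28 four, 29-38 used only initially. *)
Definition For (i hi : nat) (body : com) : com :=
  Seq (Const (Dir i) 0)
      (While (Le (Dir i) (Dir hi)) (Seq body (Op Add (Dir i) (Dir i) (Dir 5)))).

Section runs.
Context {R : realType} {d : nat} (O : oracles R d) (C : nat).
Implicit Types (m : nat -> rat) (q : nat -> R) (P : (nat -> rat) -> (nat -> R) -> Prop).

(* Time is counted in multiples of [C], a bound on the cost of one instruction. *)
Definition runs (c : com) m q (n : nat) P : Prop :=
  exists t m' q', [/\ exec O c (State m q) t (State m' q'), (t <= n * C)%N & P m' q'].

Definition small (x : rat) : Prop := (1 + bitlen x <= C)%N.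

Lemma runs_weak c m q n n' P P' :
  runs c m q n P -> (n <= n')%N -> (forall m' q', P m' q' -> P' m' q') ->
  runs c m q n' P'.
Proof.
move=> [t [m' [q' [e tn p]]]] nn' PP'; exists t, m', q'; split => //; last exact: PP'.
by rewrite (leq_trans tn)// leq_mul2r nn' orbT.
Qed.

Lemma runs_le c m q n n' P :
  runs c m q n P -> (n <= n')%N -> runs c m q n' P.
Proof. by move=> r nn'; apply: runs_weak r nn' _. Qed.

Lemma runs_skip m q P : (0 < C)%N -> P m q -> runs Skip m q 1 P.
Proof. by move=> C0 p; exists 1%N, m, q; split => //; [constructor|rewrite mul1n]. Qed.

Lemma runs_const l x a m q P : eval_loc m l = a -> small x ->
  P (upd m a x) q -> runs (Const l x) m q 1 P.
Proof.
move=> <- sx p; exists (1 + bitlen x)%N, (upd m (eval_loc m l) x), q.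
by split => //; [exact: (ExecConst O (State m q))|rewrite mul1n].
Qed.

Lemma runs_op o l l1 l2 a x m q P :
  eval_op o (m (eval_loc m l1)) (m (eval_loc m l2)) = x ->
  eval_loc m l = a -> small x ->
  P (upd m a x) q -> runs (Op o l l1 l2) m q 1 P.
Proof.
move=> <- <- sx p; eexists _, _, q; split; last exact: p.
  exact: (ExecOp O (State m q)).
by rewrite mul1n.
Qed.

Lemma runs_sep a b x r m q P :
  read_block d m (eval_loc m (Ind a)) = x -> eval_loc m (Ind b) = r ->
  (1 + bitlenv x <= C)%N ->
  P (match o_sep O x with
     | None => upd m r 1
     | Some c => write_block (upd m r 0) r.+1 c
     end) q ->
  runs (Sep a b) m q 1 P.
Proof.
move=> <- <- sx p; eexists _, _, q; split; last exact: p.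
  exact: (ExecSep O (State m q)).
by rewrite mul1n.
Qed.

Lemma runs_evalF a b x r m q P :
  read_block d m (eval_loc m (Ind a)) = x -> eval_loc m (Ind b) = r ->
  (1 + bitlenv x + o_timeF O x + bitlenv (o_evalF O x) <= C)%N ->
  P (write_block m r (o_evalF O x)) q ->
  runs (EvalF a b) m q 1 P.
Proof.
move=> <- <- sx p; eexists _, _, q; split; last exact: p.
  exact: (ExecEvalF O (State m q)).
by rewrite mul1n.
Qed.

Lemma runs_evalQ a k x m q P :
  read_block d m (eval_loc m (Ind a)) = x ->
  (1 + bitlenv x <= C)%N ->
  P m (upd q k (o_valQ O x)) ->
  runs (EvalQ a k) m q 1 P.
Proof.
move=> <- sx p; eexists _, m, _; split; last exact: p.
  exact: (ExecEvalQ O (State m q)).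
by rewrite mul1n.
Qed.

Lemma runs_seq c1 c2 m q n1 n2 P :
  runs c1 m q n1 (fun m' q' => runs c2 m' q' n2 P) ->
  runs (Seq c1 c2) m q (n1 + n2) P.
Proof.
move=> [t1 [m1 [q1 [e1 l1 [t2 [m2 [q2 [e2 l2 p]]]]]]]].
exists (t1 + t2)%N, m2, q2; split => //; first exact: ExecSeq e1 e2.
by rewrite mulnDl leq_add.
Qed.

Lemma runs_if b c1 c2 m q n P : (0 < C)%N ->
  runs (if eval_cond (State m q) b then c1 else c2) m q n P ->
  runs (If b c1 c2) m q n.+1 P.
Proof.
move=> C0 [t [m' [q' [e l p]]]]; exists (1 + t)%N, m', q'; split => //.
  exact: ExecIf.
by rewrite mulSn leq_add.
Qed.

Lemma runs_while b c m q n T (Inv : nat -> (nat -> rat) -> (nat -> R) -> Prop) P :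
  (0 < C)%N ->
  (forall k m q, (k < n)%N -> Inv k m q ->
     eval_cond (State m q) b /\ runs c m q T (Inv k.+1)) ->
  (forall m q, Inv n m q -> ~~ eval_cond (State m q) b /\ P m q) ->
  Inv 0 m q ->
  runs (While b c) m q (T.+1 * n + 1) P.
Proof.
move=> C0 step stop I0.
suff : forall j k m q, (k + j = n)%N -> Inv k m q -> runs (While b c) m q (T.+1 * j + 1) P.
  by move=> /(_ n 0%N m q (add0n n)); apply.
elim=> [|j IH] k {I0}m {}q.
  rewrite addn0 muln0 add0n => -> /stop [nb p]; exists 1%N, m, q; split => //.
    exact: ExecWhileDone.
  by rewrite mul1n.
move=> kj /(step _ _ _ _) [|bt [t [m1 [q1 [e l i]]]]]; first by rewrite -kj addnS ltnS leq_addr.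
have [|t' [m2 [q2 [e' l' p]]]] := IH k.+1 m1 q1 _ i; first by rewrite -kj addnS addSn.
exists (1 + t + t')%N, m2, q2; split => //; first exact: ExecWhileStep e e'.
have -> : ((T.+1 * j.+1 + 1) * C = C + T * C + (T.+1 * j + 1) * C)%N by ring.
by rewrite !leq_add.
Qed.

Lemma runs_for i hi n T body m q (Inv : nat -> (nat -> rat) -> (nat -> R) -> Prop) P :
  i != 5%N ->
  (forall k, (k <= n.+1)%N -> small k%:R) ->
  (forall k m q x, Inv k m q -> Inv k (upd m i x) q) ->
  (forall k m q, Inv k m q -> m hi = n%:R /\ m 5%N = 1) ->
  (forall k m q, (k <= n)%N -> Inv k m q -> m i = k%:R ->
     runs body m q T (fun m' q' => m' i = k%:R /\ Inv k.+1 m' q')) ->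
  (forall m q, Inv n.+1 m q -> P m q) ->
  Inv 0 m q ->
  runs (For i hi body) m q (T.+2 * n.+1 + 2) P.
Proof.
move=> i5 sm Iupd Ihi step fin I0.
have C0 : (0 < C)%N by exact: leq_trans (sm 0%N isT).
have -> : (T.+2 * n.+1 + 2 = 1 + (T.+2 * n.+1 + 1))%N by ring.
apply: runs_seq; apply: runs_const => //; first exact: (sm 0%N).
apply: (@runs_while _ _ _ _ _ _ (fun k m q => m i = k%:R /\ Inv k m q)) => //.
- move=> k m1 q1 kn [mi Ik]; have [mhi m5] := Ihi _ _ _ Ik; split.
    by rewrite /= mi mhi ler_nat -ltnS.
  rewrite -[T.+1]addn1; apply: runs_seq; apply: runs_weak (step k m1 q1 kn Ik mi) _ _ => //.
  move=> m' q' [mi' Ik']; have [mhi' m5'] := Ihi _ _ _ Ik'.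
  apply: (@runs_op _ _ _ _ i k.+1%:R) => //=.
  - by rewrite mi' m5' natr1.
  - exact: sm.
  by split; [rewrite /upd eqxx|exact: Iupd].
- move=> m1 q1 [mi In]; have [mhi m5] := Ihi _ _ _ In; split; last exact: fin.
  by rewrite /= mi mhi ler_nat -ltnNge.
- by split; [rewrite /upd eqxx|exact: Iupd].
Qed.

End runs.

Lemma upd_same (T : Type) (m : nat -> T) a v : upd m a v a = v.
Proof. by rewrite /upd eqxx. Qed.

Lemma upd_ne (T : Type) (m : nat -> T) a v b : b != a -> upd m a v b = m b.
Proof. by rewrite /upd => /negbTE ->. Qed.

Lemma truncn_nat (n : nat) : Num.truncn (n%:R : rat) = n.
Proof. by apply: truncn_def; rewrite lexx ltr_nat ltnSn. Qed.

Definition scratch (a : nat) : bool := (17 < a < 27)%N.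

Definition eqm (m m' : nat -> rat) : Prop := forall a, ~~ scratch a -> m a = m' a.

Definition wr (b n : nat) (v : nat -> rat) (m : nat -> rat) : nat -> rat :=
  fun a => if (b <= a < b + n)%N then v (a - b)%N else m a.

Lemma wr0 b v m : wr b 0 v m = m.
Proof. by apply/funext => a; rewrite /wr addn0; case: ifP => //; lia. Qed.

Lemma wr_in b n v m a i : a = (b + i)%N -> (i < n)%N -> wr b n v m a = v i.
Proof. by move=> -> ij; rewrite /wr leq_addr ltn_add2l ij addKn. Qed.

Lemma wr_out b n v m a : ~~ (b <= a < b + n)%N -> wr b n v m a = m a.
Proof. by rewrite /wr => /negbTE ->. Qed.

Lemma eqm_upd_scratch m m' a v : scratch a -> eqm m m' -> eqm (upd m a v) m'.
Proof.
move=> sa e b sb; rewrite upd_ne ?e//.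
by apply: contraNneq sb => ->.
Qed.

Lemma eqm_wrS b n v m m' x : eqm m (wr b n v m') -> x = v n ->
  eqm (upd m (b + n)%N x) (wr b n.+1 v m').
Proof.
move=> e -> a sa; rewrite /upd; case: eqP => [->|ab]; first by rewrite (@wr_in _ _ _ _ _ n).
rewrite e// /wr; case: ifP => h; case: ifP => //; lia.
Qed.

Lemma eqm_refl m : eqm m m. Proof. by []. Qed.

Lemma eqm_trans m1 m2 m3 : eqm m1 m2 -> eqm m2 m3 -> eqm m1 m3.
Proof. by move=> e1 e2 a sa; rewrite e1// e2. Qed.

(** * Program fragments of one step *)

Lemma updupd (T : Type) (m : nat -> T) a v w : upd (upd m a v) a w = upd m a w.
Proof. by apply/funext => b; rewrite /upd; case: eqP. Qed.

Definition AddrV (dst ri : nat) : com :=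
  (Op Mul (Dir dst) (Dir ri) (Dir 0) ;; Op Add (Dir dst) (Dir dst) (Dir 19) ;;
   Op Add (Dir dst) (Dir dst) (Dir 11))%com.

Definition Centroid : com :=
  For 19 6
   (Const (Dir 22) 0 ;;
    For 18 0 (AddrV 20 18 ;; Op Add (Dir 22) (Dir 22) (Ind 20)) ;;
    Op Div (Dir 22) (Dir 22) (Dir 27) ;;
    Op Add (Dir 21) (Dir 7) (Dir 19) ;;
    Op Add (Ind 21) (Dir 22) (Dir 4))%com.

(* Blocks of length [blockL d] from cell 64: the query point, the oracle's
   answer (flag and vector), the best point so far, the vertices (row by row)
   and the values of the cut at the vertices. *)
Definition blockL (d : nat) : nat := (d.+1 * d.+1)%N.
Definition aX : nat := 64.
Definition aC (d : nat) : nat := 64 + blockL d.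
Definition aB (d : nat) : nat := 64 + 2 * blockL d.
Definition aV (d : nat) : nat := 64 + 3 * blockL d.
Definition aA (d : nat) : nat := 64 + 4 * blockL d.

Record std (d D G : nat) (m : nat -> rat) : Prop := Std {
  std0 : m 0%N = d%:R; std4 : m 4%N = 0; std5 : m 5%N = 1; std6 : m 6%N = d.-1%:R;
  std7 : m 7%N = aX%:R; std8 : m 8%N = (aC d)%:R; std9 : m 9%N = (aC d).+1%:R;
  std10 : m 10%N = (aB d)%:R; std11 : m 11%N = (aV d)%:R; std12 : m 12%N = (aA d)%:R;
  std13 : m 13%N = D%:R; std14 : m 14%N = G%:R;
  std27 : m 27%N = d.+1%:R; std28 : m 28%N = 4 }.

Lemma std_eqm d D G m m' : eqm m m' -> std d D G m' -> std d D G m.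
Proof. by move=> e [*]; split; (rewrite e; [assumption|by []]). Qed.

Lemma std_wr d D G m b n v : (64 <= b)%N -> std d D G m -> std d D G (wr b n v m).
Proof. by move=> b64 [*]; split; (rewrite wr_out; [assumption|lia]). Qed.

Definition entry (d : nat) (m : nat -> rat) (i j : nat) : rat := m (aV d + (i * d + j))%N.

Ltac nlia :=
  repeat match goal with
  | H : ?T |- _ => lazymatch T with
    | is_true (leq _ _) => fail
    | is_true (negb _) => fail
    | is_true (andb (leq _ _) _) => fail
    | is_true (orb (leq _ _) _) => fail
    | @eq nat _ _ => fail
    | nat => fail
    | _ => clear H
    end
  end; lia.

Ltac lookup :=
  repeat (rewrite upd_same || (rewrite upd_ne; [|first [by [] | nlia]])).

Section fragments.
Context {R : realType} {d : nat} (O : oracles R d) (C D G : nat).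
Hypothesis d_gt0 : (0 < d)%N.
Hypothesis small_addr : forall n, (n <= 64 + 5 * blockL d)%N -> small C n%:R.

Let L := blockL d.

Let Ld : (d.+1 <= L)%N. Proof. by rewrite /L /blockL leq_pmull. Qed.

Lemma entry_lt i j : (i <= d)%N -> (j < d)%N -> (i * d + j < L)%N.
Proof.
move=> id jd; rewrite /L /blockL; have := leq_mul id (leqnn d); nia.
Qed.

Lemma runs_addrV dst ri i j m q P :
  std d D G m -> m ri = i%:R -> m 19%N = j%:R -> (i <= d)%N -> (j < d)%N ->
  (17 < dst)%N -> dst != 19%N -> dst != 27%N ->
  P (upd m dst (aV d + (i * d + j))%:R) q -> runs O C (AddrV dst ri) m q 3 P.
Proof.
move=> S mi mj id jd dst17 dst19 dst27 p.
have ij := entry_lt id jd; have idd : (i * d <= L)%N by lia.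
have ad : (aV d = 64 + 3 * L)%N by [].
apply: (@runs_seq _ _ _ _ _ _ _ _ 1 2); apply: (@runs_op _ _ _ _ _ _ _ _ dst (i * d)%:R) => //.
- by rewrite /= mi (std0 S) natrM.
- by apply: small_addr; lia.
apply: (@runs_seq _ _ _ _ _ _ _ _ 1 1); apply: (@runs_op _ _ _ _ _ _ _ _ dst (i * d + j)%:R) => //.
- by rewrite /= upd_same upd_ne 1?eq_sym// mj natrD.
- by apply: small_addr; lia.
rewrite updupd; apply: (@runs_op _ _ _ _ _ _ _ _ dst (aV d + (i * d + j))%:R) => //.
- by rewrite /= upd_same upd_ne ?(std11 S) 1?addrC 1?(natrD _ (aV d))//; lia.
- by apply: small_addr; lia.
by rewrite updupd.
Qed.

Lemma runs_addr dst rb rj b j m q P :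
  m rb = b%:R -> m rj = j%:R -> (b + j <= 64 + 5 * L)%N ->
  P (upd m dst (b + j)%:R) q ->
  runs O C (Op Add (Dir dst) (Dir rb) (Dir rj)) m q 1 P.
Proof.
move=> mb mj bj p; apply: (@runs_op _ _ _ _ _ _ _ _ dst (b + j)%:R) => //.
  by rewrite /= mb mj natrD.
exact: small_addr.
Qed.

Definition centroid (V : nat -> nat -> rat) (j : nat) : rat :=
  (\sum_(0 <= i < d.+1) V i j) / d.+1%:R.

Lemma runs_centroid m q :
  std d D G m ->
  (forall j l, (j < d)%N -> (l <= d.+1)%N -> small C (\sum_(0 <= i < l) entry d m i j)) ->
  (forall j, (j < d)%N -> small C (centroid (entry d m) j)) ->
  runs O C Centroid m q (100 * d.+1 ^ 2)
    (fun m' q' => eqm m' (wr aX d (centroid (entry d m)) m) /\ q' = q).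
Proof.
move=> S sm1 sm2.
have hL := Ld; have aVE : (aV d = 64 + 3 * L)%N by [].
pose M k := wr aX k (centroid (entry d m)) m.
have SM k m' : eqm m' (M k) -> std d D G m'.
  by move=> e; apply: std_eqm e _; exact: std_wr.
apply: (@runs_weak _ _ _ _ _ _ _ ((6 * d.+1 + 2 + 4).+2 * d.-1.+1 + 2) _
  (fun m' q' => eqm m' (M d) /\ q' = q)).
- apply: (@runs_for _ _ _ _ _ _ _ _ _ _ _ (fun k m' q' => eqm m' (M k) /\ q' = q)) => //.
  + by move=> k kn; apply: small_addr; lia.
  + by move=> k m' q' x [e ->]; split => //; exact: eqm_upd_scratch.
  + by move=> k m' q' [e _]; have S' := SM _ _ e; rewrite (std6 S') (std5 S').
  + move=> j m1 q1 jd [e1 ->] m1j.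
    have {}jd : (j < d)%N by lia.
    have -> : (6 * d.+1 + 2 + 4 = 1 + (6 * d.+1 + 2 + (1 + (1 + 1))))%N by lia.
    apply: runs_seq; apply: (@runs_const _ _ _ _ _ _ 22) => //; first exact: (small_addr (leq0n _)).
    apply: runs_seq.
    apply: (@runs_for _ _ _ _ _ _ _ _ _ _ _ (fun l m' q' => [/\ eqm m' (M j), q' = q,
       m' 19%N = j%:R & m' 22%N = \sum_(0 <= i < l) entry d m i j])) => //.
    * by move=> k kn; apply: small_addr; lia.
    * move=> k m' q' x [e -> mj m22]; split => //; first exact: eqm_upd_scratch.
    * by move=> k m' q' [e _ _ _]; have S' := SM _ _ e; rewrite (std0 S') (std5 S').
    * move=> i m2 q2 id [e2 -> m2j m22] m2i.
      have S2 := SM _ _ e2.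
      have ij := entry_lt id jd.
      apply: (@runs_seq _ _ _ _ _ _ _ _ 3 1); apply: (@runs_addrV _ _ i j) => //.
      apply: (@runs_op _ _ _ _ _ _ _ _ 22 (\sum_(0 <= i < i.+1) entry d m i j)) => //=.
      - rewrite upd_same truncn_nat !upd_ne//.
        by rewrite m22 e2 /M ?wr_out ?big_nat_recr//=; rewrite /scratch /aX; lia.
      - exact: sm1.
      - split; first by lookup.
        by split; lookup => //; do 2 apply: eqm_upd_scratch => //.
    * move=> m2 q2 [e2 -> m2j m22]; have S2 := SM _ _ e2.
      apply: runs_seq; apply: (@runs_op _ _ _ _ _ _ _ _ 22 (centroid (entry d m) j)) => //=.
      - by rewrite m22 (std27 S2).
      - exact: sm2.
      - apply: (@runs_seq _ _ _ _ _ _ _ _ 1 1).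
        apply: (@runs_addr _ _ _ aX j); rewrite ?upd_ne ?(std7 S2)//; first by rewrite /aX; lia.
        apply: (@runs_op _ _ _ _ _ _ _ _ (aX + j)%N (centroid (entry d m) j)) => //=.
        + by lookup; rewrite (std4 S2) addr0.
        + by rewrite upd_same truncn_nat.
        + exact: sm2.
        + split; first by lookup.
          by split=> //; apply: eqm_wrS => //; do 2 apply: eqm_upd_scratch => //.
    * by split; lookup; rewrite ?big_geq//; exact: eqm_upd_scratch.
  + by move=> m' q' [e ->]; split => //; rewrite prednK in e.
  + by rewrite /M wr0; split; [exact: eqm_refl|].
- by rewrite prednK//; nia.
- by [].
Qed.

End fragments.

Definition Products : com :=
  For 18 0
   (Const (Dir 22) 0 ;;
    For 19 6 (AddrV 20 18 ;; Op Add (Dir 21) (Dir 9) (Dir 19) ;;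
              Op Mul (Dir 21) (Ind 20) (Ind 21) ;;
              Op Add (Dir 22) (Dir 22) (Dir 21)) ;;
    Op Add (Dir 21) (Dir 12) (Dir 18) ;;
    Op Add (Ind 21) (Dir 22) (Dir 4))%com.

Definition Argmin : com :=
  (Const (Dir 23) 0 ;; Const (Dir 24) 0 ;;
   For 18 0
    (Op Add (Dir 21) (Dir 12) (Dir 18) ;;
     Op Add (Dir 24) (Dir 24) (Ind 21) ;;
     Op Add (Dir 22) (Dir 12) (Dir 23) ;;
     If (Le (Ind 21) (Ind 22)) (Op Add (Dir 23) (Dir 18) (Dir 4)) Skip) ;;
   Op Div (Dir 24) (Dir 24) (Dir 27) ;;
   Op Add (Dir 22) (Dir 12) (Dir 23) ;;
   Op Defs.Sub (Dir 25) (Dir 24) (Ind 22) ;;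
   Op Mul (Dir 25) (Dir 14) (Dir 25))%com.

Section fragments.
Context {R : realType} {d : nat} (O : oracles R d) (C D G : nat).
Hypothesis d_gt0 : (0 < d)%N.
Hypothesis small_addr : forall n, (n <= 64 + 5 * blockL d)%N -> small C n%:R.

Let L := blockL d.

Let Ld : (d.+1 <= L)%N. Proof. by rewrite /L /blockL leq_pmull. Qed.

Let C0 : (0 < C)%N. Proof. exact: leq_trans (small_addr (leq0n _)). Qed.
Let small0 : small C 0. Proof. exact: (small_addr (leq0n _)). Qed.

Definition lin (V : nat -> nat -> rat) (c : nat -> rat) (i : nat) : rat :=
  \sum_(0 <= j < d) V i j * c j.

Lemma runs_products m q (V : nat -> nat -> rat) (c : nat -> rat) :
  std d D G m ->
  (forall i j, (i <= d)%N -> (j < d)%N -> entry d m i j = V i j) ->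
  (forall j, (j < d)%N -> m ((aC d).+1 + j)%N = c j) ->
  (forall i j, (i <= d)%N -> (j < d)%N -> small C (V i j * c j)) ->
  (forall i l, (i <= d)%N -> (l <= d)%N -> small C (\sum_(0 <= j < l) V i j * c j)) ->
  runs O C Products m q (100 * d.+1 ^ 2)
    (fun m' q' => eqm m' (wr (aA d) d.+1 (lin V c) m) /\ q' = q).
Proof.
move=> S mV mc sm1 sm2.
have hL := Ld; have aVE : (aV d = 64 + 3 * L)%N by [].
have aCE : (aC d = 64 + L)%N by []. have aAE : (aA d = 64 + 4 * L)%N by [].
pose M k := wr (aA d) k (lin V c) m.
have SM k m' : eqm m' (M k) -> std d D G m'.
  by move=> e; apply: std_eqm e _; apply: std_wr => //; nlia.
apply: (@runs_weak _ _ _ _ _ _ _ (((6.+2 * d.-1.+1 + 2) + 3).+2 * d.+1 + 2) _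
  (fun m' q' => eqm m' (M d.+1) /\ q' = q)) => //; last by rewrite prednK//; nia.
apply: (@runs_for _ _ _ _ _ _ _ _ _ _ _ (fun k m' q' => eqm m' (M k) /\ q' = q)) => //.
- by move=> k kn; apply: small_addr; nlia.
- by move=> k m' q' x [e ->]; split => //; exact: eqm_upd_scratch.
- by move=> k m' q' [e _]; have S' := SM _ _ e; rewrite (std0 S') (std5 S').
- move=> i m1 q1 id [e1 ->] m1i.
  have -> : ((6.+2 * d.-1.+1 + 2) + 3 = 1 + (6.+2 * d.-1.+1 + 2 + (1 + 1)))%N by nlia.
  apply: runs_seq; apply: (@runs_const _ _ _ _ _ _ 22) => //.
  apply: runs_seq.
  apply: (@runs_for _ _ _ _ _ _ _ _ _ _ _ (fun l m' q' => [/\ eqm m' (M i), q' = q,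
     m' 18%N = i%:R & m' 22%N = \sum_(0 <= j < l) V i j * c j])) => //.
  + by move=> k kn; apply: small_addr; nlia.
  + by move=> k m' q' x [e -> mj m22]; split => //; exact: eqm_upd_scratch.
  + by move=> k m' q' [e _ _ _]; have S' := SM _ _ e; rewrite (std6 S') (std5 S').
  + move=> j m2 q2 jd [e2 -> m2i m22] m2j; have {}jd : (j < d)%N by nlia.
    have S2 := SM _ _ e2.
    have ij : (i * d + j < L)%N := entry_lt d_gt0 id jd.
    apply: (@runs_seq _ _ _ _ _ _ _ _ 3 3); apply: (@runs_addrV _ _ _ _ D G _ _ _ _ i j) => //.
    apply: (@runs_seq _ _ _ _ _ _ _ _ 1 2).
    apply: (@runs_addr _ _ _ _ _ _ _ _ (aC d).+1 j); [exact: small_addr|by lookup; exact: std9 S2|by lookup|rewrite -/L; nlia|].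
    apply: (@runs_seq _ _ _ _ _ _ _ _ 1 1).
    apply: (@runs_op _ _ _ _ _ _ _ _ 21 (V i j * c j)) => //=.
    * rewrite upd_same truncn_nat; lookup; rewrite truncn_nat; lookup.
      rewrite !e2 /M ?wr_out; [|rewrite /scratch; nlia..].
      by rewrite -/(entry d m i j) mV// mc.
    * exact: sm1.
    apply: (@runs_op _ _ _ _ _ _ _ _ 22 (\sum_(0 <= j0 < j.+1) V i j0 * c j0)) => //=.
    * by lookup; rewrite m22 big_nat_recr.
    * exact: sm2.
    split; first by lookup.
    by split; lookup => //; do 4 apply: eqm_upd_scratch => //.
  + move=> m2 q2 [e2 -> m2i m22]; have S2 := SM _ _ e2.
    rewrite prednK// in m22.
    apply: (@runs_seq _ _ _ _ _ _ _ _ 1 1).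
    apply: (@runs_addr _ _ _ _ _ _ _ _ (aA d) i); [exact: small_addr|exact: std12 S2|by []|rewrite -/L; nlia|].
    apply: (@runs_op _ _ _ _ _ _ _ _ (aA d + i)%N (lin V c i)) => //=.
    * by lookup; rewrite (std4 S2) addr0.
    * by rewrite upd_same truncn_nat.
    * exact: sm2.
    * split; first by lookup.
      by split=> //; apply: eqm_wrS => //; do 2 apply: eqm_upd_scratch => //.
  + by split; lookup; rewrite ?big_geq//; exact: eqm_upd_scratch.
- by rewrite /M wr0; split; [exact: eqm_refl|].
Qed.

Lemma runs_argmin m q (a : nat -> rat) :
  let s := (\sum_(0 <= i < d.+1) a i) / d.+1%:R in
  std d D G m ->
  (forall i, (i <= d)%N -> m (aA d + i)%N = a i) ->
  (forall l, (l <= d.+1)%N -> small C (\sum_(0 <= i < l) a i)) ->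
  small C s ->
  (forall i, (i <= d)%N -> small C (s - a i) /\ small C (G%:R * (s - a i))) ->
  runs O C Argmin m q (100 * d.+1)
    (fun m' q' => [/\ eqm m' m, q' = q, m' 24%N = s & exists2 k, (k <= d)%N &
       [/\ forall i, (i <= d)%N -> a k <= a i, m' 23%N = k%:R & m' 25%N = G%:R * (s - a k)]]).
Proof.
move=> s S ma sm1 sms sm2.
have hL := Ld; have aAE : (aA d = 64 + 4 * L)%N by [].
pose Inv l m' (q' : nat -> R) := [/\ eqm m' m, q' = q, m' 24%N = \sum_(0 <= i < l) a i &
    exists2 k, (k <= d)%N & m' 23%N = k%:R /\ forall i, (i < l)%N -> a k <= a i].
apply: (@runs_le _ _ _ _ _ _ _ (1 + (1 + (5.+2 * d.+1 + 2 + (1 + (1 + (1 + 1))))))); last by nlia.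
apply: runs_seq; apply: (@runs_const _ _ _ _ _ _ 23) => //.
apply: runs_seq; apply: (@runs_const _ _ _ _ _ _ 24) => //.
apply: runs_seq; apply: (@runs_for _ _ _ _ _ _ _ _ _ _ _ Inv) => //.
- by move=> k kn; apply: small_addr; nlia.
- move=> l m' q' x [e -> m24 [k kd [m23 ak]]]; split => //; first exact: eqm_upd_scratch.
  by exists k.
- by move=> l m' q' [e _ _ _]; rewrite !e// (std0 S) (std5 S).
- move=> i m1 q1 id [e1 -> m24 [k kd [m23 ak]]] m1i; have S1 := std_eqm e1 S.
  apply: (@runs_seq _ _ _ _ _ _ _ _ 1 4).
  apply: (@runs_addr _ _ _ _ _ _ _ _ (aA d) i); [exact: small_addr|exact: std12 S1|by []|rewrite -/L; nlia|].
  apply: (@runs_seq _ _ _ _ _ _ _ _ 1 3).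
  apply: (@runs_op _ _ _ _ _ _ _ _ 24 (\sum_(0 <= i0 < i.+1) a i0)) => //=.
  + rewrite upd_same truncn_nat; lookup; rewrite m24 e1 ?ma//.
    by rewrite big_nat_recr.
  + exact: sm1.
  apply: (@runs_seq _ _ _ _ _ _ _ _ 1 2).
  apply: (@runs_addr _ _ _ _ _ _ _ _ (aA d) k); [exact: small_addr|by lookup; exact: std12 S1|by lookup|rewrite -/L; nlia|].
  apply: (@runs_if _ _ _ _ _ _ _ _ _ 1) => //=.
  lookup; rewrite !truncn_nat; lookup.
  rewrite !e1 ?ma//.
  have sc a' : (64 <= a')%N -> ~~ scratch a' by rewrite /scratch; nlia.
  case: ifPn => [aik|]; last rewrite -ltNge => aki.
  + apply: (@runs_op _ _ _ _ _ _ _ _ 23 i%:R) => //=.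
    * by lookup; rewrite (std4 S1) addr0.
    * by apply: small_addr; nlia.
    split; first by lookup.
    split => //; lookup => //; first by do 4 apply: eqm_upd_scratch => //.
    exists i => //; split; first by lookup.
    by move=> l; rewrite ltnS leq_eqVlt => /predU1P[->//|/ak]; exact: le_trans.
  + apply: runs_skip => //; split; first by lookup.
    split => //; lookup => //; first by do 3 apply: eqm_upd_scratch => //.
    exists k => //; split; first by lookup.
    by move=> l; rewrite ltnS leq_eqVlt => /predU1P[->|/ak//]; exact: ltW.
- move=> m1 q1 [e1 -> m24 [k kd [m23 ak]]]; have S1 := std_eqm e1 S.
  apply: (@runs_seq _ _ _ _ _ _ _ _ 1 3).
  apply: (@runs_op _ _ _ _ _ _ _ _ 24 s) => //=; first by rewrite m24 (std27 S1).
  apply: (@runs_seq _ _ _ _ _ _ _ _ 1 2).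
  apply: (@runs_addr _ _ _ _ _ _ _ _ (aA d) k); [exact: small_addr|by lookup; exact: std12 S1|by lookup|rewrite -/L; nlia|].
  have [smk1 smk2] := sm2 _ kd.
  apply: (@runs_seq _ _ _ _ _ _ _ _ 1 1).
  apply: (@runs_op _ _ _ _ _ _ _ _ 25 (s - a k)) => //=.
    lookup; rewrite truncn_nat; lookup.
    by rewrite e1 ?ma.
  apply: (@runs_op _ _ _ _ _ _ _ _ 25 (G%:R * (s - a k))) => //=.
    by lookup; rewrite (std14 S1).
  split => //; lookup => //; first by do 4 apply: eqm_upd_scratch => //.
  by exists k => //; split => //; lookup.
- split => //; lookup; rewrite ?big_geq//; first by do 2 apply: eqm_upd_scratch => //.
  by exists 0%N => //; split => //; lookup.
Qed.

End fragments.

Definition Update : com :=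
  For 18 0
   (Op Add (Dir 21) (Dir 12) (Dir 18) ;;
    Op Defs.Sub (Dir 22) (Ind 21) (Dir 24) ;;
    Op Add (Dir 22) (Dir 22) (Dir 25) ;;
    Op Mul (Dir 26) (Dir 13) (Dir 25) ;;
    Op FloorDiv (Dir 26) (Dir 26) (Dir 22) ;;
    Op Add (Dir 26) (Dir 26) (Dir 5) ;;
    Op Div (Dir 26) (Dir 26) (Dir 13) ;;
    For 19 6
     (AddrV 20 18 ;; AddrV 21 23 ;;
      Op Defs.Sub (Dir 22) (Ind 20) (Ind 21) ;;
      Op Mul (Dir 22) (Dir 22) (Dir 26) ;;
      Op Add (Ind 20) (Ind 21) (Dir 22)))%com.

Definition CopyBest : com :=
  For 19 6
   (Op Add (Dir 20) (Dir 7) (Dir 19) ;;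
    Op Add (Dir 21) (Dir 10) (Dir 19) ;;
    Op Add (Ind 21) (Ind 20) (Dir 4))%com.

Definition RoundCut : com :=
  For 19 6
   (Op Add (Dir 20) (Dir 9) (Dir 19) ;;
    Op FloorDiv (Ind 20) (Ind 20) (Dir 15))%com.

Definition Cut : com :=
  (Sep 7 8 ;;
   If (Le (Dir 5) (Ind 8))
    (EvalF 7 9 ;; EvalQ 7 1 ;;
     If (QLe 0 1) (CopyBest ;; EvalQ 7 0) Skip)
    RoundCut)%com.

Section fragments.
Context {R : realType} {d : nat} (O : oracles R d) (C D G : nat).
Hypothesis d_gt0 : (0 < d)%N.
Hypothesis small_addr : forall n, (n <= 64 + 5 * blockL d)%N -> small C n%:R.

Let L := blockL d.

Let Ld : (d.+1 <= L)%N. Proof. by rewrite /L /blockL leq_pmull. Qed.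

Let C0 : (0 < C)%N. Proof. exact: leq_trans (small_addr (leq0n _)). Qed.

Definition step_num (g y : rat) : rat := (Num.floor (D%:R * g / (y + g)))%:~R + 1.

Lemma runs_update m q (V : nat -> nat -> rat) (a : nat -> rat) (s g : rat) (k : nat) :
  let t i := step_num g (a i - s) / D%:R in
  let V' i j := V k j + (V i j - V k j) * t i in
  std d D G m -> (k <= d)%N ->
  m 23%N = k%:R -> m 24%N = s -> m 25%N = g ->
  (forall i, (i <= d)%N -> m (aA d + i)%N = a i) ->
  (forall i j, (i <= d)%N -> (j < d)%N -> entry d m i j = V i j) ->
  (forall i, (i <= d)%N -> [/\ small C (a i - s), small C (a i - s + g),
     small C (step_num g (a i - s) - 1), small C (step_num g (a i - s)) & small C (t i)]) ->
  small C (D%:R * g) ->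
  (forall i j, (i <= d)%N -> (j < d)%N ->
     [/\ small C (V i j - V k j), small C ((V i j - V k j) * t i) & small C (V' i j)]) ->
  runs O C Update m q (200 * d.+1 ^ 2)
    (fun m' q' => eqm m' (wr (aV d) (d.+1 * d)%N (fun n => V' (n %/ d)%N (n %% d)%N) m) /\ q' = q).
Proof.
move=> t V' S kd m23 m24 m25 ma mV sma smg smV.
have hL := Ld; have aVE : (aV d = 64 + 3 * L)%N by [].
have aAE : (aA d = 64 + 4 * L)%N by [].
pose val n := V' (n %/ d)%N (n %% d)%N.
have valE i j : (j < d)%N -> val (i * d + j)%N = V' i j.
  by move=> jd; rewrite /val divnMDl// divn_small// addn0 modnMDl modn_small.
pose M n := wr (aV d) n val m.
have SM k' m' : eqm m' (M k') -> std d D G m'.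
  by move=> e; apply: std_eqm e _; apply: std_wr => //; nlia.
have Vk j : V' k j = V k j by rewrite /V' subrr mul0r addr0.
pose Inv i m' (q' : nat -> R) :=
  [/\ eqm m' (M (i * d)%N), q' = q, m' 23%N = k%:R, m' 24%N = s & m' 25%N = g].
apply: (@runs_weak _ _ _ _ _ _ _ ((7 + (9.+2 * d.-1.+1 + 2)).+2 * d.+1 + 2) _
  (Inv d.+1)); [|by rewrite prednK//; nlia|by move=> m' q' []].
apply: (@runs_for _ _ _ _ _ _ _ _ _ _ _ Inv) => //.
- by move=> n kn; apply: small_addr; nlia.
- by move=> n m' q' x [e -> ? ? ?]; split => //; exact: eqm_upd_scratch.
- by move=> n m' q' [e _ _ _ _]; have S' := SM _ _ e; rewrite (std0 S') (std5 S').
- move=> i m1 q1 id [e1 -> n23 n24 n25] m1i.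
  have S1 := SM _ _ e1.
  have m1a : m1 (aA d + i)%N = a i.
    rewrite e1 // /M wr_out ?ma//.
    have : (i * d <= d * d)%N by rewrite leq_mul2r id orbT.
    have : (d * d <= L)%N by rewrite /L /blockL; nlia.
    nlia.
  have [sm1 sm2 sm3 sm4 sm5] := sma _ id.
  apply: (@runs_seq _ _ _ _ _ _ _ _ 1 (6 + _)).
  apply: (@runs_addr _ _ _ _ _ _ _ _ (aA d) i); [exact: small_addr|exact: std12 S1|by []|rewrite -/L; nlia|].
  apply: (@runs_seq _ _ _ _ _ _ _ _ 1 (5 + _)); apply: (@runs_op _ _ _ _ _ _ _ _ 22 (a i - s)) => //=.
    by rewrite upd_same truncn_nat; lookup; rewrite m1a n24.
  apply: (@runs_seq _ _ _ _ _ _ _ _ 1 (4 + _)); apply: (@runs_op _ _ _ _ _ _ _ _ 22 (a i - s + g)) => //=.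
    by lookup; rewrite n25.
  apply: (@runs_seq _ _ _ _ _ _ _ _ 1 (3 + _)); apply: (@runs_op _ _ _ _ _ _ _ _ 26 (D%:R * g)) => //=.
    by lookup; rewrite n25 (std13 S1).
  apply: (@runs_seq _ _ _ _ _ _ _ _ 1 (2 + _)); apply: (@runs_op _ _ _ _ _ _ _ _ 26 (step_num g (a i - s) - 1)) => //=.
    by lookup; rewrite /step_num addrK.
  apply: (@runs_seq _ _ _ _ _ _ _ _ 1 (1 + _)); apply: (@runs_op _ _ _ _ _ _ _ _ 26 (step_num g (a i - s))) => //=.
    by lookup; rewrite (std5 S1) subrK.
  apply: (@runs_seq _ _ _ _ _ _ _ _ 1 _); apply: (@runs_op _ _ _ _ _ _ _ _ 26 (t i)) => //=.
    by lookup; rewrite (std13 S1).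
  apply: (@runs_for _ _ _ _ _ _ _ _ _ _ _ (fun j m' q' =>
     [/\ eqm m' (M (i * d + j)%N), q' = q, m' 18%N = i%:R,
        m' 26%N = t i & [/\ m' 23%N = k%:R, m' 24%N = s & m' 25%N = g]])) => //.
  + by move=> n kn; apply: small_addr; nlia.
  + move=> n m' q' x [e -> ? ? [? ? ?]]; split => //; exact: eqm_upd_scratch.
  + by move=> n m' q' [e _ _ _ _]; have S' := SM _ _ e; rewrite (std6 S') (std5 S').
  + move=> j m2 q2 jd [e2 -> m2i m226 [m223 m224 m225]] m2j; have {}jd : (j < d)%N by nlia.
    have S2 := SM _ _ e2.
    have ij : (i * d + j < L)%N := entry_lt d_gt0 id jd.
    have kj : (k * d + j < L)%N := entry_lt d_gt0 kd jd.
    have m2ij : m2 (aV d + (i * d + j))%N = V i j.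
      by rewrite e2 // /M wr_out; [rewrite -/(entry d m i j) mV|nlia].
    have m2kj : m2 (aV d + (k * d + j))%N = V k j.
      rewrite e2 // /M; have [lt|ge] := ltnP (k * d + j) (i * d + j).
        by rewrite (@wr_in _ _ _ _ _ (k * d + j)%N)// valE// Vk.
      by rewrite wr_out; [rewrite -/(entry d m k j) mV|nlia].
    have [sv1 sv2 sv3] := smV _ _ id jd.
    apply: (@runs_seq _ _ _ _ _ _ _ _ 3 6); apply: (@runs_addrV _ _ _ _ D G _ _ _ _ i j) => //.
    apply: (@runs_seq _ _ _ _ _ _ _ _ 3 3); apply: (@runs_addrV _ _ _ _ D G _ _ _ _ k j) => //;
      [|by lookup..|].
      by apply: std_eqm S2; exact: eqm_upd_scratch.
    apply: (@runs_seq _ _ _ _ _ _ _ _ 1 2); apply: (@runs_op _ _ _ _ _ _ _ _ 22 (V i j - V k j)) => //=.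
      rewrite upd_same; lookup; rewrite !truncn_nat; lookup.
      by rewrite m2ij m2kj.
    apply: (@runs_seq _ _ _ _ _ _ _ _ 1 1); apply: (@runs_op _ _ _ _ _ _ _ _ 22 ((V i j - V k j) * t i)) => //=.
      by lookup; rewrite m226.
    apply: (@runs_op _ _ _ _ _ _ _ _ (aV d + (i * d + j))%N (V' i j)) => //=.
    * by lookup; rewrite truncn_nat; lookup; rewrite m2kj.
    * by lookup; rewrite truncn_nat.
    split; first by lookup.
    split; [|by []|by lookup|by lookup|by split; lookup].
    rewrite addnS; apply: eqm_wrS; last by rewrite valE.
    by do 4 apply: eqm_upd_scratch => //.
  + move=> m2 q2 [e2 -> m2i _ [? ? ?]]; split => //; split => //.
    by rewrite prednK// in e2; rewrite mulSn addnC.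
  + split; [|by []|by lookup|by lookup|by split; lookup].
    by rewrite addn0; do 7 apply: eqm_upd_scratch => //.
- by split => //; rewrite mul0n /M wr0; exact: eqm_refl.
Qed.

Definition vecn (v : 'rV[rat]_d) (j : nat) : rat := if insub j is Some i then v 0 i else 0.

Lemma write_block_wr m a (v : 'rV[rat]_d) : write_block m a v = wr a d (vecn v) m.
Proof.
apply/funext => n; rewrite /write_block /wr /vecn.
case: (leqP a n) => //= an; case: insubP => [i h _|h].
  by rewrite (_ : n < a + d)%N//; nlia.
by rewrite (_ : n < a + d = false)%N//; apply/negbTE; nlia.
Qed.

Lemma read_block_ext m m' a : (forall j, (j < d)%N -> m (a + j)%N = m' (a + j)%N) ->
  read_block d m a = read_block d m' a.
Proof. by move=> e; apply/rowP => i; rewrite !mxE e. Qed.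

Lemma runs_copybest m q :
  std d D G m ->
  (forall j, (j < d)%N -> small C (m (aX + j)%N)) ->
  runs O C CopyBest m q (20 * d.+1)
    (fun m' q' => eqm m' (wr (aB d) d (fun j => m (aX + j)%N) m) /\ q' = q).
Proof.
move=> S sm.
have hL := Ld; have aBE : (aB d = 64 + 2 * L)%N by []; have aXE : aX = 64%N by [].
pose M n := wr (aB d) n (fun j => m (aX + j)%N) m.
have SM k' m' : eqm m' (M k') -> std d D G m'.
  by move=> e; apply: std_eqm e _; apply: std_wr => //; nlia.
apply: (@runs_weak _ _ _ _ _ _ _ (3.+2 * d.-1.+1 + 2) _
  (fun m' q' => eqm m' (M d) /\ q' = q)) => //; last by rewrite prednK//; nlia.
apply: (@runs_for _ _ _ _ _ _ _ _ _ _ _ (fun n m' q' => eqm m' (M n) /\ q' = q)) => //.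
- by move=> n kn; apply: small_addr; nlia.
- by move=> n m' q' x [e ->]; split => //; exact: eqm_upd_scratch.
- by move=> n m' q' [e _]; have S' := SM _ _ e; rewrite (std6 S') (std5 S').
- move=> j m1 q1 jd [e1 ->] m1j; have S1 := SM _ _ e1; have {}jd : (j < d)%N by nlia.
  have m1x : m1 (aX + j)%N = m (aX + j)%N.
    by rewrite e1// /M wr_out//; nlia.
  apply: (@runs_seq _ _ _ _ _ _ _ _ 1 2).
  apply: (@runs_addr _ _ _ _ _ _ _ _ aX j); [exact: small_addr|exact: std7 S1|by []|rewrite -/L; nlia|].
  apply: (@runs_seq _ _ _ _ _ _ _ _ 1 1).
  apply: (@runs_addr _ _ _ _ _ _ _ _ (aB d) j); [exact: small_addr|by lookup; exact: std10 S1|by lookup|rewrite -/L; nlia|].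
  apply: (@runs_op _ _ _ _ _ _ _ _ (aB d + j)%N (m (aX + j)%N)) => //=.
  + by lookup; rewrite truncn_nat; lookup; rewrite m1x (std4 S1) addr0.
  + by lookup; rewrite truncn_nat.
  + exact: sm.
  split; first by lookup.
  by split => //; apply: eqm_wrS => //; do 2 apply: eqm_upd_scratch => //.
- by move=> m' q' [e ->]; split => //; rewrite prednK in e.
- by rewrite /M wr0; split; [exact: eqm_refl|].
Qed.

Lemma runs_roundcut m q :
  let r j := (Num.floor (m ((aC d).+1 + j)%N / m 15%N))%:~R in
  std d D G m ->
  (forall j, (j < d)%N -> small C (r j)) ->
  runs O C RoundCut m q (20 * d.+1)
    (fun m' q' => eqm m' (wr (aC d).+1 d r m) /\ q' = q).
Proof.
move=> r S sm.
have hL := Ld; have aCE : (aC d = 64 + L)%N by [].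
pose M n := wr (aC d).+1 n r m.
have SM k' m' : eqm m' (M k') -> std d D G m'.
  by move=> e; apply: std_eqm e _; apply: std_wr => //; nlia.
apply: (@runs_weak _ _ _ _ _ _ _ (2.+2 * d.-1.+1 + 2) _
  (fun m' q' => eqm m' (M d) /\ q' = q)) => //; last by rewrite prednK//; nlia.
apply: (@runs_for _ _ _ _ _ _ _ _ _ _ _ (fun n m' q' => eqm m' (M n) /\ q' = q)) => //.
- by move=> n kn; apply: small_addr; nlia.
- by move=> n m' q' x [e ->]; split => //; exact: eqm_upd_scratch.
- by move=> n m' q' [e _]; have S' := SM _ _ e; rewrite (std6 S') (std5 S').
- move=> j m1 q1 jd [e1 ->] m1j; have S1 := SM _ _ e1; have {}jd : (j < d)%N by nlia.
  have m1x : m1 ((aC d).+1 + j)%N = m ((aC d).+1 + j)%N.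
    by rewrite e1// /M wr_out//; nlia.
  have m115 : m1 15%N = m 15%N.
    by rewrite e1// /M wr_out//; nlia.
  apply: (@runs_seq _ _ _ _ _ _ _ _ 1 1).
  apply: (@runs_addr _ _ _ _ _ _ _ _ (aC d).+1 j); [exact: small_addr|exact: std9 S1|by []|rewrite -/L; nlia|].
  apply: (@runs_op _ _ _ _ _ _ _ _ ((aC d).+1 + j)%N (r j)) => //=.
  + by lookup; rewrite truncn_nat; lookup; rewrite m1x m115.
  + by lookup; rewrite truncn_nat.
  + exact: sm.
  split; first by lookup.
  by split => //; apply: eqm_wrS => //; do 2 apply: eqm_upd_scratch => //.
- by move=> m' q' [e ->]; split => //; rewrite prednK in e.
- by rewrite /M wr0; split; [exact: eqm_refl|].
Qed.

Definition touched_by_cut (a : nat) : bool :=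
  [|| scratch a, (aC d <= a < aC d + d.+1)%N | (aB d <= a < aB d + d)%N].

Definition cut_post m q (x : 'rV[rat]_d) m' q' : Prop :=
  (forall a, ~~ touched_by_cut a -> m' a = m a) /\
  match o_sep O x with
  | None =>
      (forall j : 'I_d, m' ((aC d).+1 + j)%N = o_evalF O x 0 j) /\
      if q 0%N <= o_valQ O x
      then read_block d m' (aB d) = x /\ q' 0%N = o_valQ O x
      else read_block d m' (aB d) = read_block d m (aB d) /\ q' 0%N = q 0%N
  | Some c =>
      [/\ forall j : 'I_d, m' ((aC d).+1 + j)%N = (Num.floor (c 0 j / m 15%N))%:~R,
          read_block d m' (aB d) = read_block d m (aB d) & q' = q]
  end.

Lemma runs_cut m q (x : 'rV[rat]_d) :
  std d D G m -> read_block d m aX = x ->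
  (1 + bitlenv x <= C)%N ->
  (forall j, small C (x 0 j)) ->
  (o_sep O x = None -> (1 + bitlenv x + o_timeF O x + bitlenv (o_evalF O x) <= C)%N) ->
  (forall c, o_sep O x = Some c -> forall j, small C (Num.floor (c 0 j / m 15%N))%:~R) ->
  runs O C Cut m q (100 * d.+1) (cut_post m q x).
Proof.
move=> S mx sx sxj sF sc.
have hL := Ld; have aCE : (aC d = 64 + L)%N by [].
have aXE : aX = 64%N by []. have aBE : (aB d = 64 + 2 * L)%N by [].
apply: (@runs_le _ _ _ _ _ _ _ (1 + (20 * d.+1 + 5).+1)); last by nlia.
apply: runs_seq; apply: (@runs_sep _ _ _ _ _ _ x (aC d)) => //=.
- by rewrite (std7 S) truncn_nat.
- by rewrite (std8 S) truncn_nat.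
have S1 v : std d D G (upd m (aC d) v).
  by move: S => [*]; split; (rewrite upd_ne; [assumption|nlia]).
have vecnE (v : 'rV[rat]_d) (j : 'I_d) : vecn v j = v 0 j by rewrite /vecn valK.
rewrite /cut_post; case sepE : (o_sep O x) => [c|].
  rewrite write_block_wr; set m1 := wr _ _ _ _.
  have S2 : std d D G m1 by apply: std_wr => //; nlia.
  have m1c (j : 'I_d) : m1 ((aC d).+1 + j)%N = c 0 j.
    by rewrite /m1 (@wr_in _ _ _ _ _ j)// ltn_ord.
  have m115 : m1 15%N = m 15%N by rewrite /m1 wr_out; [lookup|nlia].
  apply: runs_if => //=.
  have -> : (m1 5%N <= m1 (Num.truncn (m1 8%N))) = false.
    rewrite (std5 S2) (std8 S2) truncn_nat /m1 wr_out; last by nlia.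
    by rewrite upd_same; apply/negbTE; rewrite -ltNge.
  apply: runs_weak (runs_roundcut q S2 _) _ _; [|by nlia|].
    by move=> j jd; rewrite (m1c (Ordinal jd)) m115; exact: sc.
  move=> m' q' [e ->]; split.
    move=> a; rewrite /touched_by_cut !negb_or => /and3P[sa h1 h2].
    rewrite e// wr_out; last by nlia.
    rewrite /m1 wr_out; last by nlia.
    by rewrite upd_ne//; nlia.
  split => //.
  - move=> j; have jd := ltn_ord j.
    by rewrite e// (@wr_in _ _ _ _ _ j)// m1c m115.
  - apply: read_block_ext => j jd; rewrite e// wr_out; last by nlia.
    rewrite /m1 wr_out; last by nlia.
    by rewrite upd_ne//; nlia.
apply: runs_if => //=.
rewrite (std5 (S1 1)) (std8 (S1 1)) truncn_nat upd_same lexx.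
have x1 : read_block d (upd m (aC d) 1) aX = x.
  by rewrite -mx; apply: read_block_ext => j jd; rewrite upd_ne//; nlia.
apply: (@runs_le _ _ _ _ _ _ _ (1 + (1 + (20 * d.+1 + 1).+1))); last by nlia.
apply: runs_seq; apply: (@runs_evalF _ _ _ _ _ _ x (aC d).+1) => //=.
- by rewrite (std7 (S1 1)) truncn_nat.
- by rewrite (std9 (S1 1)) truncn_nat.
- exact: sF.
rewrite write_block_wr; set m1 := wr _ _ _ _.
have S2 : std d D G m1 by apply: std_wr => //; nlia.
have x2 : read_block d m1 aX = x.
  by rewrite -x1; apply: read_block_ext => j jd; rewrite /m1 wr_out//; nlia.
have m1F (j : 'I_d) : m1 ((aC d).+1 + j)%N = o_evalF O x 0 j.
  by rewrite /m1 (@wr_in _ _ _ _ _ j)// ltn_ord.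
have m1m a : ~~ touched_by_cut a -> m1 a = m a.
  rewrite /touched_by_cut !negb_or => /and3P[sa h1 h2].
  by rewrite /m1 wr_out; [rewrite upd_ne//; nlia|nlia].
have m1B : read_block d m1 (aB d) = read_block d m (aB d).
  apply: read_block_ext => j jd; rewrite /m1 wr_out; last by nlia.
  by rewrite upd_ne//; nlia.
apply: runs_seq; apply: (@runs_evalQ _ _ _ _ _ _ x) => //=.
  by rewrite (std7 S2) truncn_nat.
apply: runs_if => //=; rewrite {1 2}/upd /=.
case: ifPn => qx.
  apply: runs_seq; apply: (@runs_weak _ _ _ _ _ _ _ (20 * d.+1)); [apply: (runs_copybest _ S2)|by []|].
    move=> j jd; rewrite (_ : m1 (aX + j)%N = x 0 (Ordinal jd))//.
    by rewrite -x2 mxE.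
  move=> m' q' [e ->].
  have xj (j : nat) : (j < d)%N -> m' (aX + j)%N = m1 (aX + j)%N.
    by move=> jd; rewrite e// wr_out//; nlia.
  apply: (@runs_evalQ _ _ _ _ _ _ x) => //=.
    rewrite e// wr_out; last by nlia.
    by rewrite (std7 S2) truncn_nat -x2; exact: read_block_ext.
  split.
    move=> a ha; move: (ha); rewrite /touched_by_cut !negb_or => /and3P[sa h1 h2].
    by rewrite e// wr_out ?m1m//; nlia.
  split.
    by move=> j; have jd := ltn_ord j; rewrite e// wr_out ?m1F//; nlia.
  split => //; rewrite -x2; apply/rowP => j; rewrite !mxE.
  by rewrite e// (@wr_in _ _ _ _ _ j)// ltn_ord.
apply: (@runs_le _ _ _ _ _ _ _ 1); last by nlia.
by apply: runs_skip.
Qed.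

End fragments.

(** * The update of the simplex *)

Section step.
Context {d : nat}.
Hypothesis d_gt0 : (0 < d)%N.
Variables (a : nat -> rat) (k : nat).
Hypothesis kd : (k <= d)%N.
Hypothesis kmin : forall i, (i <= d)%N -> a k <= a i.

Let s := (\sum_(0 <= i < d.+1) a i) / d.+1%:R.
Let D := (32 * d ^ 3)%N.
Let g := (8 * d ^ 2)%:R * (s - a k).
Let t i := step_num D g (a i - s) / D%:R.

Let D0 : (0 : rat) < D%:R. Proof. by rewrite ltr0n muln_gt0 expn_gt0 d_gt0. Qed.
Let G8 : 8 <= (8 * d ^ 2)%:R :> rat.
Proof. by rewrite ler_nat leq_pmulr// expn_gt0 d_gt0. Qed.

Lemma argmin_le_avg : a k <= s.
Proof.
rewrite /s ler_pdivlMr ?ltr0n// mulr_natr -[d.+1 in leLHS]subn0 -sumr_const_nat.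
by rewrite !big_mkord; apply: ler_sum => i _; apply: kmin; rewrite -ltnS.
Qed.

Let g0 : 0 <= g. Proof. by rewrite mulr_ge0// subr_ge0 argmin_le_avg. Qed.

Let yg i : (i <= d)%N -> 7 / 8 * g <= a i - s + g.
Proof.
move=> id; have := kmin id; rewrite /g; have := argmin_le_avg; move: G8.
by set w : rat := (_ * _)%:R; move: (a i) (a k) s => x y z; nra.
Qed.

Lemma step_num_bound i : (i <= d)%N -> 0 < step_num D g (a i - s) <= 2 * D%:R.
Proof.
move=> id; have D32 : 32 <= D%:R :> rat.
  by rewrite ler_nat leq_pmulr// expn_gt0 d_gt0.
rewrite /step_num; set z := D%:R * g / _.
have z0 : 0 <= z.
  apply: divr_ge0; first by rewrite mulr_ge0// ltW.
  by have := yg id; move: g0; lra.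
have z2 : z <= 8 / 7 * D%:R.
  move: g0; rewrite le_eqVlt => /predU1P[gE|gp].
    by rewrite /z -gE mulr0 mul0r mulr_ge0// ltW.
  have yp : 0 < a i - s + g by have := yg id; lra.
  rewrite ler_pdivrMr//; have := yg id; move: D0.
  by set w : rat := D%:R; move: (a i - s + g) => v; nra.
have /andP[f1 f2] := floor_itv z.
have f0 : 0 <= (Num.floor z)%:~R :> rat by rewrite ler0z floor_ge0.
by apply/andP; split; lra.
Qed.

Lemma step_gt0 i : (i <= d)%N -> 0 < t i.
Proof. by move=> id; have /andP[? _] := step_num_bound id; exact: divr_gt0. Qed.

Hypothesis ks : a k < s.

Let gp : 0 < g.
Proof. by rewrite mulr_gt0 ?subr_gt0// (lt_le_trans _ G8). Qed.

Let ygp i : (i <= d)%N -> 0 < a i - s + g.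
Proof. by move=> id; have := yg id; have := gp; lra. Qed.

Lemma step_inv_le i : (i <= d)%N -> (t i)^-1 <= 1 + (a i - s) / g.
Proof.
move=> id; have yp := ygp id; have tp := step_gt0 id.
have -> : 1 + (a i - s) / g = (g / (a i - s + g))^-1.
  by rewrite invf_div; field; rewrite gt_eqF.
rewrite lef_pV2; [|exact: tp|by rewrite posrE; apply: divr_gt0; [exact: gp|]].
rewrite /t ler_pdivlMr// /step_num mulrAC [g * _]mulrC.
have /andP[_] := floor_itv (D%:R * g / (a i - s + g)).
by rewrite intrD => /ltW.
Qed.

Lemma step_le i : (i <= d)%N ->
  t i <= (1 + (a i - s) / (s - a k) / (8 * d%:R ^+ 2))^-1 + (32 * d%:R ^+ 3)^-1.
Proof.
move=> id; have yp := ygp id.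
have sk : s - a k != 0 by rewrite gt_eqF// subr_gt0.
have dn0 : d%:R != 0 :> rat by rewrite pnatr_eq0 -lt0n.
have gE : g = 8 * d%:R ^+ 2 * (s - a k) by rewrite /g natrM natrX.
have -> : (1 + (a i - s) / (s - a k) / (8 * d%:R ^+ 2))^-1 = g / (a i - s + g).
  rewrite -[RHS]invf_div; congr (_^-1); rewrite gE; field.
  by rewrite dn0 sk.
have -> : 32 * d%:R ^+ 3 = D%:R :> rat by rewrite /D natrM natrX.
rewrite /t /step_num mulrDl mul1r lerD2r ler_pdivrMr//.
rewrite [leRHS]mulrAC [g * _]mulrC.
by have /andP[] := floor_itv (D%:R * g / (a i - s + g)).
Qed.

Lemma step_prod (k' : 'I_(1 + d)) : k' = k :> nat ->
  \prod_(i < d) t (lift k' i) <= (1 - D%:R^-1) ^+ d.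
Proof.
move=> kk'.
have -> : D%:R = 32 * d%:R ^+ 3 :> rat by rewrite /D natrM natrX.
have sk : s - a k != 0 by rewrite gt_eqF// subr_gt0.
have lt i : (lift k' i <= d)%N by have := ltn_ord (lift k' i).
apply: (@prod_shrink _ _ (fun i => (a (lift k' i) - s) / (s - a k))) => //.
- move=> i; rewrite ler_pdivlMr ?subr_gt0//.
  by have := kmin (lt i); move: (a (lift _ _)) => x; lra.
- rewrite -mulr_suml; apply/eqP; rewrite -subr_eq0; apply/eqP.
  have : \sum_(i < 1 + d) (a i - s) = 0.
    rewrite sumrB sumr_const card_ord -[X in _ - X]mulr_natr /s.
    rewrite -(big_mkord xpredT) divfK ?subrr// ?pnatr_eq0//.
  rewrite (bigD1_ord k')//= kk' => /eqP; rewrite addr_eq0 => /eqP h.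
  by rewrite -[X in X / _]opprK -h opprB mulfV ?subrr.
- by move=> i; apply/ltW/step_gt0.
- by move=> i; exact: step_le.
Qed.

End step.

Section geometry.
Context {R : realType} {d : nat}.
Hypothesis d_gt0 : (0 < d)%N.

Definition Vmat (V : nat -> nat -> rat) : 'M[R]_(1 + d, d) :=
  \matrix_(i, j) ratr (V i j).

Definition enclosed (V : nat -> nat -> rat) (q : 'rV[R]_d) (r w : R) : Prop :=
  (forall i, in_simplex (Vmat V) (row i (corner q r))) /\
  `|\det (homog (Vmat V))| <= w.

Lemma avg_lin (V : nat -> nat -> rat) (c : nat -> rat) :
  (\sum_(0 <= i < d.+1) lin (d := d) V c i) / d.+1%:R =
  \sum_(0 <= j < d) c j * centroid (d := d) V j.
Proof.
rewrite /lin exchange_big_nat/= mulr_suml; apply: eq_bigr => j _.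
by rewrite /centroid -mulr_suml mulrAC mulrC.
Qed.

Lemma enclosed_step (V : nat -> nat -> rat) (c : nat -> rat) (k : nat)
    (q : 'rV[R]_d) (r w : R) :
  let a := lin (d := d) V c in
  let s := (\sum_(0 <= i < d.+1) a i) / d.+1%:R in
  let D := (32 * d ^ 3)%N in
  let g := (8 * d ^ 2)%:R * (s - a k) in
  let t i := step_num D g (a i - s) / D%:R in
  (k <= d)%N -> (forall i, (i <= d)%N -> a k <= a i) ->
  (forall i, 0 < \sum_(j < d) ratr (c j) *
     (ratr (centroid (d := d) V j) - corner q r i j)) ->
  enclosed V q r w ->
  enclosed (fun i j => V k j + (V i j - V k j) * t i) q r ((1 - D%:R^-1) ^+ d * w).
Proof.
move=> a s D g t kd kmin cut [inV detV].
have ratrS : ratr s = \sum_(j < d) ratr (c j) * ratr (centroid (d := d) V j) :> R.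
  rewrite /s /a avg_lin big_mkord rmorph_sum/=.
  by apply: eq_bigr => j _; rewrite rmorphM.
have lin_lt i (l : 'I_(1 + d) -> R) :
    (forall j, row i (corner q r) 0 j = \sum_i l i * Vmat V i j) ->
    \sum_i l i * ratr (a i) < ratr s.
  move=> lV; rewrite -subr_gt0; have := cut i; congr (0 < _).
  under eq_bigr => j _ do rewrite mulrBr.
  rewrite sumrB -ratrS; congr (_ - _).
  transitivity (\sum_(j < d) \sum_i0 l i0 * ratr (V i0 j * c j)).
    apply: eq_bigr => j _; have := lV j; rewrite mxE => ->.
    rewrite mulr_sumr; apply: eq_bigr => i0 _.
    by rewrite !mxE rmorphM/=; ring.
  rewrite exchange_big/=; apply: eq_bigr => i0 _.
  by rewrite -mulr_sumr /a /lin big_mkord rmorph_sum.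
have ks : a k < s.
  have [l [l0 l1] lV] := inV 0; have := lin_lt _ _ lV.
  apply: contraTT; rewrite -!leNgt => sk.
  rewrite -[leLHS]mul1r -l1 mulr_suml; apply: ler_sum => i _.
  rewrite ler_wpM2l// ler_rat (le_trans sk)// kmin//; have := ltn_ord i; lia.
have gp : 0 < g by rewrite mulr_gt0 ?subr_gt0// ltr0n muln_gt0 expn_gt0 d_gt0.
pose k' : 'I_(1 + d) := inord k.
have kk' : k' = k :> nat by rewrite inordK.
have le_d (i : 'I_(1 + d)) : (i <= d)%N by have := ltn_ord i; lia.
have tp i : (i <= d)%N -> 0 < t i by move=> id; exact: (step_gt0 d_gt0 kmin id).
split.
  move=> i; have [l [l0 l1] lV] := inV i.
  apply: (@in_simplex_move _ _ (Vmat V) _ k' (fun i => ratr (t i))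
     (fun i => ratr ((a i - s) / g)) _ l) => //.
  - move=> i' j; rewrite !mxE kk' rmorphD rmorphM rmorphB/=.
    by congr (_ + _); rewrite mulrC.
  - by move=> i'; rewrite ltr0q tp.
  - move=> i'; have := step_inv_le d_gt0 kmin ks (le_d i').
    by rewrite -(ler_rat R) [ratr (1 + _)]rmorphD/= rmorph1 fmorphV.
  - rewrite kk' -(rmorphN1 (@ratr R)) ler_rat.
    have sk : s - a k != 0 by rewrite gt_eqF// subr_gt0.
    have d0 : d%:R != 0 :> rat by rewrite pnatr_eq0 -lt0n.
    rewrite (_ : (a k - s) / g = - (8 * d ^ 2)%:R^-1); last first.
      rewrite /g -[a k - s]opprB mulNr; congr (- _).
      by rewrite invfM mulrCA mulfV// mulr1.
    rewrite lerN2 invf_le1 ?ler1n ?ltr0n muln_gt0 ?expn_gt0 d_gt0//.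
  - rewrite (eq_bigr (fun i' => (l i' * ratr (a i') - l i' * ratr s) * (ratr g)^-1)); last first.
      by move=> i' _; rewrite rmorphM rmorphB fmorphV/= mulrA mulrBr.
    rewrite -mulr_suml sumrB -mulr_suml l1 mul1r.
    rewrite pmulr_lle0 ?invr_gt0 ?ltr0q// subr_le0; apply/ltW.
    exact: lin_lt lV.
rewrite (@det_move_vertices _ _ (Vmat V) _ k' (fun i => ratr (t i))); last first.
  move=> i' j; rewrite !mxE kk' rmorphD rmorphM rmorphB/=.
  by congr (_ + _); rewrite mulrC.
rewrite normrM ler_pM// -rmorph_prod/= ger0_norm; last first.
  by rewrite ler0q prodr_ge0// => i _; apply/ltW/tp/(le_d (lift k' i)).
have := step_prod d_gt0 kmin ks kk'; rewrite -/s -/D -/g.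
by rewrite -(ler_rat R) rmorphXn/= rmorphB/= rmorph1 fmorphV/= ratr_nat.
Qed.

Lemma enclosed_volume V (q : 'rV[R]_d) (r w : R) : 0 <= r ->
  enclosed V q r w -> r ^+ d <= (d.+1)`!%:R * w.
Proof.
move=> r0 [inV detV]; apply: le_trans (simplex_volume r0 inV) _.
by rewrite ler_wpM2l.
Qed.

(* The initial simplex: the corner of the box [-h, h]^d with legs 2 d h. *)
Definition V0 (h : rat) (i j : nat) : rat :=
  if i == j.+1 then - h + 2 * d%:R * h else - h.

Lemma enclosed_init (h : rat) (q : 'rV[R]_d) (r : R) : 0 < h ->
  (forall i j, `|corner q r i j| <= ratr h) ->
  enclosed (V0 h) q r ((2 * d%:R * ratr h) ^+ d).
Proof.
move=> h0 box.
have hR : 0 < ratr h :> R by rewrite ltr0q.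
have dR : 0 < d%:R :> R by rewrite ltr0n.
have E : Vmat (V0 h) = corner (const_mx (- ratr h)) (2 * d%:R * ratr h).
  apply/matrixP => i j; rewrite !mxE /V0.
  rewrite (_ : (i == lift ord0 j) = (i == j.+1 :> nat)); last by rewrite -val_eqE.
  by case: ifP => _; rewrite ?mulr1n ?addr0 ?rmorphD ?rmorphN ?rmorphM/= ?ratr_nat.
have S0 : 0 < 2 * d%:R * ratr h :> R by rewrite mulr_gt0// mulr_gt0//.
split; last first.
  by rewrite E det_corner ger0_norm// exprn_ge0// ltW.
move=> i; set p := row i _.
have pE j : `|p 0 j| <= ratr h by rewrite mxE.
set S := 2 * d%:R * ratr h in E S0 *.
pose b j := (p 0 j + ratr h) / S.
have b0 j : 0 <= b j.
  by apply: divr_ge0; [have /ler_normlP[] := pE j; lra|exact: ltW].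
have b1 : \sum_j b j <= 1.
  rewrite -mulr_suml ler_pdivrMr// mul1r.
  apply: (@le_trans _ _ (\sum_(j < d) 2 * ratr h)).
    by apply: ler_sum => j _; have /ler_normlP[] := pE j; lra.
  by rewrite sumr_const card_ord /S -[_ * _ *+ d]mulr_natr mulrAC.
have bE j : b j * S = p 0 j + ratr h by rewrite divfK ?gt_eqF.
clearbody b.
pose lam (i : 'I_(1 + d)) := if unlift ord0 i is Some j then b j else 1 - \sum_j b j.
have lam0 : lam ord0 = 1 - \sum_j b j by rewrite /lam unlift_none.
have lamS (j : 'I_d) : lam (lift ord0 j) = b j.
  by rewrite /lam; case: unliftP => [j' /lift_inj ->//|/eqP]; rewrite eq_sym (negbTE (neq_lift _ _)).
have lamE (f : 'I_(1 + d) -> R) : \sum_i lam i * f i =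
    (1 - \sum_j b j) * f ord0 + \sum_(j < d) b j * f (lift ord0 j).
  rewrite [LHS]big_ord_recl; congr (_ + _); first by rewrite -lam0.
  by apply: eq_bigr => j _; rewrite -lamS.
exists lam.
- split; first by move=> i'; rewrite /lam; case: unliftP => [j _|_] //; rewrite subr_ge0.
  have := lamE (fun=> 1); under eq_bigr do rewrite mulr1; move=> ->.
  by under [X in _ + X]eq_bigr do rewrite mulr1; rewrite mulr1 subrK.
move=> j; rewrite lamE E.
rewrite [X in _ + X](eq_bigr (fun j' => b j' * - ratr h + b j' * (S *+ (j' == j)))); last first.
  by move=> j' _; rewrite mxE mxE -mulrDr (inj_eq lift_inj).
rewrite [corner _ _ _ _]mxE [const_mx _ _ _]mxE (_ : ord0 == _ = false) ?addr0; last first.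
  exact/negbTE/neq_lift.
rewrite big_split/= -mulr_suml; set B := \sum_j b j.
rewrite (bigD1 j)//= eqxx mulr1n big1 ?addr0; last first.
  by move=> j' /negbTE ->; rewrite mulr0.
by rewrite bE; ring.
Qed.

End geometry.

Section cuts.
Context {R : realType} {d : nat}.
Variables (X : set 'rV[R]_d) (xmax : 'rV[R]_d) (delta rho : R).
Hypotheses (d_gt0 : (0 < d)%N) (cvX : convex_set X) (ballX : eball d 1 `<=` X).
Hypotheses (Xmax : X xmax) (delta0 : 0 < delta) (delta1 : delta <= 1).
Hypotheses (rho1 : 1 <= rho) (boxX : forall v, X v -> forall i, `|v 0 i| <= rho).

Let unit_row (i : 'I_(1 + d)) : 'rV[R]_d := \row_j (i == lift ord0 j)%:R.

Let target (i : 'I_(1 + d)) (j : 'I_d) : R :=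
  corner ((1 - delta) *: xmax) (delta / 2) i j.

Let targetE i j : target i j = (1 - delta) * xmax 0 j + delta * (unit_row i 0 j / 2).
Proof. by rewrite /target !mxE; case: eqP => _ /=; rewrite ?mulr1n ?mulr0n; field. Qed.

Let unit_row01 i j : 0 <= unit_row i 0 j /\ unit_row i 0 j <= 1.
Proof. by rewrite mxE; case: eqP. Qed.

Let enorm_le1 (v : 'rV[R]_d) : dot v v <= 1 -> enorm v <= 1.
Proof. by move=> h; rewrite -[leRHS]sqrtr1 /enorm ler_sqrt. Qed.

Let X_unit_row i : X (unit_row i).
Proof.
apply: ballX; apply: enorm_le1; rewrite /dot.
case: (unliftP ord0 i) => [j0|] ->; last first.
  by rewrite big1// => j _; rewrite mxE (negbTE (neq_lift _ _)) mulr0.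
rewrite (bigD1 j0)//= mxE eqxx mulr1 big1 ?addr0// => j /negbTE jj0.
by rewrite mxE (inj_eq lift_inj) eq_sym jj0 mulr0.
Qed.

Let X_delta (b : R) (l : 'I_d) : `|b| = 1 -> X (b *: delta_mx 0 l).
Proof.
move=> b1; apply: ballX; apply: enorm_le1; rewrite /dot (bigD1 l)//= !mxE !eqxx mulr1.
rewrite big1 ?addr0; first by rewrite -expr2 -real_normK ?num_real// b1 expr1n.
by move=> j /negbTE jl; rewrite !mxE jl andbF mulr0 mul0r.
Qed.

Lemma target_box i j : `|target i j| <= rho.
Proof.
rewrite targetE; have /ler_normlP[h1 h2] := boxX Xmax j.
have [u0 u1] := unit_row01 i j; rewrite ler_norml.
move: (xmax 0 j) (unit_row i 0 j) h1 h2 u0 u1 => x u h1 h2 u0 u1.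
have d1 : 0 <= 1 - delta by rewrite subr_ge0.
have r1 := rho1.
have e1 : (1 - delta) * - rho <= (1 - delta) * x by rewrite ler_wpM2l//; lra.
have e2 : (1 - delta) * x <= (1 - delta) * rho by rewrite ler_wpM2l//; lra.
have e3 : delta * - rho <= delta * (u / 2) by rewrite ler_pM2l//; lra.
have e4 : delta * (u / 2) <= delta * rho by rewrite ler_pM2l//; lra.
by apply/andP; split; lra.
Qed.

Lemma evaluation_cut (c x : 'rV[R]_d) (B gap : R) i :
  enorm c <= B -> gap < dot c (x - xmax) ->
  delta * (2 * d%:R * rho * B) <= gap ->
  0 < \sum_j c 0 j * (x 0 j - target i j).
Proof.
move=> cB gapc dgap; have r1 := rho1; have dl0 := delta0.
have B0 : 0 <= B by apply: le_trans cB; exact: sqrtr_ge0.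
have cj j : `|c 0 j| <= B.
  apply: le_trans cB; rewrite /enorm -sqrtr_sqr ler_sqrt ?sqr_ge0//; last first.
    by rewrite /dot sumr_ge0// => l _; rewrite -expr2 sqr_ge0.
  by rewrite /dot (bigD1 j)//= -expr2 lerDl sumr_ge0// => l _; rewrite -expr2 sqr_ge0.
have -> : \sum_j c 0 j * (x 0 j - target i j) =
    dot c (x - xmax) + delta * \sum_j c 0 j * (xmax 0 j - unit_row i 0 j / 2).
  rewrite /dot mulr_sumr -big_split/=; apply: eq_bigr => j _.
  by rewrite targetE !mxE; ring.
have : `|\sum_j c 0 j * (xmax 0 j - unit_row i 0 j / 2)| <= 2 * d%:R * rho * B.
  apply: le_trans (ler_norm_sum _ _ _) _.
  apply: (@le_trans _ _ (\sum_(j < d) B * (2 * rho))).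
    apply: ler_sum => j _; rewrite normrM ler_pM//.
    have := boxX Xmax j; have := unit_row01 i j; move: (xmax 0 j) (unit_row i 0 j) => y u.
    by rewrite !ler_norml => -[u0 u1] /andP[y0 y1]; apply/andP; split; lra.
  by rewrite sumr_const card_ord -[_ *+ d]mulr_natr; nra.
rewrite ler_norml => /andP[h _].
have : delta * - (2 * d%:R * rho * B) <= delta * \sum_j c 0 j * (xmax 0 j - unit_row i 0 j / 2).
  by rewrite ler_wpM2l// ltW.
by rewrite mulrN; lra.
Qed.

Lemma separation_cut (c x : 'rV[rat]_d) (e : rat) (W : R) i :
  \big[Num.max/0]_(i < d) `|c 0 i| = 1 ->
  (forall v, X v -> dot (ratv R c) v < dot (ratv R c) (ratv R x)) ->
  0 < e -> (forall j, `|ratr (x 0 j) : R| <= W) -> rho <= W ->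
  4 * d%:R * W * ratr e <= delta ->
  0 < \sum_j ratr (Num.floor (c 0 j / e))%:~R * (ratr (x 0 j) - target i j).
Proof.
move=> cmax sep e0 xW rW eW; have r1 := rho1; have dl0 := delta0; have dl1 := delta1.
have [l cl] : exists l, `|c 0 l| = 1.
  have h := @bigmax_eq_arg _ _ _ 0 (Ordinal d_gt0) predT (fun i => `|c 0 i|) isT
    (fun _ _ => normr_ge0 _).
  by eexists; rewrite -[RHS]cmax; exact/esym/h.
have eR : 0 < ratr e :> R by rewrite ltr0q.
set C : 'rV[R]_d := ratv R c in sep *.
have CE j : C 0 j = ratr (c 0 j) by rewrite mxE.
have Cl : `|C 0 l| = 1 by rewrite CE -ratr_norm cl rmorph1.
pose th j : R := C 0 j / ratr e - ratr (Num.floor (c 0 j / e))%:~R.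
have th01 j : 0 <= th j /\ th j <= 1.
  have /andP[] := floor_itv (c 0 j / e); rewrite intrD => f1 f2.
  have -> : th j = ratr (c 0 j / e - (Num.floor (c 0 j / e))%:~R).
    by rewrite /th CE rmorphB/= fmorph_div.
  split; first by rewrite ler0q subr_ge0.
  by rewrite -(rmorph1 (@ratr R)) ler_rat lerBlDr addrC ltW.
have -> : \sum_j ratr (Num.floor (c 0 j / e))%:~R * (ratr (x 0 j) - target i j) =
   (\sum_j C 0 j * (ratr (x 0 j) - target i j)) / ratr e
   - \sum_j th j * (ratr (x 0 j) - target i j).
  rewrite mulr_suml -sumrB; apply: eq_bigr => j _; rewrite /th.
  by field; rewrite gt_eqF.
have th_le : \sum_j th j * (ratr (x 0 j) - target i j) <= 2 * d%:R * W.
  apply: (@le_trans _ _ (\sum_(j < d) (2 * W))).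
    apply: ler_sum => j _; have := th01 j; have := xW j; have := target_box i j.
    move: (th j) (ratr (x 0 j)) (target i j) => t y z.
    rewrite !ler_norml => /andP[? ?] /andP[? ?] [? ?].
    apply: (@le_trans _ _ (t * (2 * W))); first by rewrite ler_wpM2l//; lra.
    by rewrite ler_piMl//; lra.
  by rewrite sumr_const card_ord -[_ *+ d]mulr_natr; lra.
have half : 2^-1 < dot C (ratv R x) - \sum_j C 0 j * (unit_row i 0 j / 2).
  pose b := Num.sg (C 0 l).
  have b1 : `|b| = 1 by rewrite normr_sg; case: eqP Cl => // ->; rewrite normr0 => /eqP; rewrite eq_sym oner_eq0.
  have Xz := convex_setP cvX (X_unit_row i) (X_delta l b1) (_ : 0 <= 2^-1) (_ : 2^-1 <= 1).
  have := sep _ (Xz _ _); rewrite ltrBrDr => /(_ ltac:(lra) ltac:(lra)); apply: le_lt_trans.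
  rewrite /dot.
  under [leRHS]eq_bigr => j _ do rewrite !mxE mulrDr.
  rewrite big_split/= addrC lerD//.
    rewrite (bigD1 l)//= big1 ?addr0; last first.
      by move=> j /negbTE jl; rewrite jl !mulr0.
    have Cb : C 0 l * b = 1 by rewrite mulrC /b -normrEsg.
    by rewrite eqxx mulr1 mulrCA -CE Cb; lra.
  by apply: ler_sum => j _; rewrite -CE [unit_row _ _ _]mxE [_ / 2]mulrC.
have Xs := sep _ Xmax.
have main : delta / 2 < \sum_j C 0 j * (ratr (x 0 j) - target i j).
  have -> : \sum_j C 0 j * (ratr (x 0 j) - target i j) =
     (1 - delta) * (dot C (ratv R x) - dot C xmax) +
     delta * (dot C (ratv R x) - \sum_j C 0 j * (unit_row i 0 j / 2)).
    rewrite /dot -!sumrB !mulr_sumr -big_split/=; apply: eq_bigr => j _.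
    by rewrite targetE [ratv R x 0 j]mxE; ring.
  move: half Xs; set A := dot C _; set A' := dot C xmax; set A'' := \sum_j _.
  clearbody A A' A''; move=> h1 h2; nra.
rewrite subr_gt0; apply: le_lt_trans th_le _.
rewrite ltr_pdivlMr//; apply: le_lt_trans main; lra.
Qed.

End cuts.

(** * Bit lengths *)

Definition grid (D M : nat) (x : rat) : Prop :=
  x * D%:R \is a Num.int /\ `|x| <= M%:R.

Lemma grid_weak D M D' M' x : (D %| D')%N -> (M <= M')%N -> grid D M x -> grid D' M' x.
Proof.
move=> /dvdnP[k ->] MM' [xi xM]; split; last by rewrite (le_trans xM)// ler_nat.
by rewrite mulnC natrM mulrA rpredM// natr_int.
Qed.

Lemma grid_int M x : x \is a Num.int -> `|x| <= M%:R -> grid 1 M x.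
Proof. by move=> xi xM; split => //; rewrite mulr1. Qed.

Lemma grid0 D M : grid D M 0.
Proof. by split; rewrite ?mul0r ?normr0. Qed.

Lemma gridD D M M' x y : grid D M x -> grid D M' y -> grid D (M + M') (x + y).
Proof.
move=> [xi xM] [yi yM]; split; first by rewrite mulrDl rpredD.
by rewrite natrD (le_trans (ler_normD _ _))// lerD.
Qed.

Lemma gridN D M x : grid D M x -> grid D M (- x).
Proof. by move=> [xi xM]; split; rewrite ?mulNr ?rpredN ?normrN. Qed.

Lemma gridB D M M' x y : grid D M x -> grid D M' y -> grid D (M + M') (x - y).
Proof. by move=> xg yg; apply: gridD => //; exact: gridN. Qed.

Lemma gridM D D' M M' x y : grid D M x -> grid D' M' y -> grid (D * D') (M * M') (x * y).
Proof.
move=> [xi xM] [yi yM]; split; first by rewrite natrM mulrACA rpredM.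
by rewrite normrM natrM ler_pM.
Qed.

Lemma grid_sum D M (f : nat -> rat) n : (forall i, (i < n)%N -> grid D M (f i)) ->
  grid D (n * M) (\sum_(0 <= i < n) f i).
Proof.
elim: n => [|n IH] fg; first by rewrite big_geq//; exact: grid0.
rewrite big_nat_recr//= mulSn addnC; apply: gridD; last exact: fg.
by apply: IH => i iN; apply: fg; exact: ltnW.
Qed.

Lemma grid_div D M k x : (0 < k)%N -> grid D M x -> grid (D * k) M (x / k%:R).
Proof.
move=> k0 [xi xM]; split.
  by rewrite natrM mulrA mulrAC divfK// pnatr_eq0 -lt0n.
rewrite normrM (le_trans _ xM)// ler_piMr//.
by rewrite ger0_norm// invf_le1 ?ltr0n// ler1n.
Qed.

Lemma grid_bitlen D M x a b : (D <= 2 ^ a)%N -> (M * D <= 2 ^ b)%N -> (0 < D)%N ->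
  grid D M x -> (bitlen x <= a + b + 2)%N.
Proof.
move=> Da MDb D0 [/intrP[z xz] xM].
have Dq : D%:R != 0 :> rat by rewrite pnatr_eq0 -lt0n.
have xE : x = z%:~R / (D%:Z)%:~R by rewrite -xz -[(D%:Z)%:~R]/(D%:R) mulfK.
have [k [zk Dk]] : exists k, z = k * numq x /\ D%:Z = k * denq x.
  rewrite xE; have : D%:Z != 0 by case: (D) D0.
  by case: (divqP z D) => [z' /eqP//|k y k0 _]; exists k.
have k0 : k != 0 by apply: contraTneq D0 => k0; move: Dk; rewrite k0 mul0r => -[->].
have k1 : (0 < `|k|)%N by rewrite absz_gt0.
have zM : (`|z| <= M * D)%N.
  rewrite -(ler_nat rat) natrM -[(`|z|%N)%:R]/(`|z|%N%:~R) abszE intr_norm -xz.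
  by rewrite normrM [`|D%:R|]ger0_norm// ler_wpM2r.
have nz : (`|numq x| <= 2 ^ b)%N.
  by apply: leq_trans (leq_trans zM MDb); rewrite zk abszM leq_pmull.
have dD : (`|denq x| <= 2 ^ a)%N.
  by apply: leq_trans Da; rewrite -[D]/(`|D%:Z|%N) Dk abszM leq_pmull.
rewrite /bitlen; have := leq_trunc_log 2 nz; have := leq_trunc_log 2 dD.
by rewrite !trunc_expnK//; lia.
Qed.

Lemma bitlen_denq x a : (bitlen x <= a)%N -> (`|denq x| <= 2 ^ a)%N.
Proof.
move=> ba; apply/ltnW; apply: leq_trans (trunc_log_ltn _ (isT : (1 < 2)%N)) _.
by rewrite leq_exp2l//; move: ba; rewrite /bitlen; lia.
Qed.

Lemma bitlen_norm x a : (bitlen x <= a)%N -> `|x| <= (2 ^ a)%:R.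
Proof.
move=> ba; have nx : (`|numq x| <= 2 ^ a)%N.
  apply/ltnW; apply: leq_trans (trunc_log_ltn _ (isT : (1 < 2)%N)) _.
  by rewrite leq_exp2l//; move: ba; rewrite /bitlen; lia.
rewrite -(ler_nat rat) in nx; apply: le_trans nx.
rewrite -[leLHS]/(`|x|) -{1}(divq_num_den x) normrM normfV.
rewrite -[(`|numq x|%N)%:R]/(`|numq x|%N%:~R) abszE intr_norm ler_piMr//.
by rewrite invf_le1 ?normr_gt0 ?intr_eq0 ?denq_neq0// -intr_norm -[1]/(1%:~R) ler_int -gtz0_ge1 normr_gt0 denq_neq0.
Qed.

Lemma bitlen_grid d (v : 'rV[rat]_d) : exists2 D : nat, (0 < D <= 2 ^ bitlenv v)%N &
  forall i, grid D (2 ^ bitlenv v) (v 0 i).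
Proof.
exists (\prod_(i < d) `|denq (v 0%R i)|)%N.
  rewrite prodn_gt0/= => [|i]; last by rewrite absz_gt0 denq_neq0.
  rewrite /bitlenv expn_sum; apply: leq_prod => i _; exact: bitlen_denq.
move=> i; have bi : (bitlen (v 0%R i) <= bitlenv v)%N.
  by rewrite /bitlenv (bigD1 i)//= leq_addr.
split; last exact: bitlen_norm.
rewrite (bigD1 i)//= natrM mulrA rpredM ?natr_int//.
have -> : (`|denq (v 0%R i)|%N)%:R = (denq (v 0 i))%:~R :> rat.
  by rewrite -[(`|_|%N)%:R]/(`|_|%N%:~R) abszE ger0_norm// denq_ge0.
by rewrite -{1}(divq_num_den (v 0 i)) divfK ?intr_int// intr_eq0 denq_neq0.
Qed.

(** * Sizes of the numbers in one step *)

Lemma size_facts d D G P : (32 <= D)%N -> G = (8 * d ^ 2)%N ->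
  P = (64 * D * d.+1 ^ 4)%N ->
  [/\ (32 * (d.+1 * d.+1) <= P)%N, (D * (G * (d.+1 * d.+1)) <= P)%N,
    (2 * D + 1 <= P)%N & (d.+1 * d.+1 + G * (d.+1 * d.+1) <= P)%N].
Proof.
move=> D32 GE PE.
have e4 : (d.+1 * d.+1 <= d.+1 ^ 4)%N by rewrite mulnn leq_pexp2l.
have e42 : (d ^ 2 * (d.+1 * d.+1) <= d.+1 ^ 4)%N.
  by rewrite mulnn -[4%N]/(2 + 2)%N expnD leq_mul2r leq_exp2r// leqnSn orbT.
have Ge : (G * (d.+1 * d.+1) <= 8 * d.+1 ^ 4)%N by rewrite GE -mulnA leq_mul2l e42 orbT.
have e1 : (0 < d.+1 ^ 4)%N by rewrite expn_gt0.
rewrite PE -mulnA; clear PE GE e42; move: e4 Ge e1.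
move: (d.+1 ^ 4)%N (d.+1 * d.+1)%N (G * (d.+1 * d.+1))%N.
move=> E Z Y h1 h2 h3.
have hE : (32 * E <= D * E)%N by rewrite leq_mul2r D32 orbT.
have hD : (D <= D * E)%N by rewrite leq_pmulr// h3.
have hY : (D * Y <= 8 * (D * E))%N by rewrite [leqRHS]mulnCA leq_mul2l h2 orbT.
move: (D * E)%N (D * Y)%N hE hD hY => X X' hE hD hY.
by split; lia.
Qed.

Section iteration_sizes.
Context {d : nat} (C : nat).
Hypothesis d_gt0 : (0 < d)%N.
Variables (V : nat -> nat -> rat) (c : nat -> rat) (k Dv W Df Mc D G P : nat).
Hypotheses (DE : D == (32 * d ^ 3)%N) (GE : G == (8 * d ^ 2)%N).
Hypothesis P_facts : [/\ (32 * (d.+1 * d.+1) <= P)%N, (D * (G * (d.+1 * d.+1)) <= P)%N,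
    (2 * D + 1 <= P)%N & (d.+1 * d.+1 + G * (d.+1 * d.+1) <= P)%N].

Let a := lin (d := d) V c.
Let s := (\sum_(0 <= i < d.+1) a i) / d.+1%:R.
Let g := G%:R * (s - a k).
Let t i := step_num D g (a i - s) / D%:R.

Definition size_den : nat := (d.+1 * (Df * (Dv * D)))%N.
Definition size_num : nat := (P * (W * Mc))%N.

Hypotheses (kd : (k <= d)%N) (kmin : forall i, (i <= d)%N -> a k <= a i).
Hypotheses (W0 : (0 < W)%N) (Mc0 : (0 < Mc)%N).
Hypothesis gridV : forall i j, (i <= d)%N -> (j < d)%N -> grid Dv W (V i j).
Hypothesis gridc : forall j, (j < d)%N -> grid Df Mc (c j).
Hypothesis small_grid : forall x, grid size_den size_num x -> small C x.

Let snb i : (i <= d)%N -> 0 < step_num D g (a i - s) <= 2 * D%:R.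
Proof. by move=> id; rewrite /g (eqP DE) (eqP GE); exact: step_num_bound. Qed.

Let sni i : step_num D g (a i - s) \is a Num.int.
Proof. by rewrite rpredD// intr_int. Qed.

Let D32 : (32 <= D)%N. Proof. by rewrite (eqP DE) leq_pmulr// expn_gt0 d_gt0. Qed.

Let sm D' K x : (D' %| size_den)%N -> (K <= P)%N ->
  grid D' (K * (W * Mc)) x -> small C x.
Proof.
move=> DD KK xg; apply: small_grid; apply: grid_weak xg => //.
by rewrite leq_mul2r KK orbT.
Qed.

Let T1 : (0 < W * Mc)%N. Proof. by rewrite muln_gt0 W0. Qed.

Let dv_div : (Dv %| size_den)%N.
Proof. by rewrite /size_den dvdn_mull// dvdn_mull// dvdn_mulr. Qed.
Let dvf_div : (Dv * Df %| size_den)%N.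
Proof. by rewrite /size_den dvdn_mull// mulnC dvdn_mul// dvdn_mulr. Qed.
Let dvfd_div : (Dv * Df * d.+1 %| size_den)%N.
Proof. by rewrite /size_den mulnC dvdn_mul// mulnC dvdn_mul// dvdn_mulr. Qed.
Let dvD_div : (Dv * D %| size_den)%N.
Proof. by rewrite /size_den dvdn_mull// dvdn_mull. Qed.

Let gridW D' K x : grid D' (K * W) x -> grid D' (K * (W * Mc)) x.
Proof. by apply: grid_weak => //; rewrite mulnA leq_pmulr. Qed.

Let ga i : (i <= d)%N -> grid (Dv * Df) (d * (W * Mc)) (a i).
Proof.
move=> id; apply: grid_sum => j jd; apply: gridM; [exact: gridV|exact: gridc].
Qed.

Let gs : grid (Dv * Df * d.+1) (d.+1 * d * (W * Mc)) s.
Proof. by rewrite -[(d.+1 * d * _)%N]mulnA; apply: grid_div => //; apply: grid_sum => i id; exact: ga. Qed.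

Let gsa i : (i <= d)%N -> grid (Dv * Df * d.+1) (d.+1 * d.+1 * (W * Mc)) (s - a i).
Proof.
move=> id.
have -> : (d.+1 * d.+1 * (W * Mc) = d.+1 * d * (W * Mc) + d.+1 * (W * Mc))%N by ring.
apply: gridB gs _; apply: grid_weak (ga id); first by rewrite dvdn_mulr.
by rewrite leq_mul2r leqnSn orbT.
Qed.

Let gg i : (i <= d)%N ->
  grid (Dv * Df * d.+1) (G * (d.+1 * d.+1) * (W * Mc)) (G%:R * (s - a i)).
Proof.
move=> id; rewrite -[(G * _ * _)%N]mulnA -[(Dv * Df * d.+1)%N]mul1n; apply: gridM; last exact: gsa.
by apply: grid_int; rewrite ?natr_int// normr_nat.
Qed.

Ltac bnd := case: P_facts => F1 F2 F3 F4; nlia.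

Lemma small_sumV j l : (j < d)%N -> (l <= d.+1)%N ->
  small C (\sum_(0 <= i < l) V i j).
Proof.
move=> jd ld; apply: (@sm Dv l) => //; first bnd.
by apply/gridW/grid_sum => i il; apply: gridV => //; nlia.
Qed.

Lemma small_centroid j : (j < d)%N -> small C (centroid (d := d) V j).
Proof.
move=> jd; apply: (@sm (Dv * d.+1) d.+1) => //.
- by rewrite /size_den mulnC dvdn_mul// dvdn_mull// dvdn_mulr.
- bnd.
by apply/gridW/grid_div => //; apply: grid_sum => i il; apply: gridV => //; nlia.
Qed.

Lemma small_cut_entry j : (j < d)%N -> small C (c j).
Proof.
move=> jd; apply: (@sm Df 1) => //; first by rewrite /size_den dvdn_mull// dvdn_mulr.
  bnd.
by rewrite mul1n; apply: grid_weak (gridc jd) => //; rewrite leq_pmull.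
Qed.

Lemma small_mul i j : (i <= d)%N -> (j < d)%N -> small C (V i j * c j).
Proof.
move=> id jd; apply: (@sm (Dv * Df) 1) => //; first bnd.
by rewrite mul1n; apply: gridM; [exact: gridV|exact: gridc].
Qed.

Lemma small_sum_mul i l : (i <= d)%N -> (l <= d)%N ->
  small C (\sum_(0 <= j < l) V i j * c j).
Proof.
move=> id ld; apply: (@sm (Dv * Df) l) => //; first bnd.
by apply: grid_sum => j jl; apply: gridM; [apply: gridV|apply: gridc] => //; nlia.
Qed.

Lemma small_sum_lin l : (l <= d.+1)%N -> small C (\sum_(0 <= i < l) a i).
Proof.
move=> ld; have ldd : (l * d <= d.+1 * d.+1)%N := leq_mul ld (leqnSn d).
apply: (@sm (Dv * Df) (l * d)) => //; first bnd.
by rewrite -[(l * d * _)%N]mulnA; apply: grid_sum => i il; apply: ga; nlia.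
Qed.

Lemma small_avg : small C s.
Proof.
have dd : (d.+1 * d <= d.+1 * d.+1)%N by rewrite leq_mul2l leqnSn orbT.
by apply: (sm _ _ gs) => //; bnd.
Qed.

Lemma small_gap i : (i <= d)%N -> small C (s - a i) /\ small C (G%:R * (s - a i)).
Proof.
move=> id; split; first by apply: (sm _ _ (gsa id)) => //; bnd.
by apply: (sm _ _ (gg id)) => //; bnd.
Qed.

Let gg_kd : grid (Dv * Df * d.+1) (G * (d.+1 * d.+1) * (W * Mc)) g.
Proof. exact: gg. Qed.

Lemma small_Dg : small C (D%:R * g).
Proof.
apply: (@sm (1 * (Dv * Df * d.+1)) (D * (G * (d.+1 * d.+1)))); first by rewrite mul1n.
  bnd.
rewrite -[(D * _ * _)%N]mulnA; apply: gridM => //.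
by apply: grid_int; rewrite ?natr_int// normr_nat.
Qed.

Let gt i : (i <= d)%N -> grid D 2 (t i).
Proof.
move=> id; have D0 : D%:R != 0 :> rat by rewrite pnatr_eq0 -lt0n; move: D32; nlia.
have /andP[n0 n2] := snb id; have Dp : (0 : rat) < D%:R by rewrite lt_neqAle eq_sym D0 ler0n.
split; first by rewrite /t divfK//; exact: sni.
by rewrite ger0_norm /t ?ler_pdivrMr// divr_ge0// ltW.
Qed.

Lemma small_step i : (i <= d)%N -> [/\ small C (a i - s), small C (a i - s + g),
  small C (step_num D g (a i - s) - 1), small C (step_num D g (a i - s)) & small C (t i)].
Proof.
move=> id; have /andP[n0 n2] := snb id; have ni := sni i.
have gas : grid (Dv * Df * d.+1) (d.+1 * d.+1 * (W * Mc)) (a i - s).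
  by rewrite -opprB; apply: gridN; exact: gsa.
split.
- by apply: (sm _ _ gas) => //; bnd.
- apply: (@sm _ (d.+1 * d.+1 + G * (d.+1 * d.+1))); last by rewrite mulnDl; exact: gridD gas gg_kd.
    by [].
  bnd.
- apply: (@sm 1 (2 * D + 1)) => //; first bnd.
  apply: (@grid_weak _ (2 * D + 1)) => //; first by rewrite leq_pmulr.
  by apply: gridB; apply: grid_int => //; rewrite ger0_norm ?natrM// ltW.
- apply: (@sm 1 (2 * D)) => //; first bnd.
  apply: (@grid_weak _ (2 * D)) => //; first by rewrite leq_pmulr.
  by apply: grid_int => //; rewrite ger0_norm ?natrM// ltW.
- apply: (@sm D 2); last by apply: grid_weak (gt id) => //; rewrite leq_pmulr.
    by rewrite /size_den dvdn_mull// dvdn_mull// dvdn_mull.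
  bnd.
Qed.

Lemma grid_next i j : (i <= d)%N -> (j < d)%N ->
  grid (Dv * D) (3 * W) (V k j + (V i j - V k j) * t i).
Proof.
move=> id jd; have [ti t2] := gt id; have [Vi VW] := gridV id jd.
have [Vki VkW] := gridV kd jd; split.
  have -> : (V k j + (V i j - V k j) * t i) * (Dv * D)%:R =
     V k j * Dv%:R * D%:R + (V i j * Dv%:R - V k j * Dv%:R) * (t i * D%:R).
    by rewrite natrM; ring.
  by rewrite rpredD// rpredM// ?natr_int// rpredB.
have t0 : 0 <= t i by have /andP[n0 _] := snb id; rewrite divr_ge0// ltW.
rewrite ger0_norm// in t2.
rewrite natrM; move: VW VkW; rewrite !ler_norml.
move: (V k j) (V i j) (t i) t0 t2 => x y z z0 z2 /andP[y1 y2] /andP[x1 x2].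
have w0 : 0 <= W%:R :> rat by []. move: (W%:R) w0 y1 y2 x1 x2 => w w0 y1 y2 x1 x2.
by apply/andP; split; nra.
Qed.

Lemma small_move i j : (i <= d)%N -> (j < d)%N ->
  [/\ small C (V i j - V k j), small C ((V i j - V k j) * t i) &
      small C (V k j + (V i j - V k j) * t i)].
Proof.
move=> id jd; have gB := gridB (gridV id jd) (gridV kd jd); split.
- apply: (@sm Dv 2) => //; first bnd.
  by apply: gridW; rewrite mul2n -addnn.
- apply: (@sm (Dv * D) 4) => //; first bnd.
  apply: gridW; rewrite (_ : 4 * W = (W + W) * 2)%N; last by lia.
  by apply: gridM => //; exact: gt.
- apply: (@sm (Dv * D) 3) => //; first bnd.
  by apply: gridW; exact: grid_next.
Qed.

End iteration_sizes.

Definition Body : com :=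
  (Centroid ;; Cut ;; Products ;; Argmin ;; Update ;;
   Op Div (Dir 15) (Dir 15) (Dir 28))%com.

Section body.
Context {R : realType} {d : nat} (O : oracles R d) (C D G P : nat).
Hypothesis d_gt0 : (0 < d)%N.
Hypotheses (DE : D == (32 * d ^ 3)%N) (GE : G == (8 * d ^ 2)%N).
Hypothesis P_facts : [/\ (32 * (d.+1 * d.+1) <= P)%N, (D * (G * (d.+1 * d.+1)) <= P)%N,
    (2 * D + 1 <= P)%N & (d.+1 * d.+1 + G * (d.+1 * d.+1) <= P)%N].
Hypothesis small_addr : forall n, (n <= 64 + 5 * blockL d)%N -> small C n%:R.

Let L := blockL d.

Let Ld : (d.+1 <= L)%N. Proof. by rewrite /L /blockL leq_pmull. Qed.

Definition center (V : nat -> nat -> rat) : 'rV[rat]_d := \row_j centroid (d := d) V j.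

Definition cut_vector (x : 'rV[rat]_d) (e : rat) (c : nat -> rat) : Prop :=
  forall j : 'I_d, c j = match o_sep O x with
    | None => o_evalF O x 0 j
    | Some c' => (Num.floor (c' 0 j / e))%:~R
    end.

Definition best_update (x b : 'rV[rat]_d) (v : R) (b' : 'rV[rat]_d) (v' : R) : Prop :=
  if o_sep O x is None then
    if v <= o_valQ O x then b' = x /\ v' = o_valQ O x else b' = b /\ v' = v
  else b' = b /\ v' = v.

Definition body_post m (q : nat -> R) m' (q' : nat -> R) : Prop :=
  let V := entry d m in
  [/\ std d D G m', m' 15%N = m 15%N / 4, m' 16%N = m 16%N, m' 17%N = m 17%N &
   best_update (center V) (read_block d m (aB d)) (q 0%N)
     (read_block d m' (aB d)) (q' 0%N) /\
   exists c k, [/\ cut_vector (center V) (m 15%N) c, (k <= d)%N,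
     forall i, (i <= d)%N -> lin (d := d) V c k <= lin (d := d) V c i &
     let a := lin (d := d) V c in
     let s := (\sum_(0 <= i < d.+1) a i) / d.+1%:R in
     let t i := step_num D (G%:R * (s - a k)) (a i - s) / D%:R in
     forall i j, (i <= d)%N -> (j < d)%N ->
       entry d m' i j = V k j + (V i j - V k j) * t i]].

Lemma runs_body m q (Dv W : nat) :
  let x := center (entry d m) in
  std d D G m -> (0 < W)%N ->
  (forall i j, (i <= d)%N -> (j < d)%N -> grid Dv W (entry d m i j)) ->
  (1 + bitlenv x <= C)%N ->
  (o_sep O x = None -> (1 + bitlenv x + o_timeF O x + bitlenv (o_evalF O x) <= C)%N) ->
  (forall c, cut_vector x (m 15%N) c -> exists Df Mc, [/\ (0 < Mc)%N,
     forall j, (j < d)%N -> grid Df Mc (c j) &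
     forall y, grid (size_den (d := d) Dv Df D) (size_num W Mc P) y -> small C y]) ->
  small C (m 15%N / 4) ->
  runs O C Body m q (1000 * d.+1 ^ 2) (body_post m q).
Proof.
move=> x S W0 gV sx sF sc se.
have hL := Ld; have aVE : (aV d = 64 + 3 * L)%N by [].
have aCE : (aC d = 64 + L)%N by []. have aBE : (aB d = 64 + 2 * L)%N by [].
have aAE : (aA d = 64 + 4 * L)%N by []. have aXE : aX = 64%N by [].
set V := entry d m in gV *.
have [c0 cut0] : exists c0, cut_vector x (m 15%N) c0.
  exists (fun j => if insub j is Some j' then match o_sep O x with
    | None => o_evalF O x 0 j'
    | Some c' => (Num.floor (c' 0 j' / m 15%N))%:~R end else 0).
  by move=> j; rewrite valK.
have [Df0 [Mc0 [Mc00 gc0 sg0]]] := sc _ cut0.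
apply: (@runs_le _ _ _ _ _ _ _ (100 * d.+1 ^ 2 + (100 * d.+1 + (100 * d.+1 ^ 2 +
   (100 * d.+1 + (200 * d.+1 ^ 2 + 1)))))); last by clear; nia.
have entry_off m1 m2 : (forall a, (aV d <= a < aV d + L)%N -> m1 a = m2 a) ->
    forall i j, (i <= d)%N -> (j < d)%N -> entry d m1 i j = entry d m2 i j.
  move=> e i j id jd; apply: e; have : (i * d + j < L)%N := entry_lt d_gt0 id jd.
  by nlia.
apply: runs_seq; apply: (runs_weak (runs_centroid (D := D) (G := G) O d_gt0 small_addr _ S _ _) (leqnn _)).
- by move=> j l jd ld; apply: (small_sumV d_gt0 DE P_facts (leq0n d) W0 Mc00 gV sg0).
- by move=> j jd; apply: (small_centroid d_gt0 DE P_facts (leq0n d) W0 Mc00 gV sg0).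
move=> m1 q1 [e1 ->].
have S1 : std d D G m1 by apply: std_eqm e1 _; exact: std_wr.
have x1 : read_block d m1 aX = x.
  apply/rowP => j; rewrite !mxE e1; last by rewrite /scratch; nlia.
  by rewrite (@wr_in _ _ _ _ _ j).
have V1 i j : (i <= d)%N -> (j < d)%N -> entry d m1 i j = V i j.
  move=> id jd; apply: entry_off => // a ha.
  rewrite e1; last by rewrite /scratch; nlia.
  by rewrite wr_out//; nlia.
have low1 a : (a < 64)%N -> ~~ scratch a -> m1 a = m a.
  by move=> a64 sa; rewrite e1// wr_out//; nlia.
have m115 : m1 15%N = m 15%N by rewrite low1.
have best1 : read_block d m1 (aB d) = read_block d m (aB d).
  apply: read_block_ext => j jd; rewrite e1; last by rewrite /scratch; nlia.
  by rewrite wr_out//; nlia.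
apply: runs_seq; apply: (runs_weak (runs_cut (D := D) (G := G) d_gt0 small_addr _ S1 x1 sx _ sF _) (leqnn _)).
- by move=> j; rewrite mxE; apply: (small_centroid d_gt0 DE P_facts (leq0n d) W0 Mc00 gV sg0).
- move=> c' sE j; have := cut0 j; rewrite sE m115 => <-.
  exact: (small_cut_entry d_gt0 DE P_facts (leq0n d) W0 Mc00 gc0 sg0).
move=> m2 q2 [off2 post2].
have off2' b : ~~ scratch b -> (b < 64)%N || (64 + 3 * L <= b)%N -> m2 b = m1 b.
  move=> sb hb; apply: off2; rewrite /touched_by_cut (negbTE sb) negb_or.
  by apply/andP; split; nlia.
have S2 : std d D G m2.
  by case: S1 => *; split; (rewrite off2'; [assumption|by []|by []]).
have V2 i j : (i <= d)%N -> (j < d)%N -> entry d m2 i j = V i j.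
  move=> id jd; rewrite -V1//; apply: entry_off => // a ha.
  by apply: off2'; rewrite /scratch; nlia.
pose c j := m2 ((aC d).+1 + j)%N.
have cutc : cut_vector x (m 15%N) c.
  move=> j; rewrite /c; move: post2; case: (o_sep O x) => [c'|] [h1 _].
    by move=> _; rewrite h1 m115.
  by rewrite h1.
have [Df [Mc [Mc1 gc sg]]] := sc _ cutc.
apply: runs_seq; apply: (runs_weak (@runs_products _ _ O C D G d_gt0 small_addr _ _ V c S2 V2 _ _ _) (leqnn _)).
- by [].
- by move=> i j id jd; apply: (small_mul d_gt0 DE P_facts (leq0n d) W0 Mc1 gV gc sg).
- by move=> i l id ld; apply: (small_sum_mul d_gt0 DE P_facts (leq0n d) W0 Mc1 gV gc sg).
move=> m3 q3 [e3 ->].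
pose a := lin (d := d) V c.
have S3 : std d D G m3 by apply: std_eqm e3 _; apply: std_wr => //; nlia.
have a3 i : (i <= d)%N -> m3 (aA d + i)%N = a i.
  move=> id; rewrite e3; last by rewrite /scratch; nlia.
  by rewrite (@wr_in _ _ _ _ _ i).
have off3 b : ~~ scratch b -> (b < aA d)%N -> m3 b = m2 b.
  by move=> sb ba; rewrite e3// wr_out//; nlia.
have V3 i j : (i <= d)%N -> (j < d)%N -> entry d m3 i j = V i j.
  move=> id jd; rewrite -V2//; apply: entry_off => // b hb.
  by apply: off3; rewrite /scratch; nlia.
have H := @runs_argmin _ _ O C D G d_gt0 small_addr m3 q2 a S3 a3.
apply: runs_seq; apply: (runs_weak (H _ _ _) (leqnn _)) => {H}.
- by move=> l ld; apply: (small_sum_lin d_gt0 DE P_facts (leq0n d) W0 Mc1 gV gc sg).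
- exact: (small_avg d_gt0 DE P_facts (leq0n d) W0 Mc1 gV gc sg).
- by move=> i id; exact: (small_gap d_gt0 DE P_facts (leq0n d) W0 Mc1 gV gc sg).
move=> m4 q4 [e4 -> m424 [k kd [kmin m423 m425]]].
have S4 := std_eqm e4 S3.
have H := @runs_update _ _ O C D G d_gt0 small_addr m4 q2 V a _ _ k S4 kd m423 m424 m425.
apply: runs_seq; apply: (runs_weak (H _ _ _ _ _) (leqnn _)) => {H}.
- by move=> i id; rewrite e4 ?a3//; rewrite /scratch; nlia.
- move=> i j id jd; rewrite -V3//; apply: entry_off => // b hb.
  by apply: e4; rewrite /scratch; nlia.
- by move=> i id; exact: (small_step d_gt0 DE GE P_facts kd kmin W0 Mc1 gV gc sg).
- exact: (small_Dg d_gt0 DE P_facts kd W0 Mc1 gV gc sg).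
- by move=> i j id jd; exact: (small_move d_gt0 DE GE P_facts kd kmin W0 Mc1 gV sg).
move=> m5 q5 [e5 ->].
have S5 : std d D G m5 by apply: std_eqm e5 _; apply: std_wr => //; nlia.
have off5 b : ~~ scratch b -> (b < aV d)%N -> m5 b = m2 b.
  move=> sb ba; rewrite e5// wr_out; last by nlia.
  by rewrite e4// off3//; nlia.
have low5 b : (b < 64)%N -> ~~ scratch b -> m5 b = m b.
  by move=> b64 sb; rewrite off5 ?off2' ?low1//; nlia.
apply: (@runs_op _ _ _ _ _ _ _ _ 15 (m 15%N / 4)) => //=.
  by rewrite low5// (std28 S5).
split.
- by case: S5 => *; split; (rewrite upd_ne; [assumption|by []]).
- by rewrite upd_same.
- by rewrite upd_ne// low5.
- by rewrite upd_ne// low5.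
have bestE : read_block d (upd m5 15 (m 15%N / 4)) (aB d) = read_block d m2 (aB d).
  apply: read_block_ext => j jd; rewrite upd_ne; last by nlia.
  by apply: off5; rewrite /scratch; nlia.
split.
  rewrite bestE /best_update -/x; move: post2; case: (o_sep O x) => [c'|].
    by move=> [_ -> ->]; rewrite best1.
  by move=> [_]; rewrite best1.
exists c, k; split => //.
move=> a' s t i j id jd.
have ij : (i * d + j < L)%N := entry_lt d_gt0 id jd.
rewrite /entry upd_ne; last by nlia.
rewrite e5; last by rewrite /scratch; nlia.
rewrite (@wr_in _ _ _ _ _ (i * d + j)%N)//; last first.
  have : (i.+1 * d <= d.+1 * d)%N by rewrite leq_mul2r ltnS id orbT.
  by rewrite [(i.+1 * d)%N]mulSn; move: jd; clear; lia.
by rewrite divnMDl// divn_small// addn0 modnMDl modn_small.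
Qed.

End body.

(** * Initialization *)

Definition InitRadius : com :=
  (Const (Dir 5) 1 ;; Const (Dir 28) 2 ;; Const (Dir 29) 1 ;;
   For 18 0 (Op Mul (Dir 29) (Dir 29) (Dir 28)))%com.

Definition InitScalars : com :=
  (Op Add (Dir 27) (Dir 0) (Dir 5) ;;
   Op Defs.Sub (Dir 6) (Dir 0) (Dir 5) ;;
   Op Mul (Dir 30) (Dir 27) (Dir 27) ;;
   Const (Dir 28) 4 ;;
   Const (Dir 7) 64 ;;
   Op Add (Dir 8) (Dir 7) (Dir 30) ;;
   Op Add (Dir 9) (Dir 8) (Dir 5) ;;
   Op Add (Dir 10) (Dir 8) (Dir 30) ;;
   Op Add (Dir 11) (Dir 10) (Dir 30) ;;
   Op Add (Dir 12) (Dir 11) (Dir 30) ;;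
   Op Mul (Dir 13) (Dir 0) (Dir 0) ;;
   Const (Dir 33) 8 ;;
   Op Mul (Dir 14) (Dir 33) (Dir 13) ;;
   Op Mul (Dir 13) (Dir 13) (Dir 0) ;;
   Const (Dir 33) 32 ;;
   Op Mul (Dir 13) (Dir 33) (Dir 13))%com.

(* [1 / delta = 2 d rho (1 / lam) (B / eps)] and [E = 8 d ^ 2 rho / delta],
   with the quotients rounded up. *)
Definition InitPrecision : com :=
  (Op FloorDiv (Dir 31) (Dir 5) (Dir 1) ;;
   Op Add (Dir 31) (Dir 31) (Dir 5) ;;
   Op FloorDiv (Dir 32) (Dir 3) (Dir 2) ;;
   Op Add (Dir 32) (Dir 32) (Dir 5) ;;
   Op Add (Dir 33) (Dir 0) (Dir 0) ;;
   Op Mul (Dir 33) (Dir 33) (Dir 29) ;;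
   Op Mul (Dir 34) (Dir 33) (Dir 31) ;;
   Op Mul (Dir 34) (Dir 34) (Dir 32) ;;
   Op Mul (Dir 34) (Dir 34) (Dir 14) ;;
   Op Mul (Dir 34) (Dir 34) (Dir 29) ;;
   Op Div (Dir 15) (Dir 5) (Dir 34) ;;
   Op Defs.Sub (Dir 37) (Dir 4) (Dir 29) ;;
   Op Add (Dir 38) (Dir 37) (Dir 33) ;;
   Const (Dir 35) 1 ;;
   Const (Dir 17) (-1))%com.

Definition InitCount : com :=
  While (Le (Dir 35) (Dir 34))
   (Op Add (Dir 35) (Dir 35) (Dir 35) ;; Op Add (Dir 17) (Dir 17) (Dir 13))%com.

Definition InitSimplex : com :=
  For 18 0
   (For 19 6
    (Op Add (Dir 22) (Dir 37) (Dir 4) ;;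
     Op Add (Dir 21) (Dir 19) (Dir 5) ;;
     If (Le (Dir 18) (Dir 21))
       (If (Le (Dir 21) (Dir 18)) (Op Add (Dir 22) (Dir 38) (Dir 4)) Skip) Skip ;;
     AddrV 20 18 ;;
     Op Add (Ind 20) (Dir 22) (Dir 4)))%com.

Lemma natr_pred (n : nat) : (0 < n)%N -> (n.-1)%:R = n%:R - 1 :> rat.
Proof. by move=> n0; rewrite -subn1 natrB. Qed.

Section init.
Context {R : realType} {d : nat} (O : oracles R d) (C : nat).
Hypothesis d_gt0 : (0 < d)%N.
Variables (lam eps B : rat) (k1 k2 : nat).
Hypothesis k1E : (Num.floor (1 / lam))%:~R + 1 = k1%:R :> rat.
Hypothesis k2E : (Num.floor (B / eps))%:~R + 1 = k2%:R :> rat.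
Hypotheses (k1_gt0 : (0 < k1)%N) (k2_gt0 : (0 < k2)%N).

Let L := blockL d.
Let rho := (2 ^ d.+1)%N.
Let D := (32 * d ^ 3)%N.
Let G := (8 * d ^ 2)%N.
Definition precision : nat := (2 * d * rho * k1 * k2 * G * rho)%N.
Let E := precision.
Definition rounds : nat := (trunc_log 2 E).+1.

Hypothesis small_init : forall x, grid E (64 + 5 * L + 2 * E + D * rounds) x -> small C x.

Let E_gt0 : (0 < E)%N.
Proof. by rewrite /E /precision !muln_gt0 !expn_gt0 d_gt0 k1_gt0 k2_gt0. Qed.

Let small_int x : x \is a Num.int -> `|x| <= (64 + 5 * L + 2 * E + D * rounds)%:R -> small C x.
Proof. by move=> xi xM; apply: small_init; split => //; rewrite rpredM ?natr_int. Qed.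

Let small_nat n : (n <= 64 + 5 * L + 2 * E + D * rounds)%N -> small C n%:R.
Proof. by move=> nM; apply: small_int; rewrite ?natr_int// normr_nat ler_nat. Qed.

Let small0 : small C 0. Proof. exact: (small_nat (leq0n _)). Qed.

Let C0 : (0 < C)%N. Proof. exact: leq_trans small0. Qed.

Let rhoE : (rho <= E)%N.
Proof.
by rewrite /E /precision leq_pmull// !muln_gt0 !expn_gt0 d_gt0 k1_gt0 k2_gt0.
Qed.

Let dL : (d.+1 <= L)%N. Proof. by rewrite /L /blockL leq_pmull. Qed.

Let m0 := Defs.mem (init_state R d lam eps B).

Lemma runs_init_radius q :
  runs O C InitRadius m0 q (10 * d.+1)
    (fun m' q' => eqm m' (upd (upd (upd m0 5 1) 28 2) 29 rho%:R) /\ q' = q).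
Proof.
pose M k := upd (upd (upd m0 5 1) 28 2) 29 (2 ^ k)%:R.
apply: (@runs_le _ _ _ _ _ _ _ (1 + (1 + (1 + (1.+2 * d.+1 + 2))))); last by lia.
apply: runs_seq; apply: (@runs_const _ _ _ _ _ _ 5) => //.
apply: runs_seq; apply: (@runs_const _ _ _ _ _ _ 28) => //; first by apply: small_nat; lia.
apply: runs_seq; apply: (@runs_const _ _ _ _ _ _ 29) => //.
apply: (@runs_for _ _ _ _ _ _ _ _ _ _ _ (fun k m' q' => [/\ eqm m' (M k), q' = q & (k <= d.+1)%N])) => //.
- by move=> k kd; apply: small_nat; have := dL; lia.
- by move=> k m q' x [e -> kd]; split => //; exact: eqm_upd_scratch.
- by move=> k m q' [e _ _]; rewrite !e.
- move=> k m q' kd [e -> _] mk; apply: (@runs_op _ _ _ _ _ _ _ _ 29 (2 ^ k.+1)%:R) => //=.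
  + by rewrite !e// /M /upd /= -natrM expnS mulnC.
  + apply: small_nat; have := rhoE; have : (2 ^ k.+1 <= rho)%N by rewrite leq_exp2l.
    lia.
  split; first by rewrite upd_ne.
  split => // a sa; rewrite /M; have [->|an] := eqVneq a 29%N; first by rewrite !upd_same.
  by rewrite [LHS]upd_ne// [RHS]upd_ne// e// /M upd_ne.
- by move=> m q' [].
Qed.

Let D_le : (D <= D * rounds)%N. Proof. by rewrite leq_pmulr. Qed.
Let d2E : (d ^ 2 = d * d)%N. Proof. by rewrite mulnn. Qed.
Let d3E : (d ^ 3 = d * d * d)%N. Proof. by rewrite mulnn -expnSr. Qed.
Let DE : D = (32 * (d * d * d))%N. Proof. by rewrite /D d3E. Qed.
Let GE : G = (8 * (d * d))%N. Proof. by rewrite /G d2E. Qed.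
Let ddd_le : (d * d * d <= D)%N. Proof. by rewrite DE leq_pmull. Qed.
Let dd_le : (8 * (d * d) <= D)%N.
Proof. by rewrite DE leq_mul// leq_pmulr. Qed.

Lemma runs_init_scalars m q :
  m 0%N = d%:R -> m 4%N = 0 -> m 5%N = 1 ->
  runs O C InitScalars m q 16
    (fun m' q' => [/\ std d D G m', q' = q &
       forall a, (a < 4)%N || (a == 29%N) || (63 < a)%N -> m' a = m a]).
Proof.
move=> md m4 m5; have h1 := dL; have h2 := D_le; have h4 := dd_le; have h5 := ddd_le.
have sn n : (n <= 64 + 5 * L + D)%N -> small C n%:R by move=> nL; apply: small_nat; lia.
have LE : (d.+1 * d.+1)%N = L by [].
apply: (@runs_seq _ _ _ _ _ _ _ _ 1 15); apply: (@runs_op _ _ _ _ _ _ _ _ 27 d.+1%:R) => //=.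
- by rewrite md m5 natr1.
- by apply: sn; lia.
apply: (@runs_seq _ _ _ _ _ _ _ _ 1 14); apply: (@runs_op _ _ _ _ _ _ _ _ 6 d.-1%:R) => //=.
- by rewrite /upd /= md m5 -subn1 natrB.
- by apply: sn; lia.
apply: (@runs_seq _ _ _ _ _ _ _ _ 1 13); apply: (@runs_op _ _ _ _ _ _ _ _ 30 L%:R) => //=.
- by rewrite /upd /= -natrM LE.
- by apply: sn; lia.
apply: (@runs_seq _ _ _ _ _ _ _ _ 1 12); apply: (@runs_const _ _ _ _ _ _ 28) => //; first by apply: sn; lia.
apply: (@runs_seq _ _ _ _ _ _ _ _ 1 11); apply: (@runs_const _ _ _ _ _ _ 7) => //; first by apply: sn; lia.
apply: (@runs_seq _ _ _ _ _ _ _ _ 1 10); apply: (@runs_op _ _ _ _ _ _ _ _ 8 (64 + L)%:R) => //=.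
- by rewrite /upd /= natrD.
- by apply: sn; lia.
apply: (@runs_seq _ _ _ _ _ _ _ _ 1 9); apply: (@runs_op _ _ _ _ _ _ _ _ 9 (64 + L).+1%:R) => //=.
- by rewrite /upd /= m5 natr1.
- by apply: sn; lia.
apply: (@runs_seq _ _ _ _ _ _ _ _ 1 8); apply: (@runs_op _ _ _ _ _ _ _ _ 10 (64 + 2 * L)%:R) => //=.
- by rewrite /upd /= -natrD; congr (_%:R); lia.
- by apply: sn; lia.
apply: (@runs_seq _ _ _ _ _ _ _ _ 1 7); apply: (@runs_op _ _ _ _ _ _ _ _ 11 (64 + 3 * L)%:R) => //=.
- by rewrite /upd /= -natrD; congr (_%:R); lia.
- by apply: sn; lia.
apply: (@runs_seq _ _ _ _ _ _ _ _ 1 6); apply: (@runs_op _ _ _ _ _ _ _ _ 12 (64 + 4 * L)%:R) => //=.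
- by rewrite /upd /= -natrD; congr (_%:R); lia.
- by apply: sn; lia.
apply: (@runs_seq _ _ _ _ _ _ _ _ 1 5); apply: (@runs_op _ _ _ _ _ _ _ _ 13 (d * d)%:R) => //=.
- by rewrite /upd /= md natrM.
- by apply: sn; lia.
apply: (@runs_seq _ _ _ _ _ _ _ _ 1 4); apply: (@runs_const _ _ _ _ _ _ 33) => //; first by apply: sn; lia.
apply: (@runs_seq _ _ _ _ _ _ _ _ 1 3); apply: (@runs_op _ _ _ _ _ _ _ _ 14 G%:R) => //=.
- by rewrite /upd /= GE [RHS]natrM.
- by apply: sn; lia.
apply: (@runs_seq _ _ _ _ _ _ _ _ 1 2); apply: (@runs_op _ _ _ _ _ _ _ _ 13 (d * d * d)%:R) => //=.
- by rewrite /upd /= md [RHS]natrM.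
- by apply: sn; lia.
apply: (@runs_seq _ _ _ _ _ _ _ _ 1 1); apply: (@runs_const _ _ _ _ _ _ 33) => //; first by apply: sn; lia.
apply: (@runs_op _ _ _ _ _ _ _ _ 13 D%:R) => //=.
- by rewrite /upd /= DE [RHS]natrM.
- by apply: sn; lia.
split => //.
- move=> a ha; rewrite !upd_ne//; move: ha; clear; lia.
Qed.

Lemma runs_init_precision m q :
  std d D G m -> m 1%N = lam -> m 2%N = eps -> m 3%N = B -> m 29%N = rho%:R ->
  runs O C InitPrecision m q 15
    (fun m' q' => [/\ std d D G m', q' = q,
       [/\ m' 15%N = E%:R^-1, m' 17%N = -1, m' 34%N = E%:R & m' 35%N = 1],
       m' 37%N = - rho%:R /\ m' 38%N = - rho%:R + 2 * d%:R * rho%:R &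
       forall a, (63 < a)%N -> m' a = m a]).
Proof.
move=> S m1 m2 m3 m29; have [md m4 m5 _ _ _ _ _ _ _ _ m14 _ _] := S.
have r0 : (0 < rho)%N by rewrite expn_gt0.
have G0 : (0 < G)%N by rewrite muln_gt0 expn_gt0 d_gt0.
have sE n : (n <= E)%N -> small C n%:R by move=> nE; apply: small_nat; lia.
pose p1 := (2 * d)%N; pose p2 := (p1 * rho)%N; pose p3 := (p2 * k1)%N.
pose p4 := (p3 * k2)%N; pose p5 := (p4 * G)%N.
have EE : E = (p5 * rho)%N by [].
have p5E : (p5 <= E)%N by rewrite EE leq_pmulr.
have p4E : (p4 <= E)%N by apply: leq_trans p5E; rewrite /p5 leq_pmulr.
have p3E : (p3 <= E)%N by apply: leq_trans p4E; rewrite /p4 leq_pmulr.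
have p2E : (p2 <= E)%N by apply: leq_trans p3E; rewrite /p3 leq_pmulr.
have p1E : (p1 <= E)%N by apply: leq_trans p2E; rewrite /p2 leq_pmulr.
have k1E' : (k1 <= E)%N.
  by apply: leq_trans p3E; rewrite /p3 leq_pmull// !muln_gt0 d_gt0.
have k2E' : (k2 <= E)%N.
  by apply: leq_trans p4E; rewrite /p4 leq_pmull// !muln_gt0 d_gt0 r0.
apply: (@runs_seq _ _ _ _ _ _ _ _ 1 14); apply: (@runs_op _ _ _ _ _ _ _ _ 31 (k1.-1)%:R) => //=.
- by rewrite m5 m1 -[LHS](addrK 1) k1E -subn1 natrB.
- by apply: sE; apply: leq_trans k1E'; rewrite leq_pred.
apply: (@runs_seq _ _ _ _ _ _ _ _ 1 13); apply: (@runs_op _ _ _ _ _ _ _ _ 31 k1%:R) => //=.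
- by rewrite /upd /= m5 natr1 prednK.
- exact: sE.
apply: (@runs_seq _ _ _ _ _ _ _ _ 1 12); apply: (@runs_op _ _ _ _ _ _ _ _ 32 (k2.-1)%:R) => //=.
- by rewrite /upd /= m2 m3 -[LHS](addrK 1) k2E -subn1 natrB.
- by apply: sE; apply: leq_trans k2E'; rewrite leq_pred.
apply: (@runs_seq _ _ _ _ _ _ _ _ 1 11); apply: (@runs_op _ _ _ _ _ _ _ _ 32 k2%:R) => //=.
- by rewrite /upd /= m5 natr1 prednK.
- exact: sE.
apply: (@runs_seq _ _ _ _ _ _ _ _ 1 10); apply: (@runs_op _ _ _ _ _ _ _ _ 33 p1%:R) => //=.
- by rewrite /upd /= md -natrD; congr (_%:R); rewrite /p1; lia.
- exact: sE.
apply: (@runs_seq _ _ _ _ _ _ _ _ 1 9); apply: (@runs_op _ _ _ _ _ _ _ _ 33 p2%:R) => //=.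
- by rewrite /upd /= m29 [RHS]natrM.
- exact: sE.
apply: (@runs_seq _ _ _ _ _ _ _ _ 1 8); apply: (@runs_op _ _ _ _ _ _ _ _ 34 p3%:R) => //=.
- by rewrite /upd /= [RHS]natrM.
- exact: sE.
apply: (@runs_seq _ _ _ _ _ _ _ _ 1 7); apply: (@runs_op _ _ _ _ _ _ _ _ 34 p4%:R) => //=.
- by rewrite /upd /= [RHS]natrM.
- exact: sE.
apply: (@runs_seq _ _ _ _ _ _ _ _ 1 6); apply: (@runs_op _ _ _ _ _ _ _ _ 34 p5%:R) => //=.
- by rewrite /upd /= m14 [RHS]natrM.
- exact: sE.
apply: (@runs_seq _ _ _ _ _ _ _ _ 1 5); apply: (@runs_op _ _ _ _ _ _ _ _ 34 E%:R) => //=.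
- by rewrite /upd /= m29 EE [RHS]natrM.
- exact: sE.
apply: (@runs_seq _ _ _ _ _ _ _ _ 1 4); apply: (@runs_op _ _ _ _ _ _ _ _ 15 E%:R^-1) => //=.
- by rewrite /upd /= m5 div1r.
- apply: small_init; split; first by rewrite mulVf ?pnatr_eq0 -?lt0n// rpred1.
  rewrite ger0_norm ?invr_ge0//; apply: (@le_trans _ _ 1); last by rewrite ler1n; lia.
  by rewrite invf_le1 ?ltr0n// ler1n.
apply: (@runs_seq _ _ _ _ _ _ _ _ 1 3); apply: (@runs_op _ _ _ _ _ _ _ _ 37 (- rho%:R)) => //=.
- by rewrite /upd /= m4 m29 sub0r.
- apply: small_int; rewrite ?rpredN ?natr_int// normrN normr_nat ler_nat.
  by have := rhoE; lia.
apply: (@runs_seq _ _ _ _ _ _ _ _ 1 2); apply: (@runs_op _ _ _ _ _ _ _ _ 38 (- rho%:R + 2 * d%:R * rho%:R)) => //=.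
- by rewrite /upd /= /p2 /p1 !natrM.
- rewrite -!natrM -/p1 -/p2; apply: small_int; first by rewrite rpredD ?rpredN ?natr_int.
  apply: le_trans (ler_normD _ _) _; rewrite normrN !normr_nat -natrD ler_nat.
  by have := rhoE; lia.
apply: (@runs_seq _ _ _ _ _ _ _ _ 1 1); apply: (@runs_const _ _ _ _ _ _ 35) => //.
apply: (@runs_const _ _ _ _ _ _ 17) => //.
split => //.
- by case: S => *; split; (rewrite !upd_ne; [assumption|by []..]).
by move=> a ha; rewrite !upd_ne//; move: ha; clear; lia.
Qed.

Lemma runs_init_count m q :
  std d D G m -> m 17%N = -1 -> m 34%N = E%:R -> m 35%N = 1 ->
  runs O C InitCount m q (3 * rounds + 1)
    (fun m' q' => [/\ q' = q, m' 17%N = (D * rounds).-1%:R &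
       forall a, a != 17%N -> a != 35%N -> m' a = m a]).
Proof.
move=> S m17 m34 m35.
have D0 : (0 < D)%N by rewrite DE muln_gt0 !muln_gt0 d_gt0.
pose Inv k m' (q' : nat -> R) := [/\ q' = q, m' 17%N = (D * k)%:R - 1,
  m' 35%N = (2 ^ k)%:R & forall a, a != 17%N -> a != 35%N -> m' a = m a].
apply: (@runs_while _ _ _ _ _ _ _ _ rounds 2 Inv) => //.
- move=> k m1 q1 kr [-> n17 n35 fr].
  have pwE : (2 ^ k <= E)%N.
    by apply: leq_trans (trunc_logP (isT : (1 < 2)%N) E_gt0); rewrite leq_exp2l.
  split; first by rewrite /= n35 fr// m34 ler_nat.
  apply: (@runs_seq _ _ _ _ _ _ _ _ 1 1); apply: (@runs_op _ _ _ _ _ _ _ _ 35 (2 ^ k.+1)%:R) => //=.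
  + by rewrite n35 -natrD addnn -mul2n -expnS.
  + by apply: small_nat; rewrite expnS; lia.
  apply: (@runs_op _ _ _ _ _ _ _ _ 17 ((D * k.+1)%:R - 1)) => //=.
  + by rewrite /upd /= n17 fr// (std13 S) mulnS natrD; ring.
  + have DK : (0 < D * k.+1)%N by rewrite (muln_gt0 D) D0.
    rewrite -natr_pred//; apply: small_nat.
    have : (D * k.+1 <= D * rounds)%N by rewrite leq_mul2l kr orbT.
    by lia.
  split => //.
  by move=> a a17 a35; rewrite !upd_ne// fr.
- move=> m1 q1 [-> n17 n35 fr]; split.
    rewrite /= n35 fr// m34 ler_nat -ltnNge; exact: trunc_log_ltn.
  have DK : (0 < D * rounds)%N by rewrite (muln_gt0 D) D0.
  by split => //; rewrite n17 natr_pred.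
- by split => //; rewrite ?muln0 ?expn0 // m17 sub0r.
Qed.

Lemma runs_init_simplex m q :
  std d D G m -> m 37%N = - rho%:R -> m 38%N = - rho%:R + 2 * d%:R * rho%:R ->
  runs O C InitSimplex m q (100 * d.+1 ^ 2)
    (fun m' q' => eqm m' (wr (aV d) (d.+1 * d)%N
        (fun n => V0 (d := d) rho%:R (n %/ d)%N (n %% d)%N) m) /\ q' = q).
Proof.
move=> S m37 m38.
have hL := dL; have aVE : (aV d = 64 + 3 * L)%N by [].
have s37 : small C (- rho%:R).
  apply: small_int; rewrite ?rpredN ?natr_int// normrN normr_nat ler_nat.
  by have := rhoE; lia.
have s38 : small C (- rho%:R + 2 * d%:R * rho%:R).
  rewrite -!natrM; apply: small_int; first by rewrite rpredD ?rpredN ?natr_int.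
  apply: le_trans (ler_normD _ _) _; rewrite normrN !normr_nat -natrD ler_nat.
  have : (2 * d * rho <= E)%N.
    rewrite /E /precision -!(mulnA (2 * d * rho)%N) leq_pmulr//.
    by rewrite !muln_gt0 !expn_gt0 d_gt0 k1_gt0 k2_gt0.
  by have := rhoE; lia.
have small_addr n : (n <= 64 + 5 * blockL d)%N -> small C n%:R.
  by rewrite -/L => nL; apply: small_nat; lia.
pose v i j := V0 (d := d) rho%:R i j.
pose val n := v (n %/ d)%N (n %% d)%N.
have valE i j : (j < d)%N -> val (i * d + j)%N = v i j.
  by move=> jd; rewrite /val divnMDl// divn_small// addn0 modnMDl modn_small.
pose M n := wr (aV d) n val m.
have SM k' m' : eqm m' (M k') -> std d D G m'.
  by move=> e; apply: std_eqm e _; apply: std_wr => //; nlia.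
apply: (@runs_weak _ _ _ _ _ _ _ ((9.+2 * d.-1.+1 + 2).+2 * d.+1 + 2) _
  (fun m' q' => eqm m' (M (d.+1 * d)%N) /\ q' = q)) => //; last by rewrite prednK//; clear; nia.
apply: (@runs_for _ _ _ _ _ _ _ _ _ _ _ (fun i m' q' => eqm m' (M (i * d)%N) /\ q' = q)) => //.
- by move=> n kn; apply: small_addr; rewrite -/L; nlia.
- by move=> n m' q' x [e ->]; split => //; exact: eqm_upd_scratch.
- by move=> n m' q' [e _]; have S' := SM _ _ e; rewrite (std0 S') (std5 S').
- move=> i m1 q1 id [e1 ->] m1i.
  apply: (@runs_for _ _ _ _ _ _ _ _ _ _ _ (fun j m' q' =>
     [/\ eqm m' (M (i * d + j)%N), q' = q & m' 18%N = i%:R])) => //.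
  + by move=> n kn; apply: small_addr; rewrite -/L; nlia.
  + by move=> n m' q' x [e -> ?]; split => //; exact: eqm_upd_scratch.
  + by move=> n m' q' [e _ _]; have S' := SM _ _ e; rewrite (std6 S') (std5 S').
  + move=> j m2 q2 jd [e2 -> m2i] m2j; have {}jd : (j < d)%N by nlia.
    have S2 := SM _ _ e2.
    have ij : (i * d + j < L)%N := entry_lt d_gt0 id jd.
    have m237 : m2 37%N = - rho%:R by rewrite e2// /M wr_out ?m37//; nlia.
    have m238 : m2 38%N = - rho%:R + 2 * d%:R * rho%:R by rewrite e2// /M wr_out ?m38//; nlia.
    apply: (@runs_seq _ _ _ _ _ _ _ _ 1 8).
    apply: (@runs_op _ _ _ _ _ _ _ _ 22 (- rho%:R)) => //=.
      by rewrite m237 (std4 S2) addr0.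
    apply: (@runs_seq _ _ _ _ _ _ _ _ 1 7).
    apply: (@runs_op _ _ _ _ _ _ _ _ 21 (j.+1)%:R) => //=.
      by rewrite /upd /= m2j (std5 S2) natr1.
      by apply: small_addr; rewrite -/L; nlia.
    apply: (@runs_seq _ _ _ _ _ _ _ _ 3 4).
    pose m3 x := upd (upd (upd m2 22 (- rho%:R)) 21 j.+1%:R) 22 x.
    have tail m' : eqm m' m2 -> m' 18%N = i%:R -> m' 19%N = j%:R -> m' 22%N = v i j ->
        runs O C (AddrV 20 18;; Op Add (Ind 20) (Dir 22) (Dir 4))%com m' q 4
          (fun m'0 q' => m'0 19%N = j%:R /\
             [/\ eqm m'0 (M (i * d + j.+1)%N), q' = q & m'0 18%N = i%:R]).
      move=> e' n18 n19 n22; have S' := std_eqm e' S2.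
      apply: (@runs_seq _ _ _ _ _ _ _ _ 3 1); apply: (@runs_addrV _ _ _ _ D G d_gt0 small_addr _ _ i j) => //.
      apply: (@runs_op _ _ _ _ _ _ _ _ (aV d + (i * d + j))%N (v i j)) => //=.
      - by lookup; rewrite n22 (std4 S') addr0.
      - by lookup; rewrite truncn_nat.
      - by rewrite /v /V0; case: ifP.
      split; first by lookup.
      split; [|by []|by lookup].
      rewrite addnS; apply: eqm_wrS; last by rewrite valE.
      by apply: eqm_upd_scratch => //; apply: eqm_trans e' e2.
    have eA x : eqm (upd (upd m2 22 x) 21 j.+1%:R) m2 by do 2 apply: eqm_upd_scratch => //.
    apply: runs_if => //=; rewrite /upd /= m2i ler_nat -/(upd m2 22 _).
    case: ifPn => [ij1|]; last rewrite -ltnNge => ji.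
      apply: runs_if => //=; rewrite /upd /= m2i ler_nat.
      case: ifPn => [ji1|]; last rewrite -ltnNge => ji.
        apply: (@runs_op _ _ _ _ _ _ _ _ 22 (- rho%:R + 2 * d%:R * rho%:R)) => //=.
          by rewrite m238 (std4 S2) addr0.
        apply: tail; [by apply: eqm_upd_scratch => //; exact: eA|by lookup|by lookup|lookup].
        by rewrite /v /V0 (_ : i == j.+1)// eqn_leq ij1.
      apply: runs_skip => //; apply: tail; [exact: eA|by lookup|by lookup|lookup].
      by rewrite /v /V0 (_ : i == j.+1 = false)//; apply/negbTE; rewrite neq_ltn ji.
    apply: (@runs_le _ _ _ _ _ _ _ 1) => //; apply: runs_skip => //; apply: tail; [exact: eA|by lookup|by lookup|lookup].
    by rewrite /v /V0 (_ : i == j.+1 = false)//; apply/negbTE; rewrite neq_ltn ji orbT.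
  + by move=> m2 q2 [e2 -> m2i]; split => //; rewrite prednK// in e2; rewrite mulSn addnC.
  + by split; rewrite ?addn0// ?upd_ne//; exact: eqm_upd_scratch.
- by split => //; rewrite mul0n /M wr0; exact: eqm_refl.
Qed.

End init.

Definition Init : com :=
  (InitRadius ;; InitScalars ;; InitPrecision ;; InitCount ;; InitSimplex ;;
   EvalQ 10 0)%com.

Definition Program : com :=
  If (Le (Dir 0) (Dir 4)) Skip
    (Init ;; For 16 17 Body ;; Op Add (Dir 0) (Dir 10) (Dir 4))%com.

Section init.
Context {R : realType} {d : nat} (O : oracles R d) (C : nat).
Hypothesis d_gt0 : (0 < d)%N.
Variables (lam eps B : rat) (k1 k2 : nat).
Hypothesis k1E : (Num.floor (1 / lam))%:~R + 1 = k1%:R :> rat.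
Hypothesis k2E : (Num.floor (B / eps))%:~R + 1 = k2%:R :> rat.
Hypotheses (k1_gt0 : (0 < k1)%N) (k2_gt0 : (0 < k2)%N).

Let L := blockL d.
Let rho := (2 ^ d.+1)%N.
Let D := (32 * d ^ 3)%N.
Let G := (8 * d ^ 2)%N.
Let E := precision (d := d) k1 k2.
Let N := (D * rounds (d := d) k1 k2)%N.

Hypothesis small_init : forall x, grid E (64 + 5 * L + 2 * E + N) x -> small C x.
Hypothesis small_zero : (1 + bitlenv (0 : 'rV[rat]_d) <= C)%N.

Lemma runs_init q :
  runs O C Init (Defs.mem (init_state R d lam eps B)) q
    (10 * d.+1 + (16 + (15 + (3 * rounds (d := d) k1 k2 + 1 + (100 * d.+1 ^ 2 + 1)))))
    (fun m' q' => [/\ std d D G m', m' 15%N = E%:R^-1, m' 17%N = N.-1%:R,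
       forall i j, (i <= d)%N -> (j < d)%N -> entry d m' i j = V0 (d := d) rho%:R i j &
       read_block d m' (aB d) = 0 /\ q' 0%N = o_valQ O 0]).
Proof.
have hL : (d.+1 <= L)%N by rewrite /L /blockL leq_pmull.
have aVE : (aV d = 64 + 3 * L)%N by []. have aBE : (aB d = 64 + 2 * L)%N by [].
set m0 := Defs.mem _.
have m00 a : (3 < a)%N -> m0 a = 0 by case: a => [|[|[|[|a]]]].
apply: runs_seq; apply: (runs_weak (runs_init_radius O d_gt0 lam eps B k1_gt0 k2_gt0 small_init q) (leqnn _)).
move=> m1 q1 [e1 ->].
have m1z a : (63 < a)%N -> m1 a = 0.
  move=> a63; rewrite e1; last by rewrite /scratch; move: a63; clear; lia.
  do 3 (rewrite upd_ne; last by move: a63; clear; lia).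
  by apply: m00; move: a63; clear; lia.
apply: runs_seq; apply: (runs_weak (runs_init_scalars O d_gt0 k1_gt0 k2_gt0 small_init q _ _ _) (leqnn _));
  [by rewrite e1..|].
move=> m2 q2 [S2 -> f2].
apply: runs_seq; apply: (runs_weak (runs_init_precision O d_gt0 k1E k2E k1_gt0 k2_gt0 small_init q S2 _ _ _ _) (leqnn _));
  [by rewrite f2// e1..|].
move=> m3 q3 [S3 -> [m315 m317 m334 m335] [m337 m338] f3].
apply: runs_seq; apply: (runs_weak (runs_init_count O d_gt0 k1_gt0 k2_gt0 small_init q S3 m317 m334 m335) (leqnn _)).
move=> m4 q4 [-> m417 f4].
have S4 : std d D G m4 by case: S3 => *; split; (rewrite f4; [assumption|by []|by []]).
apply: runs_seq; apply: (runs_weak (runs_init_simplex O d_gt0 k1_gt0 k2_gt0 small_init q S4 _ _) (leqnn _));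
  [by rewrite f4..|].
move=> m5 q5 [e5 ->].
have S5 : std d D G m5 by apply: std_eqm e5 _; exact: std_wr.
have low5 a : (a < 64)%N -> ~~ scratch a -> m5 a = m4 a.
  by move=> a64 sa; rewrite e5// wr_out//; nlia.
have b5 : read_block d m5 (aB d) = 0.
  apply/rowP => j; rewrite !mxE; have jd := ltn_ord j.
  rewrite e5; last by rewrite /scratch; nlia.
  rewrite wr_out; last by nlia.
  by rewrite f4 ?f3 ?f2; first apply: m1z; nlia.
apply: (@runs_evalQ _ _ _ _ _ _ 0) => //.
  by rewrite /= (std10 S5) truncn_nat.
split => //.
- by rewrite low5// f4.
- by rewrite low5.
move=> i j id jd; have ij : (i * d + j < L)%N := entry_lt d_gt0 id jd.
rewrite /entry e5; last by rewrite /scratch; nlia.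
rewrite (@wr_in _ _ _ _ _ (i * d + j)%N)//; last first.
  have : (i.+1 * d <= d.+1 * d)%N by rewrite leq_mul2r ltnS id orbT.
  by rewrite [(i.+1 * d)%N]mulSn; move: jd; clear; lia.
by rewrite divnMDl// divn_small// addn0 modnMDl modn_small.
Qed.

End init.

(** * Correctness *)

Lemma fact_le_exp n : ((n.+1)`! <= n.+1 ^ n)%N.
Proof.
elim: n => [|n IH] //; rewrite factS expnS leq_mul2l /=.
by apply: leq_trans IH _; case: n => // n; rewrite leq_exp2r.
Qed.

Lemma grid_centroid d Dv W (V : nat -> nat -> rat) j :
  (forall i, (i <= d)%N -> grid Dv W (V i j)) ->
  grid (Dv * d.+1) W (centroid (d := d) V j).
Proof.
move=> gV; have gs : grid Dv (d.+1 * W) (\sum_(0 <= i < d.+1) V i j).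
  by apply: grid_sum => i id; exact: gV.
have [] := grid_div (ltn0Sn d) gs; split => //; move: gs => [_].
by rewrite /centroid normrM natrM normfV normr_nat ler_pdivrMr ?ltr0n// mulrC.
Qed.

Section main.
Context {R : realType} {d : nat} (pR pL pT : {poly nat}).
Variables (X : set 'rV[R]_d) (F : 'rV[R]_d -> 'rV[R]_d) (Q : 'rV[R]_d -> R).
Variables (xmax : 'rV[R]_d) (lam eps B : rat) (O : oracles R d) (C beta k1 k2 : nat).
Hypotheses (d_gt0 : (0 < d)%N) (cvX : convex_set X) (cpX : compact X).
Hypotheses (isoX : isotropic pR X) (eps0 : 0 < eps) (B0 : 0 < B) (lam0 : 0 < lam).
Hypothesis sepX : separation_oracle X (o_sep O).
Hypothesis oracleQ : Q_oracle X Q (o_valQ O).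
Hypothesis oracleF : F_evaluator pL pT X F (o_evalF O) (o_timeF O).
Hypothesis boundF : forall x, X x -> enorm (F x) <= ratr B.
Hypothesis smoothQ : smooth_VI X F (ratr lam) (ratr lam - 1) Q xmax.
Hypothesis k1E : (Num.floor (1 / lam))%:~R + 1 = k1%:R :> rat.
Hypothesis k2E : (Num.floor (B / eps))%:~R + 1 = k2%:R :> rat.

Let L := blockL d.
Let rho := (2 ^ d.+1)%N.
Let D := (32 * d ^ 3)%N.
Let G := (8 * d ^ 2)%N.
Let P := (64 * D * d.+1 ^ 4)%N.
Let E := precision (d := d) k1 k2.
Let K := rounds (d := d) k1 k2.
Let N := (D * K)%N.
Let W0 := (2 * d * rho)%N.

Hypothesis small_init : forall x, grid E (64 + 5 * L + 2 * E + N) x -> small C x.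
Hypothesis small_zero : (1 + bitlenv (0 : 'rV[rat]_d) <= C)%N.
Hypothesis small_center : forall n (V : nat -> nat -> rat), (n < N)%N ->
  (forall i j, (i <= d)%N -> (j < d)%N -> grid (D ^ n) (W0 * 3 ^ n) (V i j)) ->
  (bitlenv (center (d := d) V) <= beta)%N.
Hypothesis small_query : (1 + beta + pT.[d] + pL.[beta] <= C)%N.
Hypothesis small_step : forall n Df Mc, (n < N)%N -> (0 < Df <= 2 ^ pL.[beta])%N -> (0 < Mc)%N ->
  (Mc <= 2 ^ pL.[beta] + E * 4 ^ n + 1)%N ->
  forall y, grid (size_den (d := d) (D ^ n) Df D) (size_num (W0 * 3 ^ n) Mc P) y -> small C y.
Hypothesis small_tol : forall n, (n < N)%N -> small C (E%:R^-1 / 4 ^+ n / 4).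

Let lk1 : 1 <= lam * k1%:R.
Proof.
rewrite -ler_pdivrMl// mulr1 -k1E -[leLHS]div1r.
by have /andP[_ /ltW] := floor_itv (1 / lam); rewrite intrD.
Qed.

Let bk2 : B <= eps * k2%:R.
Proof.
rewrite -ler_pdivrMl// mulrC -k2E.
by have /andP[_ /ltW] := floor_itv (B / eps); rewrite intrD.
Qed.

Let k1_gt0 : (0 < k1)%N.
Proof. by rewrite lt0n; apply/eqP => k0; move: lk1; rewrite k0 mulr0 ler10. Qed.

Let k2_gt0 : (0 < k2)%N.
Proof. by rewrite lt0n; apply/eqP => k0; move: bk2; rewrite k0 mulr0 leNgt B0. Qed.

Let rho_gt0 : (0 < rho)%N. Proof. by rewrite expn_gt0. Qed.
Let W0_gt0 : (0 < W0)%N. Proof. by rewrite !muln_gt0 d_gt0 rho_gt0. Qed.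
Let D_gt0 : (0 < D)%N. Proof. by rewrite muln_gt0 expn_gt0 d_gt0. Qed.
Let E_gt0 : (0 < E)%N.
Proof. by rewrite /E /precision !muln_gt0 !expn_gt0 d_gt0 k1_gt0 k2_gt0. Qed.

Let Wk_gt0 : (0 < W0 * k1 * k2)%N.
Proof. by rewrite /W0 /rho !muln_gt0 !expn_gt0 d_gt0 k1_gt0 k2_gt0. Qed.

Let delta : R := ((W0 * k1 * k2)%:R)^-1.

Let delta_gt0 : 0 < delta.
Proof. by rewrite invr_gt0 ltr0n. Qed.

Let delta_le1 : delta <= 1.
Proof. by rewrite invf_le1 ?ltr0n ?ler1n. Qed.

Let E_delta : E%:R * delta = (G * rho)%:R :> R.
Proof.
have -> : E = (W0 * k1 * k2 * (G * rho))%N by rewrite /E /precision -/rho -/G /W0 !mulnA.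
by rewrite /delta natrM mulrAC mulfV ?mul1r// pnatr_eq0 -lt0n.
Qed.

Let deltaE : delta = E%:R^-1 * (8 * d%:R ^+ 2 * rho%:R).
Proof.
have e0 : E%:R != 0 :> R by rewrite pnatr_eq0 -lt0n.
by rewrite -[LHS](mulKf e0) E_delta /G !natrM natrX.
Qed.

Let Xmax : X xmax. Proof. by case: smoothQ => _ _ []. Qed.

Let box v : X v -> forall i, `|v 0 i| <= rho%:R.
Proof. by move=> Xv i; rewrite natrX; apply: (isotropic_box cvX cpX isoX). Qed.

Let rho_ge1 : 1 <= rho%:R :> R. Proof. by rewrite ler1n. Qed.

Let q0 : 'rV[R]_d := (1 - delta) *: xmax.

Definition progress (n : nat) (V : nat -> nat -> rat) (v : R) : Prop :=
  Q xmax - ratr eps <= v \/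
  enclosed (d := d) V q0 (delta / 2) (((1 - D%:R^-1) ^+ d) ^+ n * (2 * d%:R * rho%:R) ^+ d).

Let good_start : progress 0 (V0 (d := d) rho%:R) (Q 0).
Proof.
right; rewrite expr0 mul1r.
have := @enclosed_init R d d_gt0 rho%:R q0 (delta / 2); rewrite ratr_nat; apply.
  by rewrite ltr0n.
exact: (target_box Xmax delta_gt0 delta_le1 rho_ge1 box).
Qed.

Let final_progress V v : progress N V v -> Q xmax - ratr eps <= v.
Proof.
case=> // /enclosed_volume; rewrite divr_ge0 ?(ltW delta_gt0)// => /(_ isT) H.
exfalso; move: H; apply/negP; rewrite -ltNge.
have D1 : 0 <= 1 - D%:R^-1 :> R.
  by rewrite subr_ge0 invf_le1 ?ltr0n// ler1n.
rewrite -exprM mulnC exprM.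
have h1 : (1 - D%:R^-1 : R) ^+ N <= 2^-1 ^+ K by exact: half_exp.
have h2 : 2^-1 ^+ K < E%:R^-1 :> R.
  rewrite exprVn ltf_pV2 ?posrE ?exprn_gt0 ?ltr0n// -natrX ltr_nat.
  exact: trunc_log_ltn.
have dR : 1 <= d%:R :> R by rewrite ler1n.
have rR : 0 < rho%:R :> R by rewrite ltr0n.
have fl : (d.+1)`!%:R <= d.+1%:R ^+ d :> R by rewrite -natrX ler_nat fact_le_exp.
apply: (@le_lt_trans _ _ ((d.+1%:R * (2^-1 ^+ K * (2 * d%:R * rho%:R))) ^+ d)).
  have y0 : 0 <= 2 * d%:R * rho%:R :> R by rewrite !mulr_ge0.
  rewrite [leRHS]exprMn; apply: ler_pM => //.
    by apply: mulr_ge0; apply: exprn_ge0 => //; apply: exprn_ge0.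
  rewrite [leRHS]exprMn; apply: ler_wpM2r; first exact: exprn_ge0.
  by rewrite lerXn2r ?nnegrE ?exprn_ge0 ?invr_ge0.
rewrite ltr_pXn2r ?nnegrE ?mulr_ge0 ?exprn_ge0 ?invr_ge0 ?divr_ge0 ?(ltW delta_gt0)//.
rewrite deltaE -natr1.
apply: (@lt_le_trans _ _ ((d%:R + 1) * (E%:R^-1 * (2 * d%:R * rho%:R)))).
  by rewrite ltr_pM2l ?ltr_pM2r// ?mulr_gt0// ?addr_gt0// ltr0n.
have e0 : 0 < E%:R^-1 :> R by rewrite invr_gt0 ltr0n.
move: dR rR e0; move: (d%:R : R) (rho%:R : R) (E%:R^-1 : R) => x y z x1 y0 z0.
have -> : z * (8 * x ^+ 2 * y) / 2 = (z * y) * (4 * x ^+ 2) by field.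
have -> : (x + 1) * (z * (2 * x * y)) = (z * y) * (2 * x * (x + 1)) by ring.
by apply: ler_wpM2l; [apply: mulr_ge0; exact: ltW|nra].
Qed.

Let e0_gt0 n : 0 < E%:R^-1 / 4 ^+ n :> rat.
Proof. by rewrite divr_gt0 ?invr_gt0 ?ltr0n ?exprn_gt0. Qed.

Let step_progress n V c k (b : 'rV[rat]_d) v b' v' :
  let a := lin (d := d) V c in
  let s := (\sum_(0 <= i < d.+1) a i) / d.+1%:R in
  let t i := step_num D (G%:R * (s - a k)) (a i - s) / D%:R in
  (forall i j, (i <= d)%N -> (j < d)%N -> grid (D ^ n) (W0 * 3 ^ n) (V i j)) ->
  cut_vector O (center (d := d) V) (E%:R^-1 / 4 ^+ n) c ->
  (k <= d)%N -> (forall i, (i <= d)%N -> a k <= a i) ->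
  X (ratv R b) -> v = Q (ratv R b) ->
  best_update O (center (d := d) V) b v b' v' ->
  progress n V v ->
  [/\ X (ratv R b'), v' = Q (ratv R b') &
     progress n.+1 (fun i j => V k j + (V i j - V k j) * t i) v'].
Proof.
move=> a s t gV cutc kd kmin Xb vb; set x := center V in cutc *.
have xE j : x 0 j = centroid (d := d) V j by rewrite mxE.
have step : (forall i, 0 < \sum_(j < d) ratr (c j) *
     (ratr (centroid (d := d) V j) - corner q0 (delta / 2) i j)) ->
    enclosed (d := d) V q0 (delta / 2) (((1 - D%:R^-1) ^+ d) ^+ n * (2 * d%:R * rho%:R) ^+ d) ->
    enclosed (d := d) (fun i j => V k j + (V i j - V k j) * t i) q0 (delta / 2)
      (((1 - D%:R^-1) ^+ d) ^+ n.+1 * (2 * d%:R * rho%:R) ^+ d).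
  by move=> cut en; rewrite exprS -mulrA; exact: enclosed_step.
move: cutc; rewrite /best_update /cut_vector; have := sepX x.
case: (o_sep O x) => [c'|].
  move=> [cmax csep] cE [-> ->] pr; split => //.
  case: pr => [|en]; first by left.
  right; apply: step en => i.
  under eq_bigr => j _ do rewrite cE -xE.
  apply: (separation_cut (X := X) (rho := rho%:R) (W := (W0 * 3 ^ n)%:R)
    d_gt0 cvX (isotropic_inner isoX) Xmax delta_gt0 delta_le1 rho_ge1 box i cmax csep) => //.
  - move=> j; rewrite -ratr_norm -(ratr_nat R) ler_rat xE.
    by have [] := grid_centroid (fun i id => gV i j id (ltn_ord j)).
  - rewrite ler_nat /W0 -mulnA mulnCA leq_pmulr// !muln_gt0 d_gt0 expn_gt0//.
  have -> : ratr (E%:R^-1 / 4 ^+ n) = E%:R^-1 / 4 ^+ n :> R.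
    by rewrite fmorph_div/= fmorphV/= ratr_nat rmorphXn/= ratr_nat.
  have -> : 4 * d%:R * (W0 * 3 ^ n)%:R * (E%:R^-1 / 4 ^+ n) = delta * (3 ^+ n / 4 ^+ n) :> R.
    rewrite deltaE /W0 !natrM natrX; set y := 3 ^+ n; set z := (4 ^+ n)^-1; ring.
  rewrite ler_piMr ?(ltW delta_gt0)// ler_pdivrMr ?exprn_gt0// mul1r.
  by rewrite lerXn2r ?nnegrE ?ler_nat.
move=> Xx cE best pr.
have vx := oracleQ Xx.
have [Fx _ _] := oracleF Xx.
have [Xb' vb' [vv' xv']] : [/\ X (ratv R b'), v' = Q (ratv R b') & v <= v' /\ Q (ratv R x) <= v'].
  move: best; case: ifPn => [vq [-> ->]|]; first by rewrite vx; split => //; rewrite -vx.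
  by rewrite -ltNge => qv [-> ->]; split => //; split => //; rewrite -vx ltW.
split => //.
case: pr => [ok|en]; first by left; exact: le_trans vv'.
have [ok|bad] := lerP (Q xmax - ratr eps) (Q (ratv R x)).
  by left; exact: le_trans xv'.
right; apply: step en => i.
pose cF : 'rV[R]_d := F (ratv R x).
have cFE (j : 'I_d) : ratr (c j) = cF 0 j by rewrite cE /cF Fx mxE.
under eq_bigr => j _ do rewrite cFE -xE.
have -> : \sum_(j < d) cF 0 j * (ratr (x 0 j) - corner q0 (delta / 2) i j) =
    \sum_(j < d) cF 0 j * (ratv R x 0 j - corner q0 (delta / 2) i j).
  by apply: eq_bigr => j _; rewrite [ratv R x 0 j]mxE.
apply: (evaluation_cut (X := X) (rho := rho%:R) (B := ratr B) (gap := ratr lam * ratr eps)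
   Xmax delta_gt0 rho_ge1 box) => //.
- exact: boundF.
- have [_ _ _ /(_ _ Xx)] := smoothQ; rewrite subrK; apply: lt_le_trans.
  rewrite -mulrBr ltr_pM2l ?ltr0q//; lra.
- have Wk : 0 < (W0 * k1 * k2)%:R :> R by rewrite ltr0n.
  rewrite /delta ler_pdivrMl// -!(ratr_nat R) -!rmorphM/= ler_rat.
  rewrite !natrM -/W0.
  have w0 : 0 <= W0%:R :> rat by [].
  have -> : 2 * d%:R * rho%:R = W0%:R :> rat by rewrite !natrM.
  have -> : W0%:R * k1%:R * k2%:R * (lam * eps) = W0%:R * ((lam * k1%:R) * (eps * k2%:R)) by ring.
  rewrite ler_wpM2l//; apply: le_trans bk2 _; rewrite ler_peMl//.
  by rewrite mulr_ge0// ltW.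
Qed.

Let progress_ext n V V' v : (forall i j, (i <= d)%N -> (j < d)%N -> V i j = V' i j) ->
  progress n V v -> progress n V' v.
Proof.
move=> e; rewrite /progress /enclosed; have -> // : Vmat (R := R) (d := d) V = Vmat V'.
apply/matrixP => i j; rewrite !mxE e//.
by rewrite -ltnS.
Qed.

Let small_natr n : (n <= 64 + 5 * L + N)%N -> small C n%:R.
Proof.
move=> nM; apply: small_init; split; first by rewrite -natrM natr_int.
by rewrite normr_nat ler_nat; apply: leq_trans nM _; clear; lia.
Qed.

Let N_gt0 : (0 < N)%N. Proof. by rewrite (muln_gt0 D) D_gt0. Qed.

Lemma leq_horner (p : {poly nat}) a b : (a <= b)%N -> (p.[a] <= p.[b])%N.
Proof.
move=> ab; rewrite !horner_coef; apply: leq_sum => i _.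
rewrite leq_mul2l !natrXE; case: (nat_of_ord i) => [|k]; first by rewrite leqnn orbT.
by rewrite leq_exp2r// ab orbT.
Qed.

Let cut_grid n V c : (n < N)%N ->
  (forall i j, (i <= d)%N -> (j < d)%N -> grid (D ^ n) (W0 * 3 ^ n) (V i j)) ->
  cut_vector O (center (d := d) V) (E%:R^-1 / 4 ^+ n) c ->
  exists Df Mc, [/\ (0 < Mc)%N, forall j, (j < d)%N -> grid Df Mc (c j) &
    forall y, grid (size_den (d := d) (D ^ n) Df D) (size_num (W0 * 3 ^ n) Mc P) y -> small C y].
Proof.
move=> nN gV; rewrite /cut_vector; have := sepX (center V).
case: (o_sep O (center V)) => [c'|].
  move=> [cmax _] cE; exists 1%N, (E * 4 ^ n + 1)%N; split; first by rewrite addn1.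
    move=> j jd; rewrite (cE (Ordinal jd)); apply: grid_int; first exact: intr_int.
    have c1 : `|c' 0 (Ordinal jd)| <= 1.
      by rewrite -cmax; exact: (le_bigmax _ (fun i => `|c' 0 i|)).
    set r := c' 0 _ / _.
    have r1 : `|r| <= (E * 4 ^ n)%:R.
      have -> : r = c' 0 (Ordinal jd) * (E * 4 ^ n)%:R.
        by rewrite /r invf_div invrK natrM natrX [_ * E%:R]mulrC.
      by rewrite normrM normr_nat ler_piMl.
    have /andP[f1 f2] := floor_itv r.
    move: f1 f2 r1; rewrite natrD intrD !ler_norml => f1 f2 /andP[r1 r2].
    by apply/andP; split; lra.
  by apply: small_step; rewrite ?addn1 ?expn_gt0// ltnS leq_addl.
move=> Xx cE; have [_ lF _] := oracleF Xx.
have [Df /andP[Df0 Dfl] gc] := bitlen_grid (o_evalF O (center V)).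
have le : (bitlenv (o_evalF O (center V)) <= pL.[beta])%N.
  by apply: leq_trans lF _; apply: leq_horner; exact: small_center gV.
exists Df, (2 ^ bitlenv (o_evalF O (center V)))%N; split; first by rewrite expn_gt0.
  by move=> j jd; rewrite (cE (Ordinal jd)); exact: gc.
apply: small_step => //; first by rewrite Df0/=; apply: leq_trans Dfl _; rewrite leq_exp2l.
  by rewrite expn_gt0.
by rewrite -addnA; apply: leq_trans _ (leq_addr _ _); rewrite leq_exp2l.
Qed.

Lemma runs_program q :
  runs O C Program (Defs.mem (init_state R d lam eps B)) q
    (10 * d.+1 + (16 + (15 + (3 * K + 1 + (100 * d.+1 ^ 2 + 1)))) +
      ((1000 * d.+1 ^ 2).+2 * N + 2 + 1)).+1
    (fun m' _ => let a := read_block d m' (eval_loc m' (Ind 0)) in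
       X (ratv R a) /\ Q xmax - ratr eps <= Q (ratv R a)).
Proof.
have C0 : (0 < C)%N by exact: leq_trans (small_natr (leq0n _)).
apply: runs_if => //=; rewrite lern0.
rewrite eqn0Ngt d_gt0 /=.
apply: runs_seq; apply: (runs_weak (runs_init O d_gt0 k1E k2E k1_gt0 k2_gt0 small_init small_zero q) (leqnn _)).
move=> m q1 [S m15 m17 eV [best q10]].
have ratv0 : ratv R (0 : 'rV[rat]_d) = 0 by apply/rowP => i; rewrite !mxE rmorph0.
have X0 : X (ratv R (0 : 'rV[rat]_d)).
  rewrite ratv0; apply: (isotropic_inner isoX); rewrite /eball/= /enorm /dot.
  by rewrite big1 ?sqrtr0// => i _; rewrite mxE mul0r.
pose Inv n (m : nat -> rat) (q : nat -> R) := [/\ std d D G m,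
  m 15%N = E%:R^-1 / 4 ^+ n, m 17%N = N.-1%:R,
  forall i j, (i <= d)%N -> (j < d)%N -> grid (D ^ n) (W0 * 3 ^ n) (entry d m i j) &
  [/\ X (ratv R (read_block d m (aB d))), q 0%N = Q (ratv R (read_block d m (aB d))) &
     progress n (entry d m) (q 0%N)]].
have NE : N.-1.+1 = N by rewrite prednK.
apply: runs_seq; rewrite -[X in (_ * X + 2)%N]NE.
apply: (@runs_for _ _ _ _ 16 17 N.-1 _ _ _ _ Inv) => //.
- by rewrite NE => k kN; apply: small_natr; apply: leq_trans kN (leq_addl _ _).
- move=> k m' q' x [S' h15 h17 gV [Xb qb pr]].
  have bE : read_block d (upd m' 16 x) (aB d) = read_block d m' (aB d).
    by apply: read_block_ext => j _; rewrite upd_ne.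
  split; rewrite ?bE//; by case: S' => *; split; (rewrite upd_ne; [assumption|by []]).
- by move=> k m' q' [S' _ h17 _ _]; split => //; exact: std5 S'.
- move=> k m' q'; rewrite -ltnS NE => kN [S' h15 h17 gV [Xb qb pr]] h16.
  have sx := small_center kN gV; have xq := small_query.
  have P_facts := size_facts (_ : (32 <= D)%N) (erefl G) (erefl P).
  have H := @runs_body _ _ O C D G P d_gt0 (eqxx D) (eqxx G) (P_facts _) _ m' q' _ _ S' _ gV.
  apply: (runs_weak (H _ _ _ _ _ _ _) (leqnn _)) => {H}.
  + by rewrite leq_pmulr// expn_gt0 d_gt0.
  + by move=> n nL; apply: small_natr; apply: leq_trans nL (leq_addr _ _).
  + by rewrite muln_gt0 W0_gt0 expn_gt0.
  + by apply: leq_trans _ xq; rewrite -!addnA leq_add2l; apply: leq_trans sx (leq_addr _ _).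
  + move=> oN; apply: leq_trans _ xq; have := sepX (center (entry d m')); rewrite oN => Xx.
    have [_ lF tF] := oracleF Xx.
    apply: leq_add; first by rewrite leq_add// leq_add2l.
    by apply: leq_trans lF _; exact: leq_horner.
  + by rewrite h15 => c; exact: cut_grid.
  + by rewrite h15; exact: small_tol.
  move=> m2 q2 [S2 e15 e16 e17 [bu [c [kk [cutc kkd kmin eV2]]]]].
  rewrite e16; split => //; split => //.
  + by rewrite e15 h15 -mulrA -invfM -exprSr.
  + by rewrite e17.
  + move=> i j id jd; rewrite eV2// expnSr [(3 ^ _)%N]expnS mulnCA.
    have W1 : (0 < W0 * 3 ^ k)%N by rewrite (muln_gt0 W0) W0_gt0 expn_gt0.
    exact: (grid_next d_gt0 (eqxx D) (eqxx G) kkd kmin W1 (isT : (0 < 1)%N) gV id jd).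
  move: cutc; rewrite h15 => cutc.
  have [Xb' vb' pr'] := step_progress gV cutc kkd kmin Xb qb bu pr.
  split => //; apply: progress_ext pr' => i j id jd.
  by rewrite eV2.
- move=> m' q'; rewrite NE => -[S' h15 h17 gV [Xb qb pr]].
  apply: (@runs_op _ _ _ _ _ _ _ _ 0 (aB d)%:R) => //=.
  + by rewrite (std10 S') (std4 S') addr0.
  + by apply: small_natr; rewrite /aB; clear; rewrite -addnA leq_add2l; lia.
  have -> : read_block d (upd m' 0 (aB d)%:R) (Num.truncn (upd m' 0 (aB d)%:R 0%N)) =
      read_block d m' (aB d).
    by rewrite upd_same truncn_nat; apply: read_block_ext => j _; rewrite upd_ne.
  by rewrite -qb; split => //; exact: final_progress pr.
split.
- by [].
- by rewrite m15 expr0 divr1.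
- by [].
- move=> i j id jd; rewrite eV// expn0 expn0 muln1 /V0.
  have h0 : (0 : rat) <= rho%:R by [].
  have d1 : (1 : rat) <= d%:R by rewrite ler1n.
  apply: grid_int; first by case: ifP => _; rewrite ?rpredD ?rpredM ?rpredN ?natr_int.
  rewrite /W0 !natrM ler_norml; case: ifP => _; apply/andP; split; nra.
split.
- by rewrite best.
- by rewrite best q10 oracleQ.
apply: (@progress_ext _ (V0 (d := d) rho%:R)); first by move=> i j id jd; rewrite eV.
by rewrite q10 oracleQ// ratv0.
Qed.

End main.

(** * Resource bounds *)

Lemma leq_pow2M x y a b : (x <= 2 ^ a -> y <= 2 ^ b -> x * y <= 2 ^ (a + b))%N.
Proof. by move=> xa yb; rewrite expnD leq_mul. Qed.

Lemma leq_pow2X x a k : (x <= 2 ^ a -> x ^ k <= 2 ^ (a * k))%N.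
Proof. by move=> xa; rewrite expnM; case: k => // k; rewrite leq_exp2r. Qed.

Lemma leq_pow2 n a : (n <= a -> n <= 2 ^ a)%N.
Proof. by move=> na; apply: leq_trans na (ltnW (ltn_expl _ _)). Qed.

Lemma leq_pow2_weak x a b : (x <= 2 ^ a -> a <= b -> x <= 2 ^ b)%N.
Proof. by move=> xa ab; apply: leq_trans xa _; rewrite leq_exp2l. Qed.

Section polynomial_bounds.

Definition polybnd (f : nat -> nat) : Prop :=
  exists p : {poly nat}, forall n, (f n <= p.[n])%N.

Lemma polybnd_const c : polybnd (fun=> c).
Proof. by exists c%:P => n; rewrite hornerC. Qed.

Lemma polybnd_id : polybnd id.
Proof. by exists 'X => n; rewrite hornerX. Qed.

Lemma polybndD f g : polybnd f -> polybnd g -> polybnd (fun n => f n + g n)%N.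
Proof. by move=> [p fp] [r gr]; exists (p + r) => n; rewrite hornerD leq_add. Qed.

Lemma polybndM f g : polybnd f -> polybnd g -> polybnd (fun n => f n * g n)%N.
Proof. by move=> [p fp] [r gr]; exists (p * r) => n; rewrite hornerM leq_mul. Qed.

Lemma polybndX f k : polybnd f -> polybnd (fun n => f n ^ k)%N.
Proof.
move=> pf; elim: k => [|k [p IH]]; first exact: (polybnd_const 1).
have [r fr] := polybndM pf (ex_intro _ p IH).
by exists r => n; rewrite expnS.
Qed.

Lemma polybnd_comp (p : {poly nat}) f : polybnd f -> polybnd (fun n => p.[f n]).
Proof.
move=> [r fr]; exists (p \Po r) => n; rewrite horner_comp; exact: leq_horner.
Qed.

End polynomial_bounds.

Section resources.
Variables pL pT : {poly nat}.

Definition D_bound (n : nat) : nat := (32 * n ^ 3)%N.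
Definition K_bound (n : nat) : nat := (5 * n + 10)%N.
Definition N_bound (n : nat) : nat := (D_bound n * K_bound n)%N.
Definition P_bound (n : nat) : nat := (64 * D_bound n * (n + 1) ^ 4)%N.
Definition V_bound (n : nat) : nat := (K_bound n + 2 * N_bound n)%N.
Definition center_den (n : nat) : nat := (D_bound n * N_bound n + (n + 1))%N.
Definition query_bound (n : nat) : nat :=
  (n * (center_den n + (V_bound n + center_den n) + 2))%N.
Definition answer_bound (n : nat) : nat := pL.[query_bound n].
Definition step_den (n : nat) : nat :=
  (n + 1 + (answer_bound n + (D_bound n * N_bound n + D_bound n)))%N.
Definition step_numer (n : nat) : nat :=
  (P_bound n + (V_bound n + (answer_bound n + V_bound n + 2)))%N.
Definition init_numer (n : nat) : nat :=
  (64 + 5 * (n + 1) ^ 2 + N_bound n + K_bound n + 2)%N.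
Definition unit_cost (n : nat) : nat :=
  (3 + query_bound n + pT.[n] + answer_bound n
   + (step_den n + (step_numer n + step_den n))
   + (V_bound n + 2 + (V_bound n + 2))
   + (K_bound n + (init_numer n + K_bound n)) + 2 * n)%N.
Definition step_count (n : nat) : nat :=
  (10 * (n + 1) + (16 + (15 + (3 * K_bound n + 1 + (100 * (n + 1) ^ 2 + 1)))) +
    ((1000 * (n + 1) ^ 2 + 2) * N_bound n + 2 + 1) + 1)%N.

Ltac polybnd_tac := repeat match goal with
  | |- polybnd (fun n => addn (@?f n) (@?g n)) => apply: (@polybndD f g)
  | |- polybnd (fun n => muln (@?f n) (@?g n)) => apply: (@polybndM f g)
  | |- polybnd (fun n => expn (@?f n) ?k) => apply: (@polybndX f k)
  | |- polybnd (fun n => horner ?p (@?f n)) => apply: (@polybnd_comp p f)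
  | |- polybnd (fun n => n) => exact: polybnd_id
  | |- polybnd (fun _ => ?c) => exact: (polybnd_const c)
  | |- _ => assumption
  end.

Lemma polybnd_time : polybnd (fun n => step_count n * unit_cost n + 2)%N.
Proof.
have pD : polybnd D_bound by rewrite /D_bound; polybnd_tac.
have pK : polybnd K_bound by rewrite /K_bound; polybnd_tac.
have pN : polybnd N_bound by rewrite /N_bound; polybnd_tac.
have pP : polybnd P_bound by rewrite /P_bound; polybnd_tac.
have pV : polybnd V_bound by rewrite /V_bound; polybnd_tac.
have pcd : polybnd center_den by rewrite /center_den; polybnd_tac.
have pq : polybnd query_bound by rewrite /query_bound; polybnd_tac.
have pa : polybnd answer_bound by rewrite /answer_bound; polybnd_tac.
have psd : polybnd step_den by rewrite /step_den; polybnd_tac.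
have psn : polybnd step_numer by rewrite /step_numer; polybnd_tac.
have pin : polybnd init_numer by rewrite /init_numer; polybnd_tac.
have pu : polybnd unit_cost by rewrite /unit_cost; polybnd_tac.
have ps : polybnd step_count by rewrite /step_count; polybnd_tac.
by polybnd_tac.
Qed.

End resources.

Section costs.
Context {d : nat} (pL pT : {poly nat}).
Variables (k1 k2 n : nat).
Hypotheses (d_gt0 : (0 < d)%N) (k1_gt0 : (0 < k1)%N) (k2_gt0 : (0 < k2)%N).
Hypotheses (dn : (d <= n)%N) (En : (precision (d := d) k1 k2 <= 2 ^ (5 * n + 9))%N).

Let L := blockL d.
Let rho := (2 ^ d.+1)%N.
Let D := (32 * d ^ 3)%N.
Let G := (8 * d ^ 2)%N.
Let P := (64 * D * d.+1 ^ 4)%N.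
Let E := precision (d := d) k1 k2.
Let K := rounds (d := d) k1 k2.
Let N := (D * K)%N.
Let W0 := (2 * d * rho)%N.
Let C := unit_cost pL pT n.
Let f := answer_bound pL n.

Let E_gt0 : (0 < E)%N.
Proof. by rewrite /E /precision !muln_gt0 !expn_gt0 d_gt0 k1_gt0 k2_gt0. Qed.

Let Kn : (K <= K_bound n)%N.
Proof. by rewrite /K /rounds /K_bound addnS ltnS -[leqRHS](@trunc_expnK 2)// leq_trunc_log. Qed.

Let dn3 : (d ^ 3 <= n ^ 3)%N. Proof. by rewrite leq_exp2r. Qed.
Let Dn : (D <= D_bound n)%N. Proof. by rewrite leq_mul2l dn3. Qed.
Let Nn : (N <= N_bound n)%N. Proof. exact: leq_mul. Qed.
Let d1n : (d.+1 <= n + 1)%N. Proof. by rewrite addn1 ltnS. Qed.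
Let Pn : (P <= P_bound n)%N.
Proof. by apply: leq_mul; [apply: leq_mul|rewrite leq_exp2r]. Qed.

Let En' : (E <= 2 ^ K_bound n)%N.
Proof. by apply: leq_trans En _; rewrite leq_exp2l// leq_add2l. Qed.

Let W0E : (W0 <= E)%N.
Proof.
have -> : E = (W0 * (k1 * k2 * (G * rho)))%N by rewrite /E /precision -/rho -/G /W0 !mulnA.
by rewrite leq_pmulr// !muln_gt0 k1_gt0 k2_gt0 !expn_gt0 d_gt0.
Qed.

Let pow4 i : (i < N)%N -> (4 ^ i <= 2 ^ (2 * N_bound n))%N.
Proof.
move=> iN; rewrite (expnM 2 2) leq_exp2l//; apply: leq_trans Nn; exact: ltnW.
Qed.

Let Wi i : (i < N)%N -> (W0 * 3 ^ i <= 2 ^ V_bound n)%N.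
Proof.
move=> iN; rewrite /V_bound; apply: leq_pow2M; first exact: leq_trans En'.
by apply: leq_trans (pow4 iN); case: i {iN} => // i; rewrite leq_exp2r.
Qed.

Let Ei i : (i < N)%N -> (E * 4 ^ i <= 2 ^ V_bound n)%N.
Proof. by move=> iN; rewrite /V_bound; apply: leq_pow2M => //; exact: pow4. Qed.

Let Di i : (i < N)%N -> (D ^ i <= 2 ^ (D_bound n * N_bound n))%N.
Proof.
move=> iN; apply: (@leq_pow2_weak _ (D_bound n * i)%N).
  by apply: leq_pow2X; exact: leq_pow2.
by rewrite leq_mul2l; apply/orP; right; apply: leq_trans Nn; exact: ltnW.
Qed.

Let D_gt0 : (0 < D)%N. Proof. by rewrite muln_gt0 expn_gt0 d_gt0. Qed.

Lemma small_of_grid Dg Mg a b x : (0 < Dg)%N -> (Dg <= 2 ^ a)%N -> (Mg <= 2 ^ b)%N ->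
  (3 + (a + (b + a)) <= C)%N -> grid Dg Mg x -> small C x.
Proof.
move=> D0 Da Mb ab xg; apply: leq_trans ab.
have := grid_bitlen Da (leq_pow2M Mb Da) D0 xg; rewrite -(leq_add2l 1) => h.
by apply: leq_trans h _; clear; lia.
Qed.

Lemma small_init_cost x : grid E (64 + 5 * L + 2 * E + N) x -> small C x.
Proof.
apply: (@small_of_grid _ _ (K_bound n) (init_numer n)) => //.
  have h5 : (5 * L <= 5 * (n + 1) ^ 2)%N.
    by rewrite leq_mul2l /L /blockL -mulnn leq_mul.
  have h1 : (64 + 5 * L + N <= 2 ^ (64 + 5 * (n + 1) ^ 2 + N_bound n))%N.
    by apply: leq_pow2; rewrite leq_add// leq_add2l.
  rewrite /init_numer [(2 ^ (_ + 2))%N]expnD [(2 ^ (_ + K_bound n))%N]expnD.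
  have a0 : (0 < 2 ^ (64 + 5 * (n + 1) ^ 2 + N_bound n))%N by rewrite expn_gt0.
  have b0 : (0 < 2 ^ K_bound n)%N by rewrite expn_gt0.
  move: a0 b0 h1 En'; move: (2 ^ (64 + _ + _))%N (2 ^ K_bound n)%N.
  move: L N E; clear => l m e x y *; have -> : (2 ^ 2 = 4)%N by [].
  by nia.
by rewrite /C /unit_cost; lia.
Qed.

Lemma small_zero_cost : (1 + bitlenv (0 : 'rV[rat]_d) <= C)%N.
Proof.
have -> : bitlenv (0 : 'rV[rat]_d) = (2 * d)%N.
  rewrite /bitlenv (eq_bigr (fun=> 2%N)) ?sum_nat_const ?card_ord ?[(d * 2)%N]mulnC// => i _.
  by rewrite mxE.
by rewrite /C /unit_cost; move: dn; lia.
Qed.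

Lemma center_cost i (V : nat -> nat -> rat) : (i < N)%N ->
  (forall a b, (a <= d)%N -> (b < d)%N -> grid (D ^ i) (W0 * 3 ^ i) (V a b)) ->
  (bitlenv (center (d := d) V) <= query_bound n)%N.
Proof.
move=> iN gV; rewrite /bitlenv; apply: (@leq_trans (\sum_(j < d) (center_den n +
    (V_bound n + center_den n) + 2))%N); last by rewrite sum_nat_const card_ord leq_mul2r dn orbT.
apply: leq_sum => j _; rewrite mxE.
have Dd : (D ^ i * d.+1 <= 2 ^ center_den n)%N.
  by apply: leq_pow2M; [exact: Di|exact: leq_pow2].
apply: (@grid_bitlen (D ^ i * d.+1) (W0 * 3 ^ i)) => //.
- by apply: leq_pow2M => //; exact: Wi.
- by rewrite muln_gt0 expn_gt0 D_gt0.
by apply: grid_centroid => l ld; exact: gV.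
Qed.

Lemma query_cost : (1 + query_bound n + pT.[d] + f <= C)%N.
Proof.
have := leq_horner pT dn; rewrite -/f /C /unit_cost -/f; lia.
Qed.

Lemma step_cost i Df Mc : (i < N)%N -> (0 < Df <= 2 ^ f)%N -> (0 < Mc)%N ->
  (Mc <= 2 ^ f + E * 4 ^ i + 1)%N ->
  forall y, grid (size_den (d := d) (D ^ i) Df D) (size_num (W0 * 3 ^ i) Mc P) y -> small C y.
Proof.
move=> iN /andP[Df0 Dff] Mc0 Mcf y.
apply: (@small_of_grid _ _ (step_den pL n) (step_numer pL n)).
- by rewrite /size_den (muln_gt0 d.+1) (muln_gt0 Df) (muln_gt0 (D ^ i)) expn_gt0 D_gt0 Df0.
- apply: leq_pow2M; first exact: leq_pow2.
  apply: leq_pow2M => //; apply: leq_pow2M; [exact: Di|exact: leq_pow2].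
- apply: leq_pow2M; first exact: leq_pow2.
  apply: leq_pow2M; first exact: Wi.
  apply: leq_trans Mcf _; rewrite -/f [(2 ^ (_ + 2))%N]expnD [(2 ^ (_ + _))%N]expnD.
  have a0 : (0 < 2 ^ f)%N by rewrite expn_gt0.
  have b0 : (0 < 2 ^ V_bound n)%N by rewrite expn_gt0.
  move: a0 b0 (Ei iN); move: (E * _)%N (2 ^ f)%N (2 ^ V_bound n)%N.
  by clear; move=> x y z *; have -> : (2 ^ 2 = 4)%N by []; nia.
by rewrite /C /unit_cost; lia.
Qed.

Lemma tol_cost i : (i < N)%N -> small C (E%:R^-1 / 4 ^+ i / 4).
Proof.
move=> iN; apply: (@small_of_grid (E * 4 ^ i * 4) 1 (V_bound n + 2) 0).
- by rewrite (muln_gt0 (E * 4 ^ i)) (muln_gt0 E) E_gt0 expn_gt0.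
- by apply: leq_pow2M => //; exact: Ei.
- by rewrite expn_gt0.
- by rewrite /C /unit_cost; lia.
have -> : E%:R^-1 / 4 ^+ i / 4 = (E * 4 ^ i * 4)%:R^-1 :> rat.
  by rewrite (natrM _ (E * 4 ^ i)) (natrM _ E) natrX 2!invfM.
have e0 : (0 < E * 4 ^ i * 4)%N by rewrite (muln_gt0 (E * 4 ^ i)) (muln_gt0 E) E_gt0 expn_gt0.
split; first by rewrite mulVf// pnatr_eq0 -lt0n.
by rewrite normfV normr_nat invf_le1 ?ltr0n// ler1n.
Qed.

Lemma time_cost (t : nat) :
  (t <= (10 * d.+1 + (16 + (15 + (3 * K + 1 + (100 * d.+1 ^ 2 + 1)))) +
      ((1000 * d.+1 ^ 2).+2 * N + 2 + 1)).+1 * C)%N ->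
  (t <= step_count n * C + 2)%N.
Proof.
move=> tC; apply: leq_trans tC _; apply: leq_trans (leq_addr _ _); apply: leq_mul => //.
have d2 : (d.+1 ^ 2 <= (n + 1) ^ 2)%N by rewrite leq_exp2r.
have dN : ((1000 * d.+1 ^ 2).+2 * N <= (1000 * (n + 1) ^ 2 + 2) * N_bound n)%N.
  by apply: leq_mul => //; move: d2; clear; lia.
by rewrite /step_count; move: d2 dN d1n Kn; clear; lia.
Qed.

End costs.

Lemma floor_clog2 (q : rat) : 0 < q ->
  exists2 k : nat, (Num.floor q)%:~R + 1 = k%:R :> rat & (0 < k <= 2 ^ (clog2 q).+1)%N.
Proof.
move=> q0; have f0 : (0 <= Num.floor q)%R by rewrite floor_ge0 ltW.
exists (absz (Num.floor q)).+1.
  by rewrite -natr1 natr_absz ger0_norm.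
rewrite ltn0Sn/= expnS mul2n -addnn /clog2; set c := absz (Num.ceil q).
have c0 : (0 < 2 ^ up_log 2 c)%N by rewrite expn_gt0.
have fc : (absz (Num.floor q) <= c)%N.
  have fq : Num.floor q <= Num.ceil q.
    by rewrite -(ler_int rat) (le_trans (floor_le q))// ceil_ge.
  by rewrite -lez_nat /c !gez0_abs// (le_trans f0).
by rewrite -addn1 leq_add// (leq_trans fc)// up_logP.
Qed.

Lemma precision_bound d k1 k2 c1 c2 : (k1 <= 2 ^ c1.+1 -> k2 <= 2 ^ c2.+1 ->
  precision (d := d) k1 k2 <= 2 ^ (5 * (d + c2 + c1) + 9))%N.
Proof.
move=> h1 h2; apply: (@leq_pow2_weak _ (1 + d + d.+1 + c1.+1 + c2.+1 + (3 + d * 2) + d.+1)%N).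
  by rewrite /precision; do ![apply: leq_pow2M => //]; [exact: leq_pow2|apply: leq_pow2X; exact: leq_pow2].
lia.
Qed.

Theorem theorem4p15 :
  exists prog : com, forall pR pL pT : {poly nat}, exists pTime : {poly nat},
  forall (R : realType) (d : nat) (X : set 'rV[R]_d)
    (F : 'rV[R]_d -> 'rV[R]_d) (Q : 'rV[R]_d -> R) (xmax : 'rV[R]_d)
    (lam eps B : rat) (O : oracles R d),
  convex_set X -> compact X -> isotropic pR X ->
  0 < eps -> 0 < B -> 0 < lam -> lam <= 1 ->
  separation_oracle X (o_sep O) ->
  Q_oracle X Q (o_valQ O) ->
  F_evaluator pL pT X F (o_evalF O) (o_timeF O) ->
  (forall x, X x -> enorm (F x) <= ratr B) ->
  smooth_VI X F (ratr lam) (ratr lam - 1) Q xmax ->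
  exists (t : nat) (s : state R),
    [/\ exec O prog (init_state R d lam eps B) t s,
        (t <= pTime.[d + clog2 (B / eps) + clog2 lam^-1])%N,
        X (ratv R (output d s)) &
        Q (ratv R (output d s)) >= Q xmax - ratr eps].
Proof.
exists Program => pR pL pT; have [pTime timeP] := polybnd_time pL pT.
exists pTime => R d X F Q xmax lam eps B O cvX cpX isoX eps0 B0 lam0 _ sepX oQ oF bF smooth.
have [k1 k1E /andP[k1_gt0 k1_le]] : exists2 k : nat, (Num.floor (1 / lam))%:~R + 1 = k%:R :> rat &
    (0 < k <= 2 ^ (clog2 lam^-1).+1)%N.
  by rewrite div1r; apply: floor_clog2; rewrite invr_gt0.
have [k2 k2E /andP[k2_gt0 k2_le]] := floor_clog2 (divr_gt0 B0 eps0).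
pose n := (d + clog2 (B / eps) + clog2 lam^-1)%N.
have [d0|d_gt0] := posnP d.
  have x0 (u v : 'rV[R]_d) : u = v by apply/rowP => -[i id]; exfalso; rewrite d0 in id.
  exists 2%N, (init_state R d lam eps B); split.
  - apply: (@ExecIf _ _ _ _ _ _ _ 1); have -> : eval_cond (init_state R d lam eps B) (Le (Dir 0) (Dir 4)) = true; last exact: ExecSkip.
    by rewrite /= lern0 d0.
  - by apply: leq_trans (timeP n); exact: leq_addl.
  - by have [_ _ [Xm _] _] := smooth; rewrite (x0 (ratv R _) xmax).
  - by rewrite (x0 (ratv R _) xmax) gerBl ler0q ltW.
have dn : (d <= n)%N by rewrite /n -addnA leq_addr.
have En := precision_bound d k1_le k2_le.
have [t [m [q [ex tC [Xa Qa]]]]] := runs_program d_gt0 cvX cpX isoX eps0 B0 lam0 sepX oQ oF bF smooth k1E k2E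
  (small_init_cost pL pT d_gt0 k1_gt0 k2_gt0 dn En)
  (small_zero_cost pL pT d_gt0 k1_gt0 k2_gt0 dn En)
  (center_cost d_gt0 k1_gt0 k2_gt0 dn En)
  (query_cost pL pT d_gt0 k1_gt0 k2_gt0 dn En)
  (step_cost pT d_gt0 k1_gt0 k2_gt0 dn En)
  (tol_cost pL pT d_gt0 k1_gt0 k2_gt0 dn En)
  (fun=> 0).
exists t, (State m q); split => //.
by apply: leq_trans (timeP n); exact: (time_cost dn En tC).
Qed.
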